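(* Let $S$ be a connected graph other than $P_3$. Then the implication ''for every 2-connected claw-$o$-heavy graph $G$, if $G$ is $S$-$f$-heavy then $G$ is Hamiltonian'' holds if and only if (up to isomorphism) $S$ is one of $P_4,P_5,P_6,Z_1,Z_2,B,N,W$.
   Context: All graphs are finite and simple. $d(v)$ denotes the degree of $v$ in $G$, and $d_{G'}(u,v)$ denotes the distance between $u$ and $v$ in a graph $G'$. A graph is Hamiltonian if it has a cycle through all its vertices. $o$-heavy: Let $G$ be a graph on $n$ vertices. For a given graph $H$, $G$ is $H$-$o$-heavy if for every induced subgraph $G'$ of $G$ isomorphic to $H$ there exist two nonadjacent vertices $x,y\in V(G')$ such that $d(x)+d(y)\geq n$ (degrees taken in $G$). Claw-$o$-heavy means $K_{1,3}$-$o$-heavy. $f$-heavy: Let $G$ be a graph on $n$ vertices. For a given graph $H$, $G$ is $H$-$f$-heavy if for every induced subgraph $G'$ of $G$ isomorphic to $H$ and every two vertices $u,v\in V(G')$, $d_{G'}(u,v)=2$ implies $\max\{d(u),d(v)\}\geq n/2$ (degrees taken in $G$). Particular graphs: $P_i$ is the path on $i$ vertices; $Z_i$ is obtained from a triangle by attaching a path with $i$ edges at one of its vertices; $B$ (bull) is obtained from a triangle by attaching one pendant edge at each of two of its vertices; $N$ (net) is obtained from a triangle by attaching one pendant edge at each of its three vertices; $W$ (wounded) has vertices $a_1,a_2,a_3,b_1,b_2,c_1$ and edges $a_1a_2,a_2a_3,a_3a_1,a_1b_1,b_1c_1,a_2b_2$. *)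

(* Defs.v *)
From mathcomp Require Import all_boot.

Set Implicit Arguments.
Unset Strict Implicit.
Unset Printing Implicit Defensive.

Record sgraph := SGraph {
  vertex :> finType;
  edge : rel vertex;
  edge_sym : symmetric edge;
  edge_irrefl : irreflexive edge }.

Arguments edge {s} _ _.

Definition deg (G : sgraph) (v : G) : nat := #|[set w : G | edge v w]|.

Definition iso (G H : sgraph) : Prop :=
  exists2 f : G -> H, bijective f & {mono f : x y / edge x y}.

Lemma induced_sym (G : sgraph) (A : {set G}) :
  symmetric (fun x y : {x : G | x \in A} => edge (val x) (val y)).
Proof. by move=> x y; apply: edge_sym. Qed.

Lemma induced_irrefl (G : sgraph) (A : {set G}) :
  irreflexive (fun x y : {x : G | x \in A} => edge (val x) (val y)).
Proof. by move=> x; apply: edge_irrefl. Qed.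

Definition induced (G : sgraph) (A : {set G}) : sgraph :=
  SGraph (@induced_sym G A) (@induced_irrefl G A).

Definition connected (G : sgraph) : Prop :=
  0 < #|G| /\ forall x y : G, connect edge x y.

Definition kconnected (k : nat) (G : sgraph) : Prop :=
  k < #|G| /\ forall X : {set G}, #|X| < k -> connected (induced (~: X)).

Definition hamiltonian (G : sgraph) : Prop :=
  exists c : seq G, [/\ 3 <= size c, ucycle edge c & forall x : G, x \in c].

Definition is_dist (G : sgraph) (u v : G) (k : nat) : Prop :=
  (exists p : seq G, [/\ path edge u p, last u p = v & size p = k]) /\
  (forall p : seq G, path edge u p -> last u p = v -> k <= size p).

Definition o_heavy (H G : sgraph) : Prop :=
  forall A : {set G}, iso (induced A) H ->
  exists x y : G, [/\ x \in A, y \in A, x != y, ~~ edge x y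
                    & #|G| <= deg x + deg y].

(* The distance is taken in the induced subgraph, the degrees in [G]; the bound
   max {d(u), d(v)} >= n / 2 has a rational right-hand side, so it is cleared
   of its denominator. *)
Definition f_heavy (H G : sgraph) : Prop :=
  forall A : {set G}, iso (induced A) H ->
  forall u v : induced A, is_dist u v 2 ->
  #|G| <= 2 * maxn (deg (val u)) (deg (val v)).

(* The graph on {0, ..., n-1} whose edges are the pairs listed in [E], read as
   unordered pairs. *)
Definition edges_rel (n : nat) (E : seq (nat * nat)) : rel 'I_n :=
  fun x y => (x != y) &&
    (((val x, val y) \in E) || ((val y, val x) \in E)).

Lemma edges_rel_sym n E : symmetric (@edges_rel n E).
Proof. by move=> x y; rewrite /edges_rel eq_sym orbC. Qed.

Lemma edges_rel_irrefl n E : irreflexive (@edges_rel n E).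
Proof. by move=> x; rewrite /edges_rel eqxx. Qed.

Definition graph_of_edges (n : nat) (E : seq (nat * nat)) : sgraph :=
  SGraph (@edges_rel_sym n E) (@edges_rel_irrefl n E).

Definition claw : sgraph := graph_of_edges 4 [:: (0, 1); (0, 2); (0, 3)].

Definition P_ (i : nat) : sgraph :=
  graph_of_edges i [seq (j, j.+1) | j <- iota 0 i.-1].

Definition triangle_edges : seq (nat * nat) := [:: (0, 1); (1, 2); (0, 2)].

(* The attached path is 2, 3, ..., i + 2. *)
Definition Z_ (i : nat) : sgraph :=
  graph_of_edges (i + 3)
    (triangle_edges ++ [seq (j, j.+1) | j <- iota 2 i]).

Definition bull : sgraph :=
  graph_of_edges 5 (triangle_edges ++ [:: (0, 3); (1, 4)]).

Definition net : sgraph :=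
  graph_of_edges 6 (triangle_edges ++ [:: (0, 3); (1, 4); (2, 5)]).

(* a_1, a_2, a_3, b_1, b_2, c_1 are numbered 0, 1, 2, 3, 4, 5. *)
Definition wounded : sgraph :=
  graph_of_edges 6 (triangle_edges ++ [:: (0, 3); (3, 5); (1, 4)]).

(* Main.v *)
(* Call x and y near if they are adjacent or d(x) + d(y) >= n.  As for the
   Bondy-Chvatal closure, a cycle of successively near vertices can be replaced by
   a cycle of G through the same vertices and possibly more; claw-o-heaviness says
   that among three neighbours of a vertex some two are near.

   Sufficiency.  If G is not Hamiltonian, take a longest cycle C containing all
   heavy vertices (d(v) >= n/2) and a shortest ear from u to v.  Around u and v grow
   sets of vertices of C which the near cycles can traverse as if they were cliques.
   When the two sets are as large as possible, any near pair that is not forced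
   yields a longer near cycle, so C and the ear look like two cliques joined by three
   paths.  Counting the vertices adjacent to neither end shows that u and v are not
   both heavy, and one of the two sets has at most one heavy vertex and no near pair
   that is not an edge.  Inside that set, which is claw-free, the induced paths
   between the three exits produce a triangle with three disjoint legs, and this
   triangle together with the ear gives copies of N, W, Z_2 and P_6 with a light pair
   at distance two.  The other graphs reduce to these: P_4 to P_5 to P_6 and Z_1 to B
   to N.

   Necessity.  P_{T,T,T} and P_{3,3,3} are 2-connected, claw-free and not Hamiltonian.
   Hence S is a non-complete induced subgraph of both, and a finite search over the
   512 vertex sets of P_{T,T,T} leaves only P_3 and the eight listed graphs. *)

Require Import Defs.
From mathcomp Require Import all_boot zify.
From Stdlib Require Import Classical.

Set Implicit Arguments.
Unset Strict Implicit.
Unset Printing Implicit Defensive.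

(** * Clusters *)

(** The cycle, its arcs and the ear consist of edges; [near] serves its competitors: no longer cycle
    of [near] passes through all heavy vertices. Hence reroutings may use pairs of large degree sum,
    and as distinct heavy vertices are near, two distinct vertices that are not near are never both
    heavy. A cluster records only how one path, or two disjoint paths, can span a set between its
    three exits. This is enough to write down the rerouted cycles and survives the absorption of
    suitable vertices from the links. The forbidden copies end in propositional logic: $f$-heaviness
    puts a heavy vertex into each pair at distance two, whereas ear vertices are light and neither a
    pair that is not near nor an edge of a calm cluster has two heavy ends. The obstacle is heavy
    vertices in both clusters; near pairs between the clusters form a matching, which leaves one
    heavy vertex in each, and adding two degree conditions makes one cluster calm. The exceptional
    case is a one-vertex ear between adjacent ends: there the ear and its ends supply the triangle
    or the path. *)

Section Linkages.

Variables (T : eqType) (F : rel T).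
Hypothesis Fsym : symmetric F.

Definition walk (x y : T) (s : seq T) : bool :=
  if s is h :: t then [&& h == x, path F x t & last x t == y] else false.

Lemma walk1 x : walk x x [:: x].
Proof. by rewrite /walk /= !eqxx. Qed.

Lemma walk2 x y : F x y -> walk x y [:: x; y].
Proof. by move=> Fxy; rewrite /walk /= !eqxx Fxy. Qed.

Lemma walkP x y s :
  reflect (exists t, [/\ s = x :: t, path F x t & last x t = y]) (walk x y s).
Proof.
case: s => [|h t] /=; first by constructor=> -[t []].
apply: (iffP and3P) => [[/eqP-> Ft /eqP<-]|[_ [[-> <-] Ft <-]]].
  by exists t.
by rewrite !eqxx.
Qed.

Lemma walk_cat x y z w s t :
  walk x y s -> walk z w t -> F y z -> walk x w (s ++ t).
Proof.
move=> /walkP[s' [-> Fs <-]] /walkP[t' [-> Ft <-]] Fyz.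
by apply/walkP; exists (s' ++ z :: t'); rewrite cat_path last_cat /= Fs Fyz.
Qed.

Lemma walk_rev x y s : walk x y s -> walk y x (rev s).
Proof.
move=> /walkP[s' [-> Fs <-]]; apply/walkP; exists (rev (belast x s')).
rewrite lastI rev_rcons; split=> //.
  by rewrite rev_path (eq_path (e' := F)).
by case: s' {Fs} => //= a s'; rewrite rev_cons last_rcons.
Qed.

Lemma walk_path x a p L :
  walk x a p -> path F a L -> walk x (last a L) (p ++ L).
Proof.
move=> /walkP[p' [-> Fp <-]] FL; apply/walkP; exists (p' ++ L).
by rewrite cat_path last_cat Fp.
Qed.

Lemma walk_link x a b y p L q :
  walk x a p -> path F a (rcons L b) -> walk b y q -> walk x y (p ++ L ++ q).
Proof.
move=> wp; rewrite rcons_path => /andP[FL Fb] wq.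
by rewrite catA; apply: walk_cat (walk_path wp FL) wq Fb.
Qed.

Lemma link_rev a b L : path F a (rcons L b) -> path F b (rcons (rev L) a).
Proof.
move=> FL; have := rev_path F a (rcons L b).
rewrite last_rcons belast_rcons rev_cons => rFL.
by rewrite rFL (eq_path (e' := F)).
Qed.

Lemma walk_link_rev x a b y p L q :
  walk x b p -> path F a (rcons L b) -> walk a y q ->
  walk x y (p ++ rev L ++ q).
Proof. by move=> wp /link_rev FL wq; apply: walk_link wp FL wq. Qed.

Lemma walk_cycle x y s : walk x y s -> F y x -> cycle F s.
Proof.
by move=> /walkP[s' [-> Fs <-]] Fyx; rewrite /= rcons_path Fs.
Qed.

Lemma walk_cons x y z s : F x y -> walk y z s -> walk x z (x :: s).
Proof. by move=> Fxy ws; apply: (walk_cat (walk1 x) ws). Qed.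

Lemma walk_rcons x y z s : walk x y s -> F y z -> walk x z (rcons s z).
Proof. by move=> ws Fyz; rewrite -cats1; apply: walk_cat ws (walk1 z) Fyz. Qed.

Definition ham (D : seq T) (x y : T) : Prop :=
  exists2 s, walk x y s & perm_eq s D.

(** This is the trace left in [D] by a cycle that uses all three exits of [D] and also enters it at
    [s]; [a] is the exit that it reaches from [s]. *)
Definition linkage (D : seq T) (s a j k : T) : Prop :=
  exists p q, [/\ walk s a p, walk j k q & perm_eq (p ++ q) D].

Lemma ham_sym D x y : ham D x y -> ham D y x.
Proof.
by case=> s ws sD; exists (rev s); [apply: walk_rev | rewrite perm_rev].
Qed.

Lemma linkage_sym D s a j k : linkage D s a j k -> linkage D s a k j.
Proof.
case=> p [q [wp wq pq]]; exists p, (rev q); split=> //; first exact: walk_rev.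
by apply: perm_trans pq; rewrite perm_cat2l perm_rev.
Qed.

(* A cluster behaves, as far as Hamiltonian cycles leaving it through its three
   terminals are concerned, like a clique. *)
Record cluster (D : seq T) (a1 a2 a3 : T) : Prop := Cluster {
  ham12 : ham D a1 a2;
  ham13 : ham D a1 a3;
  ham23 : ham D a2 a3;
  linkage1 : forall s, s \in D -> s != a1 ->
    linkage D s a2 a1 a3 \/ linkage D s a3 a1 a2;
  linkage2 : forall s, s \in D -> s != a2 ->
    linkage D s a1 a2 a3 \/ linkage D s a3 a1 a2;
  linkage3 : forall s, s \in D -> s != a3 ->
    linkage D s a1 a2 a3 \/ linkage D s a2 a1 a3 }.

Lemma ham_perm D D' x y : perm_eq D D' -> ham D x y -> ham D' x y.
Proof. by move=> DD' [s ws sD]; exists s => //; apply: perm_trans sD DD'. Qed.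

Lemma linkage_perm D D' s a j k :
  perm_eq D D' -> linkage D s a j k -> linkage D' s a j k.
Proof.
move=> DD' [p [q [wp wq pq]]]; exists p, q; split=> //.
exact: perm_trans pq DD'.
Qed.

Lemma cluster_perm D D' a1 a2 a3 :
  perm_eq D D' -> cluster D a1 a2 a3 -> cluster D' a1 a2 a3.
Proof.
move=> DD' [h12 h13 h23 k1 k2 k3]; have lk := linkage_perm DD'.
split; try by apply: ham_perm DD' _.
- by move=> s; rewrite -(perm_mem DD') => sD /(k1 s sD)[]/lk; [left|right].
- by move=> s; rewrite -(perm_mem DD') => sD /(k2 s sD)[]/lk; [left|right].
- by move=> s; rewrite -(perm_mem DD') => sD /(k3 s sD)[]/lk; [left|right].
Qed.

Lemma cluster_swap12 D a1 a2 a3 : cluster D a1 a2 a3 -> cluster D a2 a1 a3.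
Proof.
move=> [h12 h13 h23 k1 k2 k3]; split=> //; first exact: ham_sym.
- by move=> s sD /(k2 s sD)[]; [left | right; apply: linkage_sym].
- by move=> s sD /(k1 s sD)[]; [left | right; apply: linkage_sym].
- by move=> s sD /(k3 s sD)[]; [right | left].
Qed.

Lemma cluster_swap23 D a1 a2 a3 : cluster D a1 a2 a3 -> cluster D a1 a3 a2.
Proof.
move=> [h12 h13 h23 k1 k2 k3]; split=> //; first exact: ham_sym.
- by move=> s sD /(k1 s sD)[]; [right | left].
- by move=> s sD /(k3 s sD)[]; [left; apply: linkage_sym | right].
- by move=> s sD /(k2 s sD)[]; [left; apply: linkage_sym | right].
Qed.

Lemma cluster_rot D a1 a2 a3 : cluster D a1 a2 a3 -> cluster D a2 a3 a1.
Proof. by move/cluster_swap12/cluster_swap23. Qed.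

End Linkages.

(** Two lists are permutations of each other when every predicate has the same count on both, so
    permutation goals between concatenations and reversals become linear arithmetic. *)
Ltac perm_count :=
  let P := fresh "P" in
  apply/permP => P;
  repeat match goal with
  | H : is_true (perm_eq _ _) |- _ => move/permP/(_ P): H
  end;
  rewrite -?cats1 /=; do 4 (rewrite ?count_cat ?count_rev /=);
  repeat match goal with |- context [nat_of_bool ?b] => move: (nat_of_bool b) => ? end;
  clear; lia.

Arguments walk {T} F x y s : simpl never.

Section Growth.

Variables (T : eqType) (F : rel T).
Hypothesis Fsym : symmetric F.

Notation walk := (walk F).
Notation ham := (ham F).
Notation linkage := (linkage F).
Notation cluster := (cluster F).

Lemma cluster_triangle a1 a2 a3 :
  F a1 a2 -> F a1 a3 -> F a2 a3 -> cluster [:: a1; a2; a3] a1 a2 a3.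
Proof.
move=> F12 F13 F23.
have F21 : F a2 a1 by rewrite Fsym.
have F31 : F a3 a1 by rewrite Fsym.
have F32 : F a3 a2 by rewrite Fsym.
have k1 : linkage [:: a1; a2; a3] a1 a1 a2 a3.
  by exists [:: a1], [:: a2; a3]; split; rewrite ?walk1 ?walk2.
have k2 : linkage [:: a1; a2; a3] a2 a2 a1 a3.
  exists [:: a2], [:: a1; a3]; split; rewrite ?walk1 ?walk2 //.
  by perm_count.
have k3 : linkage [:: a1; a2; a3] a3 a3 a1 a2.
  exists [:: a3], [:: a1; a2]; split; rewrite ?walk1 ?walk2 //.
  by perm_count.
split.
- exists [:: a1; a3; a2]; last by perm_count.
  exact: walk_cons F13 (walk2 F32).
- by exists [:: a1; a2; a3] => //; apply: walk_cons F12 (walk2 F23).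
- exists [:: a2; a1; a3]; last by perm_count.
  exact: walk_cons F21 (walk2 F13).
- by move=> s; rewrite !inE => /or3P[]/eqP-> ne; rewrite ?eqxx in ne; auto.
- by move=> s; rewrite !inE => /or3P[]/eqP-> ne; rewrite ?eqxx in ne; auto.
- by move=> s; rewrite !inE => /or3P[]/eqP-> ne; rewrite ?eqxx in ne; auto.
Qed.

(** The vertex [x] takes over the exit of [a1], so walks ending at [a1] are prolonged by [x]. Only a
    spanning walk from [a2] to [a3] must have [x] inside: it arises from a linkage of [s], whose two
    walks are joined through [x] at their ends [s] and [a1]. This is what the second neighbour [s]
    is for. *)
Lemma cluster_absorb D a1 a2 a3 x s :
  cluster D a1 a2 a3 -> F x a1 -> s \in D -> s != a1 -> F x s ->
  x \notin D -> cluster (x :: D) x a2 a3.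
Proof.
move=> [[p12 w12 e12] [p13 w13 e13] [p23 w23 e23] k1 k2 k3] Fx1 sD s1 Fxs xD.
have Fsx : F s x by rewrite Fsym.
have F1x : F a1 x by rewrite Fsym.
have l1 t : linkage D t a1 a2 a3 -> linkage (x :: D) t x a2 a3.
  case=> p [q [wp wq pq]]; exists (rcons p x), q.
  by split=> //; [apply: walk_rcons wp _ | perm_count].
have l2 t : linkage D t a2 a1 a3 -> linkage (x :: D) t a2 x a3.
  case=> p [q [wp wq pq]]; exists p, (x :: q).
  by split=> //; [apply: walk_cons wq | perm_count].
have l3 t : linkage D t a3 a1 a2 -> linkage (x :: D) t a3 x a2.
  case=> p [q [wp wq pq]]; exists p, (x :: q).
  by split=> //; [apply: walk_cons wq | perm_count].
have lx : linkage (x :: D) x x a2 a3.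
  by exists [:: x], p23; split; rewrite ?walk1 //; perm_count.
split.
- by exists (x :: p12); [apply: walk_cons w12 | perm_count].
- by exists (x :: p13); [apply: walk_cons w13 | perm_count].
- case: (k1 s sD s1) => -[p [q [wp wq pq]]].
    exists (rev p ++ x :: q); last by perm_count.
    by apply: walk_cat (walk_rev Fsym wp) _ Fsx; apply: walk_cons wq.
  exists (rev q ++ x :: p); last by perm_count.
  by apply: walk_cat (walk_rev Fsym wq) _ F1x; apply: walk_cons wp.
- move=> t; rewrite inE => /predU1P[->|tD]; first by rewrite eqxx.
  move=> tx; have [->|t1] := eqVneq t a1; last first.
    by case: (k1 t tD t1); [left; apply: l2 | right; apply: l3].
  (* The old terminal [a1] has become an inner vertex. The linkage of [s] serves with its two walks
     interchanged and [x] put before [s]. *)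
  case: (k1 s sD s1) => -[p [q [wp wq pq]]].
    right; exists q, (x :: p).
    by split=> //; [apply: walk_cons wp | perm_count].
  left; exists q, (x :: p).
  by split=> //; [apply: walk_cons wp | perm_count].
- move=> t; rewrite inE => /predU1P[-> _|tD t2]; first by left.
  by case: (k2 t tD t2); [left; apply: l1 | right; apply: l3].
- move=> t; rewrite inE => /predU1P[-> _|tD t3]; first by left.
  by case: (k3 t tD t3); [left; apply: l1 | right; apply: l2].
Qed.

(** Two exits move outwards at once. A walk that starts at one new terminal and must contain the
    other as an inner vertex collects it across the pair [x], [y]. *)
Lemma cluster_absorb2 D a1 a2 a3 x y :
  cluster D a1 a2 a3 -> F x a1 -> F y a2 -> F x y ->
  cluster (x :: y :: D) x y a3.
Proof.
move=> [[p12 w12 e12] [p13 w13 e13] [p23 w23 e23] k1 k2 k3] Fx1 Fy2 Fxy.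
have F1x : F a1 x by rewrite Fsym.
have F2y : F a2 y by rewrite Fsym.
have Fyx : F y x by rewrite Fsym.
have l1 t : linkage D t a1 a2 a3 -> linkage (x :: y :: D) t x y a3.
  case=> p [q [wp wq pq]]; exists (rcons p x), (y :: q).
  by split; [apply: walk_rcons wp _ | apply: walk_cons wq | perm_count].
have l2 t : linkage D t a2 a1 a3 -> linkage (x :: y :: D) t y x a3.
  case=> p [q [wp wq pq]]; exists (rcons p y), (x :: q).
  by split; [apply: walk_rcons wp _ | apply: walk_cons wq | perm_count].
have l3 t : linkage D t a3 a1 a2 -> linkage (x :: y :: D) t a3 x y.
  case=> p [q [wp wq pq]]; exists p, (x :: rcons q y).
  split=> //; last by perm_count.
  by apply: walk_cons Fx1 (walk_rcons wq _).
have l1' : linkage (x :: y :: D) a1 a3 x y.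
  by exists p13, [:: x; y]; split; rewrite ?walk2 //; perm_count.
have l2' : linkage (x :: y :: D) a2 a3 x y.
  by exists p23, [:: x; y]; split; rewrite ?walk2 //; perm_count.
have lx : linkage (x :: y :: D) x x y a3.
  exists [:: x], (y :: p23); split; rewrite ?walk1 //; last by perm_count.
  exact: walk_cons w23.
have ly : linkage (x :: y :: D) y y x a3.
  exists [:: y], (x :: p13); split; rewrite ?walk1 //; last by perm_count.
  exact: walk_cons w13.
split.
- exists (x :: rcons p12 y); last by perm_count.
  by apply: walk_cons Fx1 (walk_rcons w12 _).
- exists (x :: y :: p23); last by perm_count.
  by apply: walk_cons Fxy (walk_cons _ w23).
- exists (y :: x :: p13); last by perm_count.
  by apply: walk_cons Fyx (walk_cons _ w13).
- move=> t; rewrite !inE => /or3P[/eqP->|/eqP-> _|tD tx]; first by rewrite eqxx.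
    by left.
  have [->|t1] := eqVneq t a1; first by right.
  by case: (k1 t tD t1); [left; apply: l2 | right; apply: l3].
- move=> t; rewrite !inE => /or3P[/eqP-> _|/eqP->|tD ty]; first by left.
    by rewrite eqxx.
  have [->|t2] := eqVneq t a2; first by right.
  by case: (k2 t tD t2); [left; apply: l1 | right; apply: l3].
- move=> t; rewrite !inE => /or3P[/eqP-> _|/eqP-> _|tD t3]; [by left|by right|].
  by case: (k3 t tD t3); [left; apply: l1 | right; apply: l2].
Qed.

End Growth.

(** * Rerouting cycles through two clusters and three links *)

Section Exchange.

Variables (T : eqType) (F : rel T).
Hypothesis Fsym : symmetric F.

Notation walk := (walk F).
Notation ham := (ham F).
Notation linkage := (linkage F).
Notation cluster := (cluster F).

Definition noham (S : seq T) : Prop := forall c, perm_eq c S -> ~~ cycle F c.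

Lemma noham_walk S x y c :
  noham S -> walk x y c -> F y x -> perm_eq c S -> False.
Proof. by move=> nS wc Fyx /nS; rewrite (walk_cycle wc Fyx). Qed.

Lemma noham_perm S S' : perm_eq S S' -> noham S -> noham S'.
Proof. by move=> SS' nS c cS; apply: nS; rewrite (perm_trans cS) // perm_sym. Qed.

Variables (D1 D2 : seq T).

(** Two links suffice for a cycle through both clusters. A third link without inner vertices would
    leave nothing uncovered, and this is how links are shown to be nonempty. *)
Lemma theta_no_edge_link a1 a2 a3 b1 b2 b3 L1 L3 :
  cluster D1 a1 a2 a3 -> cluster D2 b1 b2 b3 ->
  path F a1 (rcons L1 b1) -> path F a3 (rcons L3 b3) ->
  ~ noham (D1 ++ D2 ++ L1 ++ L3).
Proof.
move=> cD1 cD2 l1 l3 nS.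
have [p wp pD] := ham13 cD1; have [q wq qD] := ham13 cD2.
have w := walk_link (walk_rev Fsym wp) l1 wq.
have := l3; rewrite -(revK L3) => /(link_rev Fsym); rewrite revK.
rewrite rcons_path => /andP[l3' l3e].
by apply: noham_walk nS (walk_path w l3') l3e _; perm_count.
Qed.

(** The exits reached from [s] and from [t] carry different indices, so the four walks, the three
    links and the pair [s], [t] close up into one cycle; equal indices would give two cycles. *)
Lemma theta_linkage a1 a2 a3 b1 b2 b3 L1 L2 L3 s t :
  linkage D1 s a1 a2 a3 -> linkage D2 t b2 b1 b3 -> F s t ->
  path F a1 (rcons L1 b1) -> path F a2 (rcons L2 b2) ->
  path F a3 (rcons L3 b3) ->
  ~ noham (D1 ++ D2 ++ L1 ++ L2 ++ L3).
Proof.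
move=> [p [p' [wp wp' pD]]] [q [q' [wq wq' qD]]] Fst l1 l2 l3 nS.
have w1 := walk_link wp l1 wq'.
have w2 := walk_link_rev Fsym w1 l3 (walk_rev Fsym wp').
have w3 := walk_link w2 l2 (walk_rev Fsym wq).
by apply: noham_walk nS w3 _ _; [rewrite Fsym | perm_count].
Qed.

(** Let [Mi] and [Nj] be the linkages of [s] and [t] with exits [i] and [j]; they exclude each other
    when [i] and [j] differ. An inner vertex has at least two of its three linkages, which exclude
    every linkage on the other side, although one exists there. A terminal number [i] has its own
    linkage or both others, so only equal numbers survive. *)
Lemma theta_cross a1 a2 a3 b1 b2 b3 L1 L2 L3 s t :
  uniq [:: a1; a2; a3] -> uniq [:: b1; b2; b3] ->
  cluster D1 a1 a2 a3 -> cluster D2 b1 b2 b3 ->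
  path F a1 (rcons L1 b1) -> path F a2 (rcons L2 b2) ->
  path F a3 (rcons L3 b3) -> noham (D1 ++ D2 ++ L1 ++ L2 ++ L3) ->
  s \in D1 -> t \in D2 -> F s t ->
  [\/ s = a1 /\ t = b1, s = a2 /\ t = b2 | s = a3 /\ t = b3].
Proof.
move=> /and3P[/norP[a12 /norP[a13 _]] /norP[a23 _] _] /and3P[/norP[b12 _] _ _].
move=> cD1 cD2 l1 l2 l3 nS sD tD Fst.
have n132 : noham (D1 ++ D2 ++ L1 ++ L3 ++ L2).
  by apply: noham_perm nS; perm_count.
have n213 : noham (D1 ++ D2 ++ L2 ++ L1 ++ L3).
  by apply: noham_perm nS; perm_count.
have n231 : noham (D1 ++ D2 ++ L2 ++ L3 ++ L1).
  by apply: noham_perm nS; perm_count.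
have n312 : noham (D1 ++ D2 ++ L3 ++ L1 ++ L2).
  by apply: noham_perm nS; perm_count.
have n321 : noham (D1 ++ D2 ++ L3 ++ L2 ++ L1).
  by apply: noham_perm nS; perm_count.
pose M1 := linkage D1 s a1 a2 a3; pose M2 := linkage D1 s a2 a1 a3.
pose M3 := linkage D1 s a3 a1 a2.
pose N1 := linkage D2 t b1 b2 b3; pose N2 := linkage D2 t b2 b1 b3.
pose N3 := linkage D2 t b3 b1 b2.
have M12 : M1 -> N2 -> False.
  by move=> m n; apply: (theta_linkage m n Fst l1 l2 l3 nS).
have M13 : M1 -> N3 -> False.
  move=> /(linkage_sym Fsym) m n.
  exact: (theta_linkage m n Fst l1 l3 l2 n132).
have M21 : M2 -> N1 -> False.
  by move=> m n; apply: (theta_linkage m n Fst l2 l1 l3 n213).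
have M23 : M2 -> N3 -> False.
  move=> /(linkage_sym Fsym) m /(linkage_sym Fsym) n.
  exact: (theta_linkage m n Fst l2 l3 l1 n231).
have M31 : M3 -> N1 -> False.
  move=> m /(linkage_sym Fsym) n.
  exact: (theta_linkage m n Fst l3 l1 l2 n312).
have M32 : M3 -> N2 -> False.
  move=> /(linkage_sym Fsym) m /(linkage_sym Fsym) n.
  exact: (theta_linkage m n Fst l3 l2 l1 n321).
have m1 : s = a1 \/ (M2 \/ M3).
  by have [|s1] := eqVneq s a1; [left | right; apply: linkage1 cD1 _ sD s1].
have m2 : s = a2 \/ (M1 \/ M3).
  by have [|s1] := eqVneq s a2; [left | right; apply: linkage2 cD1 _ sD s1].
have m3 : s = a3 \/ (M1 \/ M2).
  by have [|s1] := eqVneq s a3; [left | right; apply: linkage3 cD1 _ sD s1].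
have k1 : t = b1 \/ (N2 \/ N3).
  by have [|s1] := eqVneq t b1; [left | right; apply: linkage1 cD2 _ tD s1].
have k2 : t = b2 \/ (N1 \/ N3).
  by have [|s1] := eqVneq t b2; [left | right; apply: linkage2 cD2 _ tD s1].
have k3 : t = b3 \/ (N1 \/ N2).
  by have [|s1] := eqVneq t b3; [left | right; apply: linkage3 cD2 _ tD s1].
case: m1 => [e1|m1].
  have {}m2 : M1 \/ M3 by case: m2 => // e2; move: a12; rewrite -e1 -e2 eqxx.
  have {}m3 : M1 \/ M2 by case: m3 => // e3; move: a13; rewrite -e1 -e3 eqxx.
  case: k1 => [|[]]; first (by constructor); [case: m2 | case: m3] => *; exfalso; eauto 2.
case: m2 => [e2|m2].
  have {}m3 : M1 \/ M2 by case: m3 => // e3; move: a23; rewrite -e2 -e3 eqxx.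
  case: k2 => [|[]]; first (by constructor); [case: m1 | case: m3] => *; exfalso; eauto 2.
case: m3 => [e3|m3].
  case: k3 => [|[]]; first (by constructor); [case: m1 | case: m2] => *; exfalso; eauto 2.
have : [\/ N1, N2 | N3].
  case: k1 => [e1|[]]; [|by constructor..].
  by case: k2 => [e2|[]]; [move: b12; rewrite -e1 -e2 eqxx | by constructor..].
by case; [case: m1 | case: m2 | case: m3] => *; exfalso; eauto 2.
Qed.

(* In the next two lemmas the last vertex of the first link need not be
   adjacent to the second cluster. *)
Lemma theta_last_cluster a1 a2 a3 b1 b2 b3 L1 L2 L3 s :
  cluster D1 a1 a2 a3 -> cluster D2 b1 b2 b3 ->
  path F a1 L1 -> path F a2 (rcons L2 b2) -> path F a3 (rcons L3 b3) ->
  noham (D1 ++ D2 ++ L1 ++ L2 ++ L3) ->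
  s \in D1 -> F (last a1 L1) s -> s = a1.
Proof.
move=> cD1 cD2 l1 l2 l3 nS sD Fs; apply/eqP; apply: contraT => s1.
have [q wq qD] := ham23 cD2; exfalso.
case: (linkage1 cD1 sD s1) => -[p [p' [wp wp' pD]]].
  have w1 := walk_link wp l2 wq.
  have w2 := walk_link_rev Fsym w1 l3 (walk_rev Fsym wp').
  by apply: noham_walk nS (walk_path w2 l1) Fs _; perm_count.
have w1 := walk_link wp l3 (walk_rev Fsym wq).
have w2 := walk_link_rev Fsym w1 l2 (walk_rev Fsym wp').
by apply: noham_walk nS (walk_path w2 l1) Fs _; perm_count.
Qed.

Lemma theta_last_first a1 a2 a3 b1 b2 b3 L1 x L2 L3 :
  cluster D1 a1 a2 a3 -> cluster D2 b1 b2 b3 ->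
  path F a1 L1 -> path F x (rcons L2 b2) -> path F a3 (rcons L3 b3) ->
  noham (D1 ++ D2 ++ L1 ++ (x :: L2) ++ L3) ->
  ~ F (last a1 L1) x.
Proof.
move=> cD1 cD2 l1 l2 l3 nS Fx.
have [q wq qD] := ham23 cD2; have [p wp pD] := ham13 cD1.
have w1 := walk_link (walk1 F x) l2 wq.
have w2 := walk_link_rev Fsym w1 l3 (walk_rev Fsym wp).
by apply: noham_walk nS (walk_path w2 l1) Fx _; perm_count.
Qed.

End Exchange.

(** * Near vertices *)

(** Ore's argument: without a crossing, each position satisfying [R] is followed by one that fails
    [P], so after a shift by one no position is counted twice. *)
Lemma crossing_or_count (T : Type) (P R : pred T) x s :
  (exists l u v r, [/\ x :: s = l ++ [:: u, v & r], P v & R u]) \/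
  count P s + count R (belast x s) <= size s.
Proof.
elim: s x => [|y s IHs] x; first by right.
case: (IHs y) => [[l [u [v [r [-> Pv Ru]]]]]|le_s].
  by left; exists (x :: l), u, v, r.
have [/andP[Py Rx]|PR] := boolP (P y && R x); first by left; exists [::], x, y, s.
right; rewrite /=; move: PR le_s; case: (P y); case: (R x) => //= _; lia.
Qed.

Section Heavy.

Variable G : sgraph.

Definition heavy (v : G) : bool := #|G| <= 2 * deg v.

(* Adjacent, or adjacent in one step of the Bondy-Chvatal closure. *)
Definition near (x y : G) : bool :=
  (x != y) && (edge x y || (#|G| <= deg x + deg y)).

Lemma near_sym : symmetric near.
Proof. by move=> x y; rewrite /near eq_sym edge_sym addnC. Qed.

Lemma edge_neq (x y : G) : edge x y -> x != y.
Proof. by apply: contraTneq => ->; rewrite edge_irrefl. Qed.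

Lemma edge_near (x y : G) : edge x y -> near x y.
Proof. by move=> xy; rewrite /near (edge_neq xy) xy. Qed.

Lemma heavy_near (x y : G) : heavy x -> heavy y -> x != y -> near x y.
Proof.
rewrite /heavy /near => hx hy ->; apply/orP; right.
by move: hx hy; set m := #|_|; move: (deg x) (deg y) => a b; lia.
Qed.

Lemma near_light (x y : G) : near x y -> ~~ heavy x -> ~~ heavy y -> edge x y.
Proof.
rewrite /heavy /near => /andP[_ /orP[//|h]] hx hy.
by move: h hx hy; set m := #|_|; move: (deg x) (deg y) => a b; lia.
Qed.

Lemma pairwise_near_path (x : G) s : uniq (x :: s) ->
  {in x :: s &, forall a b, a != b -> near a b} -> path near x s.
Proof.
elim: s x => //= y s IHs x /andP[xys us] H; apply/andP; split.
  apply: H; rewrite ?inE ?eqxx ?orbT //.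
  by move: xys; rewrite inE negb_or => /andP[].
by apply: IHs => // a b as_ bs; apply: H; rewrite inE ?as_ ?bs orbT.
Qed.

Lemma deg_split (x : G) (c : seq G) : uniq c ->
  deg x = count (edge x) c + #|[set w | edge x w & w \notin c]|.
Proof.
move=> uc; rewrite /deg -(cardsID [set w in c]).
congr (_ + _); last by apply: eq_card => w; rewrite !inE andbC.
rewrite -size_filter -(card_uniqP (filter_uniq _ uc)).
by apply: eq_card => w; rewrite !inE mem_filter.
Qed.

Lemma closure_step (Q : rel G) x s :
  symmetric Q -> subrel edge Q -> uniq (x :: s) -> 2 <= size s ->
  path Q x s -> #|G| <= deg x + deg (last x s) ->
  exists2 c, uniq c & [/\ 3 <= size c, cycle Q c & {subset x :: s <= c}].
Proof.
move=> Qsym EQ us ss Qs le_n; set y := last x s in le_n *.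
have [w /and3P[xw yw wc]|no_w] :=
  pickP (fun w => [&& edge x w, edge y w & w \notin x :: s]).
  exists (w :: x :: s); first by rewrite /= wc.
  split; [exact: ltnW | | by move=> v vs; rewrite inE vs orbT].
  by rewrite /= rcons_path Qs EQ 1?edge_sym //= EQ.
case: (crossing_or_count (edge x) (edge y) x s) => [[l [u [v [r [def_s xv yu]]]]]|].
  have def_y : y = last v r.
    by rewrite /y -[last x s]/(last x (x :: s)) def_s last_cat.
  have pe : perm_eq ((l ++ [:: u]) ++ rev (v :: r)) (x :: s).
    by rewrite def_s; perm_count.
  exists ((l ++ [:: u]) ++ rev (v :: r)); first by rewrite (perm_uniq pe).
  split; [by rewrite (perm_size pe) | | by move=> z; rewrite (perm_mem pe)].
  have w1 : walk Q x u (l ++ [:: u]).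
    case: l def_s {pe} => [|z l] [<- ds]; first by rewrite walk1.
    apply/walkP; exists (l ++ [:: u]); rewrite last_cat; split=> //.
    by move: Qs; rewrite ds -cat_rcons cat_path cats1 => /andP[].
  have w2 : walk Q y v (rev (v :: r)).
    apply: walk_rev => //; apply/walkP; exists r; split=> //.
    case: l def_s {pe w1} => [|z l] [ex ds]; first by move: Qs; rewrite ds => /andP[].
    by move: Qs; rewrite ds -cat_rcons cat_path => /andP[_ /andP[]].
  apply: walk_cycle (walk_cat w1 w2 _) _; first by rewrite Qsym EQ.
  by rewrite Qsym EQ.
move=> le_s; exfalso.
have cx := deg_split x us; have cy := deg_split y us.
set Ox := [set w | _ & _] in cx; set Oy := [set w | _ & _] in cy.
have OxOy : Ox :&: Oy = set0.
  apply/setP=> w; rewrite /Ox /Oy !inE -/(x :: s); have /= := no_w w; rewrite !inE.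
  by case: (edge x w); case: (edge y w); case: (_ || _).
have := subset_leq_card (_ : Ox :|: Oy \subset ~: [set w in x :: s]).
have -> : Ox :|: Oy \subset ~: [set w in x :: s].
  by apply/subsetP=> w; rewrite /Ox /Oy !inE; case/orP=> /andP[].
have := cardsC [set w in x :: s].
have -> : #|[set w in x :: s]| = (size s).+1.
  by rewrite cardsE (card_uniqP us).
have := cardsUI Ox Oy; rewrite OxOy cards0.
have cy' : count (edge y) (x :: s) = count (edge y) (belast x s).
  by rewrite lastI -cats1 count_cat /= -/y edge_irrefl !addn0.
move: cx cy le_s le_n; rewrite cy' /= edge_irrefl.
move: (count _ s) (count _ (belast x s)).
move: #|Ox| #|Oy| #|_ :|: _| (deg x) (deg y) #|~: _| #|G|; clear; lia.
Qed.

Definition with_pairs (M : seq (G * G)) : rel G :=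
  fun x y => [|| edge x y, (x, y) \in M | (y, x) \in M].

Lemma with_pairs_sym M : symmetric (with_pairs M).
Proof. by move=> x y; rewrite /with_pairs edge_sym; congr (_ || _); rewrite orbC. Qed.

(** The pairs are eliminated one at a time. A cycle without repetitions passes through a pair at
    most once, so cutting it there leaves a path of the smaller relation, which [closure_step]
    closes again. *)
Lemma closure_pairs (M : seq (G * G)) :
  {in M, forall e, #|G| <= deg e.1 + deg e.2} ->
  forall c, uniq c -> 3 <= size c -> cycle (with_pairs M) c ->
  exists2 c', uniq c' & [/\ 3 <= size c', cycle edge c' & {subset c <= c'}].
Proof.
elim: M => [_ c uc sc cc|e M IHM leM c uc sc cc].
  exists c => //; split=> //; rewrite -(eq_cycle (e := with_pairs [::])) //.
  by move=> x y; rewrite /with_pairs !in_nil !orbF.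
have leM' : {in M, forall e, #|G| <= deg e.1 + deg e.2}.
  by move=> d dM; apply: leM; rewrite inE dM orbT.
set Q := with_pairs M in IHM.
have [cQ|ncQ] := boolP (cycle Q c); first exact: IHM leM' c uc sc cQ.
have [y yc nQy] : exists2 y, y \in c & ~~ Q y (next c y).
  apply/hasP; apply: contraR ncQ => /hasPn nQ.
  by apply: cycle_from_next => // y /nQ; rewrite negbK.
have [i s0 def_c] := rot_to yc.
have [x [s def_s]] : exists x s, s0 = x :: s.
  case: s0 def_c => [|x s]; last by exists x, s.
  by move/(congr1 size); move: sc; rewrite size_rot /= => + sc1; rewrite sc1.
have def_x : next c y = x by rewrite -(next_rot i uc) def_c def_s /= eqxx.
rewrite def_x in nQy.
have pc : perm_eq (x :: rcons s y) c.
  by rewrite perm_sym -(perm_rot i) def_c def_s; perm_count.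
have uc' : uniq (x :: rcons s y) by rewrite (perm_uniq pc).
have ss : 0 < size s.
  by move: sc; rewrite -(perm_size pc) /= size_rcons.
have : cycle (with_pairs (e :: M)) (y :: x :: s) by rewrite -def_s -def_c rot_cycle.
rewrite /= rcons_path => /and3P[eyx ps ely].
have ee : (e == (x, y)) || (e == (y, x)).
  move: eyx nQy; rewrite /Q /with_pairs !inE.
  by rewrite ![_ == e]eq_sym; do 5![case: (_ == _) | case: (_ \in _) | case: (edge _ _)].
have Qe u v : with_pairs (e :: M) u v -> (u, v) != (x, y) -> (u, v) != (y, x) -> Q u v.
  rewrite /Q /with_pairs !inE => /or3P[->//|/predU1P[|->]|/predU1P[|->]];
    rewrite ?orbT // => de; case/orP: ee; rewrite -de => /eqP[-> ->]; rewrite ?eqxx //.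
have ps' : path Q x (rcons s y).
  case: s ss ps ely uc' {def_s def_c pc} => // z s _ /= /andP[xz ps] ely.
  rewrite inE negb_or => /and3P[/andP[nxz nxs] nzs us].
  have xy : x != y by move: nxs; rewrite mem_rcons inE negb_or => /andP[].
  have zy : z != y by move: nzs; rewrite mem_rcons inE negb_or => /andP[].
  apply/andP; split.
    by apply: Qe; rewrite // xpair_eqE ?eqxx ?(negbTE zy) ?(negbTE xy).
  have: path (with_pairs (e :: M)) z (rcons s y) by rewrite rcons_path ps.
  apply: (sub_in_path (P := predC1 x)) => [u v /= ux vx uv|].
    by apply: Qe; rewrite // xpair_eqE ?(negbTE ux) ?(negbTE vx) ?andbF.
  apply/allP=> v; rewrite inE => /predU1P[->|vs] /=; first by rewrite eq_sym.
  by apply: contraNneq nxs => <-.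
have [||||||c' uc1 [sc' cc' cs]] := @closure_step Q x (rcons s y).
- exact: with_pairs_sym.
- by move=> u v; rewrite /Q /with_pairs => ->.
- by [].
- by rewrite size_rcons.
- by [].
- rewrite last_rcons; have := leM e (mem_head _ _).
  by case/orP: ee => /eqP-> //=; rewrite addnC.
have [c2 uc2 [sc2 cc2 cs2]] := IHM leM' c' uc1 sc' cc'.
exists c2 => //; split=> // v vc; apply: cs2; apply: cs.
by rewrite (perm_mem pc).
Qed.

Lemma near_cycle c : uniq c -> 3 <= size c -> cycle near c ->
  exists2 c', uniq c' & [/\ 3 <= size c', cycle edge c' & {subset c <= c'}].
Proof.
move=> uc sc cc.
pose M := [seq e : G * G <- enum {: G * G} | #|G| <= deg e.1 + deg e.2].
apply: (closure_pairs (M := M)) => //.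
  by move=> e; rewrite mem_filter => /andP[].
apply: sub_cycle cc => x y /andP[_ /orP[xy|le_n]]; rewrite /with_pairs ?xy //.
by rewrite mem_filter le_n mem_enum orbT.
Qed.

End Heavy.

Arguments near {G} x y.

Definition claw_near (G : sgraph) : Prop := forall c x y z : G,
  edge c x -> edge c y -> edge c z -> x != y -> x != z -> y != z ->
  [\/ near x y, near x z | near y z].

(** * Cycles with an ear *)

Section Theta.

Variable G : sgraph.
Implicit Types (u v x y z t : G) (zs SA SB l A m B s c : seq G).

(* The arcs SA and SB of the cycle and its ear zs are all read from u to v.  The
   cycle is compared with cycles of near rather than of edge. *)
Record config u v zs SA SB : Prop := Config {
  cfg_uniq : uniq (u :: v :: SA ++ SB ++ zs);
  cfgA : path edge u (rcons SA v);
  cfgB : path edge u (rcons SB v);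
  cfgZ : path edge u (rcons zs v);
  cfgZ0 : zs != [::];
  cfg_heavy : forall h : G, heavy h -> h \in u :: v :: SA ++ SB;
  cfg_max : forall c : seq G, uniq c -> 3 <= size c -> cycle near c ->
    (forall h : G, heavy h -> h \in c) -> size c <= size (u :: v :: SA ++ SB);
  cfg_ear : forall x y s, x \in u :: v :: SA ++ SB ->
    y \in u :: v :: SA ++ SB -> x != y -> s != [::] ->
    path edge x (rcons s y) -> {in s, forall z, z \notin u :: v :: SA ++ SB} ->
    size zs <= size s }.

Lemma edge_path x s : path edge x s -> path near x s.
Proof. by apply: sub_path => a b; apply: edge_near. Qed.

Lemma config_swap u v zs SA SB : config u v zs SA SB -> config u v zs SB SA.
Proof.
case=> U eA eB eZ Z0 hv mx er.
have pe : perm_eq (u :: v :: SA ++ SB) (u :: v :: SB ++ SA) by perm_count.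
have pm := perm_mem pe; split=> //.
- by rewrite -(perm_uniq (_ : perm_eq (u :: v :: SA ++ SB ++ zs) _)) //; perm_count.
- by move=> h; rewrite -pm; apply: hv.
- by move=> c; rewrite -(perm_size pe); apply: mx.
- move=> x y s; rewrite -!pm => xC yC xy s0 es sC; apply: er es _ => // z zs'.
  by rewrite pm sC.
Qed.

Lemma config_rev u v zs SA SB :
  config u v zs SA SB -> config v u (rev zs) (rev SA) (rev SB).
Proof.
case=> U eA eB eZ Z0 hv mx er.
have pe : perm_eq (u :: v :: SA ++ SB) (v :: u :: rev SA ++ rev SB).
  by perm_count.
have pm := perm_mem pe.
have er' a b L : path edge a (rcons L b) -> path edge b (rcons (rev L) a).
  by apply: link_rev; apply: edge_sym.
split.
- rewrite -(perm_uniq (_ : perm_eq (u :: v :: SA ++ SB ++ zs) _)) //.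
  by perm_count.
- exact: er'.
- exact: er'.
- exact: er'.
- by rewrite -size_eq0 size_rev size_eq0.
- by move=> h; rewrite -pm; apply: hv.
- by move=> c; rewrite -(perm_size pe); apply: mx.
- move=> x y s; rewrite -!pm size_rev => xC yC xy s0 es sC; apply: er es _ => // z zs'.
  by rewrite pm sC.
Qed.

(** Any nonempty part [zs1] of the ear already exceeds the maximal length. This permits reroutings
    that leave the ear at an inner vertex. *)
Lemma config_noham u v zs SA SB zs1 S :
  config u v zs SA SB -> {subset zs1 <= zs} -> uniq zs1 -> zs1 != [::] ->
  perm_eq S (u :: v :: SA ++ SB ++ zs1) -> noham near S.
Proof.
case=> U eA eB eZ Z0 hv mx er s1 u1 n1 pS c /perm_trans/(_ pS) pc.
have pu : perm_eq (u :: v :: SA ++ SB ++ zs1) ((u :: v :: SA ++ SB) ++ zs1).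
  by perm_count.
have sz1 : 0 < size zs1 by rewrite lt0n size_eq0.
apply/negP=> cc; have := mx c; rewrite (perm_uniq pc) (perm_uniq pu).
have -> : uniq ((u :: v :: SA ++ SB) ++ zs1).
  have : uniq ((u :: v :: SA ++ SB) ++ zs) by rewrite /= -catA.
  rewrite !cat_uniq => /and3P[-> /hasPn nC _]; rewrite u1 andbT /=.
  by apply/hasPn=> z /s1; apply: nC.
rewrite (perm_size pc) (perm_size pu) size_cat => H.
suff: size (u :: v :: SA ++ SB) + size zs1 <= size (u :: v :: SA ++ SB).
  by rewrite -[X in _ <= X]addn0 leq_add2l leqNgt sz1.
apply: H => //; first by rewrite /= !addSn !ltnS (leq_trans sz1) ?leq_addl.
move=> h /hv; rewrite (perm_mem pc) (perm_mem pu) mem_cat => -> //.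
Qed.

(* The clusters D1 at u and D2 at v, of which the arcs of the cycle traverse the
   segments l2, l3 and m2, m3, are joined by zs, A and B. *)
Record theta u v zs l2 A m2 l3 B m3 : Prop := Theta {
  th_cfg : config u v zs (l2 ++ A ++ m2) (l3 ++ B ++ m3);
  th_D1 : cluster near (u :: l2 ++ l3) u (last u l2) (last u l3);
  th_D2 : cluster near (v :: m2 ++ m3) v (head v m2) (head v m3);
  th_l2 : l2 != [::]; th_l3 : l3 != [::];
  th_m2 : m2 != [::]; th_m3 : m3 != [::] }.

Lemma theta_swap u v zs l2 A m2 l3 B m3 :
  theta u v zs l2 A m2 l3 B m3 -> theta u v zs l3 B m3 l2 A m2.
Proof.
case=> cf c1 c2 *; split=> //; first exact: config_swap.
  by apply: cluster_perm _ (cluster_swap23 (@near_sym G) c1); perm_count.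
by apply: cluster_perm _ (cluster_swap23 (@near_sym G) c2); perm_count.
Qed.

Lemma last_rev x s : last x (rev s) = head x s.
Proof. by case: s => //= y s; rewrite rev_cons last_rcons. Qed.

Lemma head_rev x s : head x (rev s) = last x s.
Proof. by case/lastP: s => //= s y; rewrite rev_rcons last_rcons. Qed.

Lemma rev_neq0 (s : seq G) : s != [::] -> rev s != [::].
Proof. by rewrite -!size_eq0 size_rev. Qed.

Lemma theta_rev u v zs l2 A m2 l3 B m3 :
  theta u v zs l2 A m2 l3 B m3 ->
  theta v u (rev zs) (rev m2) (rev A) (rev l2) (rev m3) (rev B) (rev l3).
Proof.
case=> cf c1 c2 *; split; rewrite ?last_rev ?head_rev ?rev_neq0 //.
- by have := config_rev cf; rewrite !rev_cat -!catA.
- by apply: cluster_perm _ c2; perm_count.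
- by apply: cluster_perm _ c1; perm_count.
Qed.

Section ThetaFacts.

Variables (u v : G) (zs l2 A m2 l3 B m3 : seq G).
Hypothesis th : theta u v zs l2 A m2 l3 B m3.

Let cf := th_cfg th.

Lemma theta_linkA : path near (last u l2) (rcons A (head v m2)).
Proof.
have := edge_path (cfgA cf); case: m2 (th_m2 th) => // b m _.
rewrite rcons_cat cat_path => /andP[_].
by rewrite rcons_cat rcons_cons -cat_rcons cat_path => /andP[].
Qed.

Lemma theta_linkZ : path near u (rcons zs v).
Proof. exact: edge_path (cfgZ cf). Qed.

Lemma theta_noham zs1 S : {subset zs1 <= zs} -> uniq zs1 -> zs1 != [::] ->
  perm_eq S (u :: v :: (l2 ++ A ++ m2) ++ (l3 ++ B ++ m3) ++ zs1) ->
  noham near S.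
Proof. exact: config_noham cf. Qed.

Lemma theta_uniqZ : uniq zs.
Proof. by have := cfg_uniq cf; rewrite /= !cat_uniq => /and3P[_ _ /and5P[]]. Qed.

Lemma theta_terminals1 : uniq [:: u; last u l2; last u l3].
Proof.
have := cfg_uniq cf.
case/lastP: l2 (th_l2 th) => // l a _; case/lastP: l3 (th_l3 th) => // l' b _.
rewrite !last_rcons => U.
have : uniq ([:: u] ++ [:: a] ++ [:: b]).
  apply: subseq_uniq U; rewrite [X in subseq _ X](_ : _ =
    [:: u] ++ (v :: rcons l a ++ A ++ m2) ++ (rcons l' b ++ B ++ m3) ++ zs);
    last by rewrite /= !catA.
  do ![apply: cat_subseq]; first exact: subseq_refl.
    by rewrite sub1seq inE mem_cat mem_rcons mem_head orbT.
  by rewrite sub1seq !mem_cat mem_rcons mem_head.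
by [].
Qed.

Lemma theta_uniq :
  uniq ((u :: l2 ++ l3) ++ (v :: m2 ++ m3) ++ zs ++ A ++ B).
Proof.
have := cfg_uniq cf; rewrite (perm_uniq (_ : perm_eq _
  ((u :: l2 ++ l3) ++ (v :: m2 ++ m3) ++ zs ++ A ++ B))) //.
by perm_count.
Qed.

End ThetaFacts.
Arguments theta_noham {u v zs l2 A m2 l3 B m3} th {zs1 S}.

Section ThetaExchange.

Variables (u v : G) (zs l2 A m2 l3 B m3 : seq G).
Hypothesis th : theta u v zs l2 A m2 l3 B m3.

Let nsym := @near_sym G.
Let lA := theta_linkA th.
Let lB := theta_linkA (theta_swap th).
Let lZ := theta_linkZ th.
Let Z0 := cfgZ0 (th_cfg th).

Lemma theta_A_neq0 : A != [::].
Proof.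
apply/eqP=> A0; case: (theta_no_edge_link nsym (th_D1 th) (th_D2 th) lZ lB).
apply: (theta_noham th (zs1 := zs)); rewrite ?(theta_uniqZ th) //.
by rewrite A0; perm_count.
Qed.

Lemma theta_noham_full :
  noham near ((u :: l2 ++ l3) ++ (v :: m2 ++ m3) ++ zs ++ A ++ B).
Proof.
by apply: (theta_noham th (zs1 := zs)); rewrite ?(theta_uniqZ th) //; perm_count.
Qed.

End ThetaExchange.

Section ThetaSeparation.

Variables (u v : G) (zs l2 A m2 l3 B m3 : seq G).
Hypothesis th : theta u v zs l2 A m2 l3 B m3.

Let nsym := @near_sym G.
Let lA := theta_linkA th.
Let lB := theta_linkA (theta_swap th).
Let lZ := theta_linkZ th.

Lemma theta_D1_D2 x y : x \in u :: l2 ++ l3 -> y \in v :: m2 ++ m3 ->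
  near x y -> [\/ x = u /\ y = v, x = last u l2 /\ y = head v m2
                | x = last u l3 /\ y = head v m3].
Proof.
have ub : uniq [:: v; head v m2; head v m3].
  by have := theta_terminals1 (theta_rev th); rewrite !last_rev.
move=> xD yD xy; have H := theta_cross nsym (theta_terminals1 th) ub (th_D1 th) (th_D2 th) lZ lA lB.
exact: (H x y (theta_noham_full th) xD yD xy).
Qed.

Lemma theta_lastA : last (last u l2) A = last u A.
Proof. by case: A (theta_A_neq0 th). Qed.

(** Otherwise the ear could be cut behind [z] and turned back into the cluster, the clusters being
    still joined by [A] and [B]. The rest of the ear may be dropped; vertices of [A] may not, which
    is why the analogous facts about [A] concern only its end vertices. *)
Lemma theta_D1_Z x z : x \in u :: l2 ++ l3 -> z \in zs -> near z x -> x = u.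
Proof.
move=> xD zZ zx; have uZ := theta_uniqZ th.
have sZ := @theta_noham _ _ _ _ _ _ _ _ _ th.
have [p1 [p2 dZ]] : exists p1 p2, zs = rcons p1 z ++ p2.
  by case/path.splitP: zZ => p1 p2; exists p1, p2.
have lp : path near u (rcons p1 z).
  by move: lZ; rewrite dZ rcons_cat cat_path => /andP[].
move: zx; rewrite -(last_rcons u p1 z); apply: (theta_last_cluster nsym
  (th_D1 th) (th_D2 th) lp lA lB) xD.
apply: (sZ (rcons p1 z)).
- by move=> w wp; rewrite dZ mem_cat wp.
- by move: uZ; rewrite dZ cat_uniq => /andP[].
- by case: (p1).
- by perm_count.
Qed.

Lemma theta_headA_Z z : z \in zs -> ~~ near z (head u A).
Proof.
move=> zZ; have uZ := theta_uniqZ th.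
have sZ := @theta_noham _ _ _ _ _ _ _ _ _ th.
have [p1 [p2 dZ]] : exists p1 p2, zs = rcons p1 z ++ p2.
  by case/path.splitP: zZ => p1 p2; exists p1, p2.
have lp : path near u (rcons p1 z).
  by move: lZ; rewrite dZ rcons_cat cat_path => /andP[].
have := theta_A_neq0 th; case dA : A => [//|x A'] _.
move: lA; rewrite dA /= => /andP[_ lA'].
apply/negP; rewrite -(last_rcons u p1 z); apply: (theta_last_first nsym
  (th_D1 th) (th_D2 th) lp lA' lB).
apply: (sZ (rcons p1 z)).
- by move=> w wp; rewrite dZ mem_cat wp.
- by move: uZ; rewrite dZ cat_uniq => /andP[].
- by case: (p1).
- by rewrite dA; perm_count.
Qed.

Lemma theta_D1_lastA x : x \in u :: l2 ++ l3 -> near (last u A) x -> x = last u l2.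
Proof.
move=> xD; rewrite -theta_lastA.
have lA' : path near (last u l2) A by move: lA; rewrite rcons_path => /andP[].
apply: (theta_last_cluster nsym (cluster_rot nsym (th_D1 th))
  (cluster_rot nsym (th_D2 th)) lA' lB lZ) xD.
by apply: noham_perm _ (theta_noham_full th); perm_count.
Qed.

Lemma theta_lastA_headB : ~~ near (last u A) (head u B).
Proof.
have := theta_A_neq0 (theta_swap th); case dB : B => [//|x B'] _.
move: lB; rewrite dB /= => /andP[_ lB'].
have lA' : path near (last u l2) A by move: lA; rewrite rcons_path => /andP[].
apply/negP; rewrite -theta_lastA; apply: (theta_last_first nsym
  (cluster_rot nsym (th_D1 th)) (cluster_rot nsym (th_D2 th)) lA' lB' lZ).
by apply: noham_perm _ (theta_noham_full th); rewrite dB; perm_count.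
Qed.

End ThetaSeparation.

(** Large clusters are measured by short links, since a vertex absorbed by a cluster is taken from
    [A] or [B]. The ends and the ear are fixed in the comparison, the arcs are not. *)
Definition theta_min u v zs (l2 A m2 l3 B m3 : seq G) : Prop :=
  theta u v zs l2 A m2 l3 B m3 /\
  forall l2' A' m2' l3' B' m3', theta u v zs l2' A' m2' l3' B' m3' ->
    size A + size B <= size A' + size B'.

Lemma theta_min_swap u v zs (l2 A m2 l3 B m3 : seq G) :
  theta_min u v zs l2 A m2 l3 B m3 -> theta_min u v zs l3 B m3 l2 A m2.
Proof.
case=> th mn; split=> [|l2' A' m2' l3' B' m3' /theta_swap/mn].
  exact: theta_swap.
by rewrite addnC [size B' + _]addnC.
Qed.

Lemma theta_min_rev u v zs (l2 A m2 l3 B m3 : seq G) :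
  theta_min u v zs l2 A m2 l3 B m3 ->
  theta_min v u (rev zs) (rev m2) (rev A) (rev l2) (rev m3) (rev B) (rev l3).
Proof.
case=> th mn; split=> [|l2' A' m2' l3' B' m3' /theta_rev]; first exact: theta_rev.
by rewrite revK !size_rev => /mn; rewrite !size_rev.
Qed.

Lemma uniq_cat_notin (s1 s2 : seq G) x : uniq (s1 ++ s2) -> x \in s2 -> x \notin s1.
Proof. by rewrite cat_uniq => /and3P[_ /hasPn ne _] /ne. Qed.

Section ThetaMin.

Variables (u v : G) (zs l2 A m2 l3 B m3 : seq G).
Hypothesis thm : theta_min u v zs l2 A m2 l3 B m3.
Let th := thm.1.
Let nsym := @near_sym G.

(** Otherwise the head of [A] is near two vertices of the cluster, one of them the terminal, and
    [cluster_absorb] shortens [A]. *)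
Lemma theta_min_headA x : x \in u :: l2 ++ l3 -> near (head u A) x -> x = last u l2.
Proof.
have := theta_A_neq0 th; case dA : A => [//|a A'] _ xD /= ax.
apply/eqP; apply: contraT => xl.
have lA := theta_linkA th; rewrite dA in lA; case/andP: lA => la _.
have aD : a \notin u :: l2 ++ l3.
  apply: (uniq_cat_notin (theta_uniq th)).
  by rewrite dA !mem_cat mem_head !orbT.
have c1 := cluster_absorb nsym (cluster_rot nsym (th_D1 th)) _ xD xl ax aD.
have th' : theta u v zs (rcons l2 a) A' m2 l3 B m3.
  case: (th) => cf _ c2 n2 n3 k2 k3; split=> //.
  - by rewrite cat_rcons; move: cf; rewrite dA.
  - rewrite last_rcons; apply: cluster_perm _ (cluster_rot nsym (cluster_rot nsym (c1 _))).
      by perm_count.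
    by rewrite near_sym.
  - by case: (l2).
by have := thm.2 _ _ _ _ _ _ th'; rewrite dA /= addSn ltnn.
Qed.

(** If the two heads were near, [cluster_absorb2] would take in both of them at once. *)
Lemma theta_min_headAB : ~~ near (head u A) (head u B).
Proof.
have := theta_A_neq0 th; case dA : A => [//|a A'] _.
have := theta_A_neq0 (theta_swap th); case dB : B => [//|b B'] _ /=.
apply/negP=> ab.
have lA := theta_linkA th; rewrite dA in lA; case/andP: lA => la _.
have lB := theta_linkA (theta_swap th); rewrite dB in lB; case/andP: lB => lb _.
rewrite near_sym in la; rewrite near_sym in lb.
have c1 := cluster_absorb2 nsym (cluster_rot nsym (th_D1 th)) la lb ab.
have th' : theta u v zs (rcons l2 a) A' m2 (rcons l3 b) B' m3.
  case: (th) => cf _ c2 n2 n3 k2 k3; split=> //.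
  - by rewrite !cat_rcons; move: cf; rewrite dA dB.
  - rewrite !last_rcons.
    apply: cluster_perm _ (cluster_rot nsym (cluster_rot nsym c1)).
    by perm_count.
  - by case: (l2).
  - by case: (l3).
have := thm.2 _ _ _ _ _ _ th'; rewrite dA dB /= addSn addnS.
by rewrite ltnNge leqnSn.
Qed.

End ThetaMin.

End Theta.

(** * Existence of a minimal theta *)

Section InitialTheta.

Variable G : sgraph.
Let nsym := @near_sym G.

Lemma config_uniqZ (u v : G) zs SA SB : config u v zs SA SB -> uniq zs.
Proof.
move/cfg_uniq.
rewrite [X in uniq X](_ : _ = (u :: v :: SA ++ SB) ++ zs) ?cat_uniq.
  by case/and3P.
by rewrite /= catA.
Qed.

(** If [z] and [a] were near, [z] could be inserted into the cycle between [u] and [a]. *)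
Lemma config_ear_arc (u v z a : G) zs SA SB :
  config u v (z :: zs) (a :: SA) SB -> ~~ near z a.
Proof.
move=> cf; apply/negP=> za.
have w1 : walk near u z [:: u; z].
  by apply: walk2; have := edge_path (cfgZ cf) => /= /andP[].
have w2 : walk near a v (a :: rcons SA v).
  have := edge_path (cfgA cf) => /= /andP[_ p].
  by apply/walkP; exists (rcons SA v); rewrite last_rcons.
have := link_rev nsym (edge_path (cfgB cf)); rewrite rcons_path => /andP[p l].
apply: (noham_walk _ (walk_path (walk_cat w1 w2 za) p) l (perm_refl _)).
apply: (config_noham (zs1 := [:: z]) cf) => //.
  by move=> w; rewrite inE => /eqP->; rewrite mem_head.
by perm_count.
Qed.

(** An empty arc could be replaced by the ear, giving a longer cycle. *)
Lemma config_arc_neq0 (u v : G) zs SA SB : config u v zs SA SB -> SA != [::].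
Proof.
move=> cf; apply/eqP=> SA0.
have w := walk_link (walk1 near u) (edge_path (cfgZ cf)) (walk1 near v).
have := link_rev nsym (edge_path (cfgB cf)); rewrite rcons_path => /andP[p l].
apply: (noham_walk _ (walk_path w p) l (perm_refl _)).
apply: (config_noham (zs1 := zs) cf) => //; last by rewrite SA0; perm_count.
  exact: config_uniqZ cf.
exact: cfgZ0 cf.
Qed.

Hypothesis clawG : claw_near G.

(** Of the three pairs of leaves of the claw at [u] formed by both arcs and the ear, only this one
    can be near. *)
Lemma config_arcs_near (u v a b : G) zs SA SB :
  config u v zs (a :: SA) (b :: SB) -> near a b.
Proof.
move=> cf; have := cfgZ0 cf; case dz : zs => [//|z zs'] _; subst zs.
have U := cfg_uniq cf.
have za := config_ear_arc cf; have zb := config_ear_arc (config_swap cf).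
have ua : edge u a by have /= /andP[] := cfgA cf.
have ub : edge u b by have /= /andP[] := cfgB cf.
have uz : edge u z by have /= /andP[] := cfgZ cf.
have sub : subseq [:: a; b; z] (u :: v :: (a :: SA) ++ (b :: SB) ++ z :: zs').
  apply: subseq_trans _ (subseq_cons _ _); apply: subseq_trans _ (subseq_cons _ _).
  rewrite -[[:: a; b; z]]/([:: a] ++ [:: b] ++ [:: z]).
  by do ![apply: cat_subseq]; rewrite sub1seq mem_head.
have := subseq_uniq sub U; rewrite /= !inE negb_or andbT => /andP[/andP[ab az] bz].
case: (clawG ua ub uz ab az bz) => // h; first by move: za; rewrite near_sym h.
by move: zb; rewrite near_sym h.
Qed.

(** The first clusters are the triangles formed by an end of the ear and its two neighbours on the
    cycle. *)
Lemma theta_init (u v : G) zs SA SB : config u v zs SA SB ->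
  exists l2 A m2 l3 B m3, theta u v zs l2 A m2 l3 B m3.
Proof.
move=> cf0.
have arc SA' SB' : config u v zs SA' SB' ->
    exists a A a', SA' = [:: a] ++ A ++ [:: a'].
  move=> cf; have := config_arc_neq0 cf.
  case dA : SA' => [//|a A0] _; subst SA'.
  case/lastP: A0 cf => [|A a'] cf; last by exists a, A, a'; rewrite cats1.
  (* The arc cannot consist of [a] alone: a cycle through everything would go from [u] along the ear
     to [v], then to [a], to the near vertex [b'] and back along the other arc. *)
  exfalso; have := config_arc_neq0 (config_swap cf).
  case/lastP: SB' cf => [//|SB' b'] cf _.
  have := config_rev cf; rewrite rev_rcons => /config_arcs_near ab'.
  have w := walk_link (walk1 near u) (edge_path (cfgZ cf)) (walk1 near v).
  have va : near v a.
    by have := edge_path (cfgA cf); rewrite /= andbT => /andP[_]; rewrite near_sym.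
  have := link_rev nsym (edge_path (cfgB cf)).
  rewrite rev_rcons /= rcons_path => /and3P[_ p l].
  have w2 := walk_cat w (walk1 near a) va.
  have := walk_path (walk_cat w2 (walk1 near b') ab') p => w3.
  apply: (noham_walk _ w3 l (perm_refl _)).
  apply: (config_noham (zs1 := zs) cf) => //; last by perm_count.
    exact: config_uniqZ cf.
  exact: cfgZ0 cf.
have [a [A [a' dA]]] := arc _ _ cf0.
have [b [B [b' dB]]] := arc _ _ (config_swap cf0).
subst SA SB; exists [:: a], A, [:: a'], [:: b], B, [:: b'].
have ab := config_arcs_near cf0.
have ab' : near a' b'.
  by have := config_rev cf0; rewrite !rev_cat => /config_arcs_near.
split=> //.
  apply: (cluster_triangle nsym) => //.
  - by have := edge_path (cfgA cf0) => /= /andP[].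
  - by have := edge_path (cfgB cf0) => /= /andP[].
have cfr := config_rev cf0; rewrite !rev_cat in cfr.
apply: (cluster_triangle nsym) => //.
- by have := edge_path (cfgA cfr) => /= /andP[].
- by have := edge_path (cfgB cfr) => /= /andP[].
Qed.

(** Being a theta is not a decidable property, but the final goal is [False], so the double negation
    of the least number principle is enough. The longest cycle and the shortest ear are obtained in
    the same style. *)
Lemma theta_min_exists (u v : G) zs SA SB : config u v zs SA SB ->
  ~ (forall l2 A m2 l3 B m3, ~ theta_min u v zs l2 A m2 l3 B m3).
Proof.
move=> /theta_init[l2 [A [m2 [l3 [B [m3 th]]]]]] H.
have [n] := ubnP (size A + size B).
elim: n => // n IHn in l2 A m2 l3 B m3 th *; rewrite ltnS => le_n.
apply: (H l2 A m2 l3 B m3); split=> // l2' A' m2' l3' B' m3' th'.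
rewrite leqNgt; apply/negP=> lt'.
exact: IHn th' (leq_trans lt' le_n).
Qed.

End InitialTheta.

(** * A longest cycle through the heavy vertices and a shortest ear *)

Section LongestCycle.

Variable G : sgraph.
Hypothesis conn2 : kconnected 2 G.

Lemma two_connected_path (w x y : G) : x != w -> y != w ->
  exists p, [/\ path edge x p, last x p = y & w \notin x :: p].
Proof.
move=> xw yw; have [_ /(_ [set w])] := conn2.
rewrite cards1 => /(_ isT)[_ conn].
have xA : x \in ~: [set w] by rewrite !inE.
have yA : y \in ~: [set w] by rewrite !inE.
case/connectP: (conn (exist _ x xA) (exist _ y yA)) => p pp ey.
exists (map val p); split.
- by rewrite -[x]/(val (exist (fun x => x \in ~: [set w]) x xA)) path_map.
- rewrite -[x]/(val (exist (fun x => x \in ~: [set w]) x xA)) last_map -ey //.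
- rewrite inE negb_or eq_sym xw /=; apply/mapP=> -[[z zA] _ /= wz].
  by move: zA; rewrite !inE wz eqxx.
Qed.

Lemma third_vertex (x y : G) : exists w, (w != x) && (w != y).
Proof.
have [lt3 _] := conn2; apply/existsP; apply: contraLR lt3 => /existsPn H.
rewrite -leqNgt -cardsT; apply: leq_trans (_ : #|[set x; y]| <= 2); last first.
  by rewrite cards2; case: eqP.
apply/subset_leq_card/subsetP=> w _; rewrite !inE.
by have := H w; rewrite negb_and !negbK.
Qed.

Lemma other_neighbour (x y : G) : exists2 a, edge x a & a != y.
Proof.
suff H z : z != x -> exists2 a, edge x a & a != z.
  have [xy|] := eqVneq y x; last exact: H.
  have [z /andP[zx _]] := third_vertex x x; have [a xa _] := H z zx.
  by exists a; rewrite // xy eq_sym edge_neq.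
move=> zx; have [w /andP[wx wz]] := third_vertex x z.
have xz : x != z by rewrite eq_sym.
have [[|a p] /= [pp lp np]] := two_connected_path xz wz.
  by move: wx; rewrite -lp eqxx.
case/andP: pp => xa _; exists a => //.
by move: np; rewrite !inE !negb_or => /and3P[_ za _]; rewrite eq_sym.
Qed.

(** The pair itself closes a path that leaves [x] through a neighbour [a]; taking [a] different from
    [y] ensures length at least three. *)
Lemma near_cycle_through (x y : G) : near x y ->
  exists2 c, uniq c & [/\ 3 <= size c, cycle near c, x \in c & y \in c].
Proof.
move=> xy; have yx : y != x by case/andP: xy; rewrite eq_sym.
have [a xa ay] := other_neighbour x y.
have ax : a != x by rewrite eq_sym edge_neq.
have [p [pp lp xp]] := two_connected_path ax yx.
case/shortenP: pp lp => q pq uq sq lq.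
have xq : x \notin a :: q.
  apply: contra xp; rewrite !inE => /predU1P[->|/sq->]; by rewrite ?eqxx ?orbT.
exists [:: x, a & q]; first by rewrite /= xq.
split.
- by case: q lq {pq uq sq xq} => //= ay'; move: ay; rewrite ay' eqxx.
- by rewrite /= rcons_path lq edge_near //= edge_path //= near_sym.
- exact: mem_head.
- by rewrite inE -lq mem_last orbT.
Qed.

(** Heavy vertices are pairwise near, so three or more of them form a near cycle in any order. With
    fewer, 2-connectedness gives a cycle through one near pair that contains them. *)
Lemma heavy_near_cycle :
  exists2 c : seq G, uniq c &
    [/\ 3 <= size c, cycle near c & forall h, heavy h -> h \in c].
Proof.
have hP h : heavy h -> h \in enum (@heavy G) by rewrite mem_enum.
have all_h : all (@heavy G) (enum (@heavy G)).
  by apply/allP=> h; rewrite mem_enum.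
have := enum_uniq (@heavy G).
case: (enum (@heavy G)) hP all_h => [|x [|y s]] hP all_h ue.
- have [lt3 _] := conn2; have /card_gt0P[x _] : 0 < #|G| by apply: ltn_trans lt3.
  have [y xy _] := other_neighbour x x.
  have [c uc [sc cc _ _]] := near_cycle_through (edge_near xy).
  by exists c => //; split=> // h /hP.
- have [y xy _] := other_neighbour x x.
  have [c uc [sc cc xc _]] := near_cycle_through (edge_near xy).
  by exists c => //; split=> // h /hP; rewrite inE => /eqP->.
case: s hP all_h ue => [|z s] hP all_h ue.
  move: all_h ue; rewrite /= !inE !andbT => /andP[hx hy] xy.
  have [c uc [sc cc xc yc]] := near_cycle_through (heavy_near hx hy xy).
  by exists c => //; split=> // h /hP; rewrite !inE => /orP[]/eqP->.
exists [:: x, y, z & s] => //; split=> //.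
rewrite (cycle_path x) /=.
have /= -> : path near x [:: y, z & s].
  apply: pairwise_near_path => // a b ah bh; apply: heavy_near; exact: (allP all_h).
rewrite andbT.
have hl : last z s \in z :: s by apply: mem_last.
apply: heavy_near.
- by have /allP := all_h; apply; rewrite !in_cons -in_cons hl !orbT.
- by case/andP: all_h.
- by apply: contraTneq ue => e; rewrite /= -{1}e in_cons hl orbT.
Qed.

Definition heavy_cycle (c : seq G) : Prop :=
  [/\ uniq c, 3 <= size c, cycle edge c & forall h, heavy h -> h \in c].

(** A longest cycle of edges also beats the cycles of [near], because [near_cycle] turns a longer
    competitor into a cycle of edges through all its vertices. *)
Lemma longest_heavy_cycle :
  (forall c, heavy_cycle c ->
     (forall c' : seq G, uniq c' -> 3 <= size c' -> cycle near c' ->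
        (forall h, heavy h -> h \in c') -> size c' <= size c) -> False) ->
  False.
Proof.
move=> H.
have extend (c : seq G) : uniq c -> 3 <= size c -> cycle near c ->
    (forall h, heavy h -> h \in c) ->
    exists2 c', heavy_cycle c' & size c <= size c'.
  move=> uc sc cc hc; have [c' uc' [sc' cc' cs]] := near_cycle uc sc cc.
  by exists c'; [split=> // h /hc/cs | apply: uniq_leq_size].
have [c0 uc0 [sc0 cc0 hc0]] := heavy_near_cycle.
have [c hc _] := extend c0 uc0 sc0 cc0 hc0.
have [n] := ubnP (#|G| - size c).
elim: n c hc => // n IHn c hc; rewrite ltnS => le_n.
apply: (H c) => // c' uc' sc' cc' hc'; rewrite leqNgt; apply/negP=> lt_c.
have [c2 hc2 le2] := extend c' uc' sc' cc' hc'.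
apply: IHn hc2 _; apply: leq_trans le_n; apply: ltn_sub2l.
  by apply: leq_trans lt_c _; rewrite -(card_uniqP uc') max_card.
exact: leq_trans lt_c le2.
Qed.

Lemma first_hit (c : seq G) x p : path edge x p -> last x p \in c -> x \notin c ->
  exists q y, [/\ path edge x (rcons q y), y \in c, {in q, forall z, z \notin c} &
                 {subset rcons q y <= p}].
Proof.
elim: p x => [|a p IHp] x /=; first by move=> _ ->.
case/andP=> xa pp lc xc; have [ac|ac] := boolP (a \in c).
  by exists [::], a; split=> //=; [rewrite xa | move=> z; rewrite !inE => /eqP->; rewrite eqxx].
have [q [y [pq yc qc sq]]] := IHp a pp lc ac.
exists (a :: q), y; split=> //=; first by rewrite xa.
  by move=> z; rewrite inE => /predU1P[->|/qc].
by move=> z; rewrite !inE => /predU1P[->|/sq->]; rewrite ?eqxx ?orbT.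
Qed.

(** The inner walk may repeat vertices, as can happen when two walks are glued at a common start; a
    shortest ear has no repetition. *)
Definition ear (c : seq G) x y s : Prop :=
  [/\ x \in c, y \in c & x != y] /\
  [/\ s != [::], path edge x (rcons s y) & {in s, forall z, z \notin c}].

(** From a vertex off the cycle one walk first hits the cycle at [u]; another, which avoids [u] by
    2-connectedness, hits it elsewhere. *)
Lemma ear_exists (c : seq G) z : uniq c -> 2 <= size c -> z \notin c ->
  exists x y s, ear c x y s.
Proof.
move=> uc sc zc.
have zneq a : a \in c -> z != a by move=> ac; apply: contraNneq zc => ->.
have [c0 c0c] : exists a, a \in c.
  by case: c sc {uc zc zneq} => // a c _; exists a; rewrite mem_head.
have [w /andP[wz wc0]] := third_vertex z c0.
rewrite eq_sym in wz; rewrite eq_sym in wc0.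
have [p [pp lp _]] := two_connected_path wz wc0.
have [|q [u [pq uC qc _]]] := first_hit pp _ zc; first by rewrite lp.
have [c1 c1c c1u] : exists2 a, a \in c & a != u.
  case: c sc uc {zc zneq c0c lp qc uC} => [|a [|b c]] //= _ /andP[ab _].
  have [eau|au] := eqVneq a u; last by exists a; rewrite ?mem_head.
  exists b; first by rewrite !inE eqxx orbT.
  by apply: contraNneq ab => ->; rewrite eau mem_head.
have [p' [pp' lp' up']] := two_connected_path (zneq u uC) c1u.
have [|q' [y [pq' yC qc' sq']]] := first_hit pp' _ zc; first by rewrite lp'.
exists u, y, (rev q ++ z :: q'); split.
  split=> //; apply: contraNneq up' => ->.
  by rewrite in_cons sq' ?orbT // mem_rcons mem_head.
split.
- by rewrite -size_eq0 size_cat addnS.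
- rewrite rcons_cat rcons_cons -cat_rcons cat_path.
  by rewrite (link_rev (@edge_sym G) pq) last_rcons.
- move=> a; rewrite mem_cat mem_rev inE => /or3P[/qc|/eqP->|/qc'] //.
Qed.

Lemma shortest_ear (c : seq G) : (exists x y s, ear c x y s) ->
  (forall x y s, ear c x y s ->
     (forall x' y' s', ear c x' y' s' -> size s <= size s') -> False) -> False.
Proof.
move=> [x [y [s es]]] H; have [n] := ubnP (size s).
elim: n => // n IHn in x y s es *; rewrite ltnS => le_n.
apply: (H x y s) => // x' y' s' es'; rewrite leqNgt; apply/negP=> lt'.
exact: IHn es' (leq_trans lt' le_n).
Qed.

Lemma dup_split (s : seq G) : ~~ uniq s ->
  exists z s1 s2 s3, s = s1 ++ z :: s2 ++ z :: s3.
Proof.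
elim: s => //= a s IHs; rewrite negb_and negbK.
case/orP=> [/path.splitPr[s1 s2]|/IHs[z [s1 [s2 [s3 ->]]]]].
  by exists a, [::], s1, s2.
by exists z, (a :: s1), s2, s3.
Qed.

Lemma shortest_ear_uniq c x y s : ear c x y s ->
  (forall x' y' s', ear c x' y' s' -> size s <= size s') -> uniq s.
Proof.
move=> [xy [s0 ps sc]] mn; apply: contraT => /dup_split[z [s1 [s2 [s3 ds]]]].
have /mn : ear c x y (s1 ++ z :: s3).
  split=> //; split.
  - by rewrite -size_eq0 size_cat addnS.
  - move: ps; rewrite ds !rcons_cat !cat_path /= !rcons_cat !cat_path /=.
    by case/and3P=> -> -> /and3P[_ _ ->].
  - move=> a; rewrite mem_cat inE => aS; apply: sc.
    rewrite ds !mem_cat !inE !mem_cat !inE.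
    by case/or3P: aS => ->; rewrite ?orbT.
rewrite ds !size_cat /= size_cat /=; move: (size s1) (size s2) (size s3).
by clear; lia.
Qed.

Lemma config_of_cycle (c : seq G) u v zs :
  heavy_cycle c ->
  (forall c' : seq G, uniq c' -> 3 <= size c' -> cycle near c' ->
        (forall h, heavy h -> h \in c') -> size c' <= size c) ->
  ear c u v zs -> (forall x' y' s', ear c x' y' s' -> size zs <= size s') ->
  exists SA SB, config u v zs SA SB.
Proof.
move=> [uc sc cc hc] mx er mn; have uz := shortest_ear_uniq er mn.
case: er => -[uC vC uv] [z0 pz zc].
have [i c' dc] := rot_to uC.
have vc' : v \in c'.
  by move: vC; rewrite -(mem_rot i) dc inE eq_sym (negbTE uv).
have [SA [SB' dc']] : exists SA SB', c' = SA ++ v :: SB'.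
  by case/path.splitPr: vc' => SA SB'; exists SA, SB'.
subst c'.
have pc : perm_eq (u :: v :: SA ++ rev SB') c.
  by rewrite perm_sym -(perm_rot i) dc; perm_count.
have pm := perm_mem pc.
have : cycle edge (u :: SA ++ v :: SB') by rewrite -dc rot_cycle.
rewrite /= rcons_cat rcons_cons -cat_rcons cat_path last_rcons => /andP[pA pB].
exists SA, (rev SB'); split=> //.
- have pe : perm_eq (u :: v :: SA ++ rev SB' ++ zs) ((u :: v :: SA ++ rev SB') ++ zs).
    by perm_count.
  rewrite (perm_uniq pe) cat_uniq uz (perm_uniq pc) uc andbT /=.
  by apply/hasPn=> z /zc; rewrite -pm.
- by apply: link_rev pB; apply: edge_sym.
- by move=> h /hc; rewrite pm.
- by rewrite (perm_size pc).
- move=> x y s; rewrite !pm => xC yC xy s0 ps sC; apply: (mn x y s).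
  by split=> //; split=> // z /sC; rewrite pm.
Qed.

End LongestCycle.

Lemma nonhamiltonian_theta (G : sgraph) :
  kconnected 2 G -> claw_near G -> ~ hamiltonian G ->
  (forall (u v : G) zs l2 A m2 l3 B m3, ~ theta_min u v zs l2 A m2 l3 B m3) ->
  False.
Proof.
move=> conn2 cl nh H; apply: (longest_heavy_cycle conn2) => c hc mx.
have [z zc] : exists z, z \notin c.
  apply/existsP; apply: contra_notT nh => /existsPn ac.
  case: hc => uc sc cc _; exists c; split=> //; first exact/andP.
  by move=> x; have := ac x; rewrite negbK.
have [uc sc _ _] := hc.
apply: (shortest_ear (ear_exists conn2 uc (ltnW sc) zc)) => u v zs er mn.
have [SA [SB cf]] := config_of_cycle hc mx er mn.
by apply: (theta_min_exists cl cf) => *; apply: H.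
Qed.

(** * The ends of a shortest ear are not both heavy *)

Section Runs.

Variables (T : eqType) (U V : pred T) (k : nat) (S : seq T).

Let both := predI U V.
Let neither := predC (predU U V).

Hypothesis long_runs : forall l p o q t,
  S = l ++ p :: o ++ q :: t -> U p -> V q -> all neither o -> k <= size o.
Hypothesis head_S : forall x t, S = x :: t -> U x && ~~ V x.
Hypothesis last_S : forall l x, S = rcons l x -> V x && ~~ U x.
Hypothesis S_neq0 : S != [::].

(* Just before a V-point the current U-point is followed by at least k points
   which are neither; each point that is both closes one such run and opens
   another. *)
Lemma run_count : k * (count both S + 1) <= count neither S.
Proof.
suff H s :
    (forall l p r, S = l ++ p :: r ++ s -> U p -> all neither r ->
       k * (count both s + 1) <= size r + count neither s) /\
    (forall l, S = l ++ s -> k * count both s <= count neither s).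
  case dS : S S_neq0 => [//|x s] _; have /andP[Ux Vx] := head_S dS.
  have [/(_ [::] x [::] dS Ux isT) + _] := H s.
  by rewrite /= /both /neither /= Ux (negbTE Vx).
elim: s => [|q s [IH1 IH0]]; split=> [l p r|l] dS.
- move=> Up; case/lastP: r dS => [|r x] dS.
    have dSp : S = rcons l p by rewrite dS cats1.
    by have /andP[_] := last_S dSp; rewrite Up.
  have dSx : S = rcons (l ++ p :: r) x by rewrite dS cats0 rcons_cat.
  have /andP[Vx _] := last_S dSx; rewrite all_rcons => /andP[nx _].
  by move: nx; rewrite /neither /= Vx orbT.
- by rewrite muln0.
- move=> Up nr; have [Vq|Vq] := boolP (V q).
    have kr := long_runs dS Up Vq nr; rewrite /= /both /neither /= Vq !orbT andbT /=.
    have [Uq|Uq] := boolP (U q).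
      have := IH1 (l ++ p :: r) q [::] _ Uq isT; rewrite -catA => /(_ dS).
      by rewrite /both /neither; move: kr; clear; rewrite ?mulnDr ?muln1 /=; lia.
    have := IH0 (rcons (l ++ p :: r) q); rewrite cat_rcons -catA => /(_ dS).
    by rewrite /both /neither; move: kr; clear; rewrite ?mulnDr ?muln1 ?muln0 /=; lia.
  have [Uq|Uq] := boolP (U q).
    have := IH1 (l ++ p :: r) q [::] _ Uq isT; rewrite -catA => /(_ dS).
    rewrite /= /both /neither /= (negbTE Vq) Uq /=.
    by clear; rewrite ?mulnDr ?muln1 ?muln0 /=; lia.
  have := IH1 l p (rcons r q); rewrite cat_rcons all_rcons nr andbT => /(_ dS Up).
  rewrite /= /both /neither /= (negbTE Vq) (negbTE Uq) /= size_rcons => /(_ isT).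
  by clear; rewrite ?mulnDr ?muln1 ?muln0 /=; lia.
- have [Uq|Uq] := boolP (U q).
    have := IH1 l q [::] dS Uq isT; rewrite /= /both /neither /= Uq /=.
    by case: (V q); clear; rewrite ?mulnDr ?muln1 ?muln0 /=; lia.
  have := IH0 (rcons l q); rewrite cat_rcons => /(_ dS).
  rewrite /= /both /neither /= (negbTE Uq) /=.
  by clear; lia.
Qed.

End Runs.

Lemma path_walk (T : eqType) (F : rel T) x s :
  path F x s -> s != [::] -> walk F (head x s) (last x s) s.
Proof. by case: s => // y s /= /andP[_ ps] _; apply/walkP; exists s. Qed.

Section BothHeavy.

Variable G : sgraph.
Let nsym := @near_sym G.
Hypothesis clawG : claw_near G.

Lemma config_heads_near (u v : G) zs SA SB :
  config u v zs SA SB -> near (head u SA) (head u SB).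
Proof.
move=> cf; have := config_arc_neq0 cf; have := config_arc_neq0 (config_swap cf).
case: SA SB cf => [//|a SA] [//|b SB] cf _ _.
exact: (config_arcs_near clawG cf).
Qed.

Lemma config_lasts_near (u v : G) zs SA SB :
  config u v zs SA SB -> near (last u SA) (last u SB).
Proof.
move=> cf; have := config_heads_near (config_rev cf); rewrite !head_rev.
have := config_arc_neq0 cf; have := config_arc_neq0 (config_swap cf).
by case: SA SB {cf} => [//|a SA] [//|b SB].
Qed.

(** If [o] were shorter than [Z], a cycle could exchange them: from [u] to [p], back to the head of
    the arc, across to the other arc and through it, from the end of the first arc back to [q], to
    [v] and home along [Z]. No heavy vertex is lost, since the heavy [u] is near all other ones and
    no vertex of [o] is near [u]. *)
Lemma config_run (u v : G) zs SA SB Z l p o q t :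
  config u v zs SA SB -> heavy u ->
  uniq Z -> {in Z, forall z, z \notin u :: v :: SA ++ SB} ->
  path near u (rcons Z v) ->
  SA = l ++ p :: o ++ q :: t -> near u p -> near v q ->
  all (predC (predU (near u) (near v))) o -> size Z <= size o.
Proof.
move=> cf hu uZ ZC pZ dA up vq no; rewrite leqNgt; apply/negP=> lt_o.
have pA := edge_path (cfgA cf); have pB := edge_path (cfgB cf).
have /andP[pB1 _] : path near u SB && near (last u SB) v by rewrite -rcons_path.
have wB := path_walk pB1 (config_arc_neq0 (config_swap cf)).
have [wl wt] : walk near (head u SA) p (rcons l p) /\
    walk near q (last u SA) (q :: t).
  move: pA; rewrite dA rcons_cat rcons_cons -cat_rcons cat_path last_rcons.
  case/andP=> p1; rewrite rcons_cat cat_path rcons_cons /= => /and3P[_ _ p2].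
  split; last first.
    rewrite !last_cat /= !last_cat /=; apply/walkP; exists t; split=> //.
    by move: p2; rewrite rcons_path => /andP[].
  have := path_walk p1; rewrite last_rcons.
  by case: l {dA p1} => [|a l] /= ->.
have w1 := walk_cat (walk1 near u) (walk_rev nsym wl) up.
have w2 := walk_cat w1 wB (config_heads_near cf).
have ba : near (last u SB) (last u SA) by rewrite nsym; apply: config_lasts_near cf.
have w3 := walk_cat w2 (walk_rev nsym wt) ba.
have qv : near q v by rewrite nsym.
have w4 := walk_cat w3 (walk1 near v) qv.
have := link_rev nsym pZ; rewrite rcons_path => /andP[pZ' lZ].
have w5 := walk_path w4 pZ'; have cc := walk_cycle w5 lZ; move: cc.
set c := _ ++ rev Z => cc.
have pe : perm_eq (c ++ o) ((u :: v :: SA ++ SB) ++ Z).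
  by rewrite /c dA; perm_count.
have uc0 : u \in c by rewrite /c mem_head.
clearbody c; have uc : uniq (c ++ o).
  rewrite (perm_uniq pe) cat_uniq uZ andbT; apply/andP; split.
    have := cfg_uniq cf; rewrite [X in uniq X](_ : _ = (u :: v :: SA ++ SB) ++ zs).
      by rewrite cat_uniq => /andP[].
    by rewrite /= catA.
  by apply/hasPn=> z /ZC.
have sc := perm_size pe; rewrite !size_cat in sc.
have := cfg_max cf _ _ cc; rewrite (subseq_uniq (prefix_subseq _ _) uc) => /(_ isT).
have ltc : size (u :: v :: SA ++ SB) < size c.
  move: sc lt_o; rewrite /= size_cat; move: (size c) (size o) (size Z) (size SA) (size SB).
  by clear; lia.
move=> cm; suff: size c <= size (u :: v :: SA ++ SB) by rewrite leqNgt ltc.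
apply: cm => //.
  by apply: leq_trans ltc; rewrite /= size_cat; case: (SA) (config_arc_neq0 cf).
move=> h hh; have : h \in c ++ o by rewrite (perm_mem pe) mem_cat (cfg_heavy cf hh).
rewrite mem_cat => /orP[//|ho]; have /= := allP no h ho.
rewrite heavy_near //; apply: contraTneq uc => uh.
rewrite cat_uniq; apply/negP=> /and3P[_ /hasP[]]; exists h => //.
by rewrite -uh.
Qed.

(** Let [k] be the length of [Z] and [b] the number of vertices on the arcs near both ends. By
    [run_count] at least [k * (b + 2)] vertices are near neither end, while the ends have at most
    [b + k] common neighbours. Their degree sum is thus at most [#|G| - k], too small for two heavy
    vertices. *)
Lemma both_heavy_count (u v : G) zs SA SB Z :
  config u v zs SA SB -> heavy u -> heavy v ->
  ~~ near v (head u SA) -> ~~ near v (head u SB) ->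
  ~~ near u (last u SA) -> ~~ near u (last u SB) ->
  uniq Z -> {in Z, forall z, z \notin u :: v :: SA ++ SB} -> Z != [::] ->
  path near u (rcons Z v) ->
  #|[set z | [&& edge u z, edge v z & z \notin u :: v :: SA ++ SB]]| <= size Z ->
  False.
Proof.
move=> cf hu hv vA vB uA uB uZ ZC Z0 pZ cmZ.
pose both := predI (near u) (near v).
pose neither := predC (predU (near u) (near v)).
have runs SA' SB' : config u v zs SA' SB' -> ~~ near v (head u SA') ->
    ~~ near u (last u SA') ->
    {in Z, forall z, z \notin u :: v :: SA' ++ SB'} ->
    size Z * (count both SA' + 1) <= count neither SA'.
  move=> cf' vA' uA' ZC'; apply: run_count.
  - by move=> l p o q t dS; apply: config_run cf' hu uZ ZC' pZ dS.
  - move=> x t dS; move: vA' (edge_path (cfgA cf')); rewrite dS /= => ->.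
    by rewrite andbT => /andP[].
  - move=> l x dS; move: uA' (edge_path (cfgA cf')); rewrite dS last_rcons => ->.
    by rewrite andbT rcons_path last_rcons nsym => /andP[].
  - exact: config_arc_neq0 cf'.
have rA := runs _ _ cf vA uA ZC.
have rB : size Z * (count both SB + 1) <= count neither SB.
  apply: runs (config_swap cf) vB uB _ => z /ZC.
  by rewrite !inE !mem_cat [(z \in SB) || _]orbC.
have uC : uniq (u :: v :: SA ++ SB).
  have := cfg_uniq cf; rewrite [X in uniq X](_ : _ = (u :: v :: SA ++ SB) ++ zs).
    by rewrite cat_uniq => /andP[].
  by rewrite /= catA.
pose Nu := [set w | edge u w]; pose Nv := [set w | edge v w].
have cI : #|Nu :&: Nv| <= count both SA + count both SB + size Z.
  rewrite -(cardsID [set w in u :: v :: SA ++ SB]); apply: leq_add; last first.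
    apply: leq_trans cmZ; apply/eq_leq/eq_card=> w; rewrite !inE.
    by rewrite andbC -andbA.
  rewrite -count_cat -size_filter.
  have uf : uniq (filter both (SA ++ SB)).
    by apply: filter_uniq; move: uC => /= /and3P[].
  rewrite -(card_uniqP uf); apply/subset_leq_card/subsetP=> w.
  rewrite !inE mem_filter /= => /andP[/andP[uw vw]].
  rewrite !edge_near //; case/or3P=> [/eqP ew|/eqP ew|->] //.
    by move: uw; rewrite ew edge_irrefl.
  by move: vw; rewrite ew edge_irrefl.
have cO : count neither SA + count neither SB <= #|~: (Nu :|: Nv)|.
  rewrite -count_cat -size_filter.
  have uf : uniq (filter neither (SA ++ SB)).
    by apply: filter_uniq; move: uC => /= /and3P[].
  rewrite -(card_uniqP uf); apply/subset_leq_card/subsetP=> w.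
  rewrite !inE mem_filter /= => /andP[nw _]; apply: contra nw.
  by case/orP=> /edge_near->; rewrite ?orbT.
have cU := cardsUI Nu Nv; have cC := cardsC (Nu :|: Nv).
have Zk : 0 < size Z by rewrite lt0n size_eq0.
have bA : count both SA <= size Z * count both SA by rewrite leq_pmull.
have bB : count both SB <= size Z * count both SB by rewrite leq_pmull.
move: hu hv; rewrite /heavy /deg -/Nu -/Nv.
move: rA rB cI cO cU cC bA bB Zk; rewrite !mulnDr !muln1.
move: (size Z * count both SA) (size Z * count both SB).
move: (count both SA) (count both SB) (count neither SA) (count neither SB).
move: (size Z) #|Nu :&: Nv| #|Nu :|: Nv| #|~: (Nu :|: Nv)| #|Nu| #|Nv| #|G|.
by clear; lia.
Qed.

End BothHeavy.

(** * Copies of small graphs *)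

Lemma iso_sym (G H : sgraph) : iso G H -> iso H G.
Proof.
case=> f [g fK gK] fE; exists g; first by exists f.
by move=> x y; rewrite -fE !gK.
Qed.

Lemma iso_trans (G H K : sgraph) : iso G H -> iso H K -> iso G K.
Proof.
case=> f bf fE [g bg gE]; exists (g \o f); first exact: bij_comp.
by move=> x y /=; rewrite gE fE.
Qed.

Definition adj (E : seq (nat * nat)) : rel nat :=
  fun i j => ((i, j) \in E) || ((j, i) \in E).

Lemma adj_sym E : symmetric (adj E).
Proof. by move=> i j; rewrite /adj orbC. Qed.

Definition dist2 (k : nat) (E : seq (nat * nat)) : seq (nat * nat) :=
  [seq e <- [seq (i, j) | i <- iota 0 k, j <- iota 0 k] |
    [&& e.1 < e.2, ~~ adj E e.1 e.2 & has (fun m => adj E e.1 m && adj E m e.2) (iota 0 k)]].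

Section Copies.

Variable G : sgraph.
Implicit Type s : seq G.

Fixpoint copy_row (E : seq (nat * nat)) (x : G) (i j : nat) s : bool :=
  if s is y :: s' then (edge x y == adj E i j) && copy_row E x i j.+1 s' else true.

(* The entries of s are not required to be distinct: see copy_uniq. *)
Fixpoint copy_from (E : seq (nat * nat)) (i : nat) s : bool :=
  if s is x :: s' then copy_row E x i i.+1 s' && copy_from E i.+1 s' else true.

Definition copy k E s := (size s == k) && copy_from E 0 s.

Lemma copy_rowP E x x0 i j s : copy_row E x i j s ->
  forall d, d < size s -> edge x (nth x0 s d) = adj E i (j + d).
Proof.
elim: s j => //= y s IHs j /andP[/eqP xy cs] [|d] /=; first by rewrite addn0.
by rewrite ltnS addnS -addSn; apply: IHs.
Qed.

Lemma copy_fromP E x0 i s : copy_from E i s ->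
  forall d e, d < e < size s -> edge (nth x0 s d) (nth x0 s e) = adj E (i + d) (i + e).
Proof.
elim: s i => [|x s IHs] i /=; first by move=> _ d e; rewrite ltn0 andbF.
move=> /andP[row cs] [|d] [|e] //; rewrite ?ltnS ?ltn0 //= => he.
  by rewrite (copy_rowP x0 row) // addn0 addnS.
by rewrite !addnS -!addSn; apply: IHs.
Qed.

Definition loopless k E := all (fun i => ~~ adj E i i) (iota 0 k).

Lemma copy_edge k E s x0 : copy k E s -> loopless k E ->
  forall d e, d < k -> e < k -> edge (nth x0 s d) (nth x0 s e) = adj E d e.
Proof.
case/andP=> /eqP sk cs ll d e dk ek.
have [de|ed|<-] := ltngtP d e.
- by rewrite (copy_fromP x0 cs) ?add0n // de sk.
- by rewrite edge_sym adj_sym (copy_fromP x0 cs) ?add0n // ed sk.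
- by rewrite edge_irrefl; have /allP/(_ d) := ll; rewrite mem_iota => /(_ dk)/negbTE.
Qed.

(** Nonadjacent vertices must differ in some adjacency, so that a list with the prescribed
    adjacencies has no repetition. The leaves of a claw violate this condition. *)
Definition separated k E :=
  all (fun i => all (fun j => [|| i == j, adj E i j |
    has (fun m => adj E i m != adj E j m) (iota 0 k)]) (iota 0 k)) (iota 0 k).

Lemma copy_uniq k E s : copy k E s -> loopless k E -> separated k E -> uniq s.
Proof.
move=> cs ll sep; have /andP[/eqP sk _] := cs.
case: s cs sk => // x0 s; move: (x0 :: s) => {}s cs sk.
apply/(uniqP x0) => d e; rewrite !inE sk => dk ek de; apply/eqP.
have /allP/(_ d) := sep; rewrite mem_iota => /(_ dk)/allP/(_ e).
rewrite mem_iota => /(_ ek)/or3P[//||].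
  by rewrite -(copy_edge x0 cs ll) // de edge_irrefl.
case/hasP=> m; rewrite mem_iota => /andP[_ mk].
by rewrite -!(copy_edge x0 cs ll) // de eqxx.
Qed.

Lemma copy_iso k E s : copy k E s -> loopless k E -> uniq s ->
  iso (graph_of_edges k E) (induced [set x in s]).
Proof.
move=> cs ll us; have /andP[/eqP sk _] := cs.
have mem_s (i : 'I_k) : tnth (in_tuple s) (cast_ord (esym sk) i) \in [set x in s].
  by rewrite inE mem_tnth.
pose f (i : graph_of_edges k E) : induced [set x in s] :=
  exist (fun x => x \in [set x in s]) _ (mem_s i).
have nthE (x0 : G) i : val (f i) = nth x0 s i by rewrite /= (tnth_nth x0).
have f_inj : injective f.
  move=> i j /(congr1 val) /eqP; rewrite (nthE (val (f i))) (nthE (val (f i)) j).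
  by rewrite nth_uniq ?sk // => /eqP/val_inj.
exists f.
  apply: inj_card_bij => //.
  by rewrite card_ord card_sig cardsE (card_uniqP us) sk.
move=> i j; rewrite [LHS](_ : _ = edge (val (f i)) (val (f j))) //.
rewrite (nthE (val (f i)) i) (nthE (val (f i)) j) (copy_edge _ cs ll) //.
rewrite /= /edges_rel -/(adj E i j); have [<-|//] := eqVneq i j.
by have /allP/(_ i) := ll; rewrite mem_iota => /(_ (ltn_ord i))/negbTE.
Qed.

(** This is [f_heavy] on explicit lists: [dist2] evaluates, so each copy yields a Boolean formula in
    the heaviness of its vertices. A maximum that reaches the bound means that one of the two
    vertices is heavy. *)
Definition fan_heavy k E : Prop := forall s x0, copy k E s ->
  all (fun e => heavy (nth x0 s e.1) || heavy (nth x0 s e.2)) (dist2 k E).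

Lemma f_heavy_fan S k E : iso S (graph_of_edges k E) ->
  loopless k E -> separated k E -> f_heavy S G -> fan_heavy k E.
Proof.
move=> isoS ll sep fS s x0 cs; have us := copy_uniq cs ll sep.
have /andP[/eqP sk _] := cs.
have isoA : iso (induced [set x in s]) S.
  exact: iso_sym (iso_trans isoS (copy_iso cs ll us)).
apply/allP=> -[i j]; rewrite mem_filter /=.
case/andP=> /and3P[ij nij /hasP[m]]; rewrite mem_iota add0n => /andP[_ mk] /andP[im mj].
case/allpairsP=> -[i' j'] /= [ik jk [ei ej]]; subst i' j'.
move: ik jk; rewrite !mem_iota !add0n !leq0n /= => ik jk.
have mem_s d : d < k -> nth x0 s d \in [set x in s] by rewrite inE -sk => /mem_nth.
pose w d (dk : d < k) : induced [set x in s] :=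
  exist (fun x => x \in [set x in s]) _ (mem_s d dk).
have wE d e (dk : d < k) (ek : e < k) : edge (w d dk) (w e ek) = adj E d e.
  by rewrite -(copy_edge x0 cs ll).
have dij : is_dist (w i ik) (w j jk) 2.
  split.
    exists [:: w m mk; w j jk]; split=> //.
    by apply/and3P; split; rewrite ?wE.
  case=> [_ /(congr1 val) /= /eqP|a [|b p] //].
    by rewrite nth_uniq ?sk // => /eqP eij; rewrite eij ltnn in ij.
  by case/andP=> + _ /= ea; rewrite ea wE (negbTE nij).
have := fS _ isoA _ _ dij; rewrite /heavy /=.
move: (deg _) (deg _) #|G| => a b n.
by clear; case: leqP; lia.
Qed.

End Copies.

Lemma claw_o_heavy_near (G : sgraph) : o_heavy claw G -> claw_near G.
Proof.
move=> hc c x y z cx cy cz xy xz yz.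
have [exy|nxy] := boolP (edge x y); first by constructor 1; apply: edge_near.
have [exz|nxz] := boolP (edge x z); first by constructor 2; apply: edge_near.
have [eyz|nyz] := boolP (edge y z); first by constructor 3; apply: edge_near.
pose s := [:: c; x; y; z].
have cs : copy 4 [:: (0, 1); (0, 2); (0, 3)] s.
  by rewrite /copy /= cx cy cz (negbTE nxy) (negbTE nxz) (negbTE nyz).
have us : uniq s by rewrite /= !inE !negb_or xy xz yz !(edge_neq cx, edge_neq cy, edge_neq cz).
have [a [b [aA bA ab nab le_n]]] := hc _ (iso_sym (copy_iso cs isT us)).
have nr : near a b by rewrite /near ab le_n orbT.
move: aA bA nab ab nr; rewrite !inE.
case/or4P=> /eqP->; case/or4P=> /eqP->; rewrite ?eqxx ?cx ?cy ?cz //;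
  rewrite 1?edge_sym ?cx ?cy ?cz // => _ _ nr;
  by [constructor 1 | constructor 2 | constructor 3
     | constructor 1; rewrite near_sym | constructor 2; rewrite near_sym
     | constructor 3; rewrite near_sym].
Qed.

Definition path_edges k : seq (nat * nat) := [seq (j, j.+1) | j <- iota 0 k.-1].
Definition Z_edges k : seq (nat * nat) :=
  triangle_edges ++ [seq (j, j.+1) | j <- iota 2 k].
Definition bull_edges := triangle_edges ++ [:: (0, 3); (1, 4)].
Definition net_edges := triangle_edges ++ [:: (0, 3); (1, 4); (2, 5)].
Definition wounded_edges := triangle_edges ++ [:: (0, 3); (3, 5); (1, 4)].

Ltac split_ands :=
  repeat match goal with
  | H : is_true (_ && _) |- _ => case/andP: H => ? ?
  end.

Ltac close_ands :=
  repeat (apply/andP; split);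
  try first [ assumption | by rewrite edge_sym | by rewrite orbC ].

Ltac use_fan H l x0 :=
  let h := fresh "h" in
  have h := H l x0 ltac:(rewrite /copy /=; close_ands);
  rewrite /= in h; split_ands.

Section FanReductions.

Variable G : sgraph.
Notation fan := (@fan_heavy G).

(** In this and the next three reductions two induced copies of the smaller graph cover all pairs at
    distance two in the larger one. *)
Lemma fan_P4_P5 : fan 4 (path_edges 4) -> fan 5 (path_edges 5).
Proof.
move=> H [|a [|b [|c [|d [|e [|f s]]]]]] x0 //= /andP[_] /= h; split_ands.
by use_fan H [:: a; b; c; d] x0; use_fan H [:: b; c; d; e] x0; close_ands.
Qed.

Lemma fan_P5_P6 : fan 5 (path_edges 5) -> fan 6 (path_edges 6).
Proof.
move=> H [|a [|b [|c [|d [|e [|f [|g s]]]]]]] x0 //= /andP[_] /= h; split_ands.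
by use_fan H [:: a; b; c; d; e] x0; use_fan H [:: b; c; d; e; f] x0; close_ands.
Qed.

Lemma fan_Z1_bull : fan 4 (Z_edges 1) -> fan 5 bull_edges.
Proof.
move=> H [|a [|b [|c [|d [|e [|f s]]]]]] x0 //= /andP[_] /= h; split_ands.
by use_fan H [:: b; c; a; d] x0; use_fan H [:: a; c; b; e] x0; close_ands.
Qed.

Lemma fan_bull_net : fan 5 bull_edges -> fan 6 net_edges.
Proof.
move=> H [|a [|b [|c [|d [|e [|f [|g s]]]]]]] x0 //= /andP[_] /= h; split_ands.
by use_fan H [:: a; b; c; d; e] x0; use_fan H [:: a; c; b; d; f] x0; close_ands.
Qed.

End FanReductions.

(** * Triangles with three legs *)

Section InducedPaths.

Variable G : sgraph.
Implicit Types (x y z : G) (s l r : seq G).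

Fixpoint induced_path s : bool :=
  if s is x :: s' then
    (if s' is y :: s'' then edge x y && all (fun z => ~~ edge x z) s'' else true)
    && induced_path s'
  else true.

Lemma induced_path_suffix l r : induced_path (l ++ r) -> induced_path r.
Proof. by elim: l => //= x l IHl /andP[_]. Qed.

Lemma last_split (P : pred G) s : has P s ->
  exists l z r, [/\ s = l ++ z :: r, P z & all (predC P) r].
Proof.
elim/last_ind: s => // s z IHs; rewrite has_rcons.
have [Pz _|nPz /= /IHs[l [y [r [-> Py nr]]]]] := boolP (P z).
  by exists s, z, [::]; rewrite cats1.
by exists l, y, (rcons r z); rewrite rcons_cat rcons_cons all_rcons /= nPz.
Qed.

Lemma first_split (P : pred G) s : has P s ->
  exists l z r, [/\ s = l ++ z :: r, P z & all (predC P) l].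
Proof.
elim: s => //= x s IHs; have [Px _|nPx /= /IHs[l [z [r [-> Pz nl]]]]] := boolP (P x).
  by exists [::], x, s.
by exists (x :: l), z, r; rewrite /= nPx.
Qed.

(** Jumping from [x] to its last neighbour on the path leaves no later neighbour of [x]; the rest is
    treated in the same way. *)
Lemma induced_path_exists x s : path edge x s -> uniq (x :: s) ->
  exists s', [/\ induced_path (x :: s'), uniq (x :: s'), last x s' = last x s &
    {subset s' <= s}].
Proof.
have [n] := ubnP (size s); elim: n => // n IHn in x s *.
case: s => [|y s]; first by exists [::].
rewrite ltnS => le_n ps us.
have /last_split[l [z [r [ds xz nr]]]] : has (edge x) (y :: s).
  by case/andP: ps => /= ->.
have pr : path edge z r by move: ps; rewrite ds cat_path => /andP[_ /andP[]].
have ur : uniq (z :: r).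
  have : uniq (y :: s) by case/andP: us.
  by rewrite ds cat_uniq => /and3P[].
have [|r' [ir ur' lr sr]] := IHn z r _ pr ur.
  by apply: leq_trans le_n; rewrite ds size_cat /= addnS ltnS leq_addl.
exists (z :: r'); split.
- apply/andP; split=> //; apply/andP; split=> //.
  by apply/allP=> a /sr ar; have := allP nr a ar.
- apply/andP; split=> //; case/andP: us => xs _; apply: contra xs.
  by rewrite ds mem_cat !inE => /predU1P[->|/sr->]; rewrite ?eqxx ?orbT.
- by rewrite ds last_cat.
- move=> a; rewrite ds mem_cat !inE => /predU1P[->|/sr->].
    by rewrite eqxx orbT.
  by rewrite !orbT.
Qed.

Lemma first_on_path (P : pred G) x s : path edge x s -> P (last x s) -> ~~ P x ->
  exists w' w, [/\ w' \in x :: s, w \in s, edge w' w, ~~ P w' & P w].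
Proof.
elim: s x => [|y s IHs] x /=; first by move=> _ ->.
case/andP=> xy ps Pl nPx; have [Py|nPy] := boolP (P y).
  by exists x, y; rewrite !mem_head.
have [w' [w [w's ws ew nP Pw]]] := IHs y ps Pl nPy.
by exists w', w; rewrite in_cons w's orbT in_cons ws orbT.
Qed.

Variables (D : seq G) (p1 p2 p3 q1 q2 q3 : G).
Let H := [:: p1, p2, p3 & D].
Hypothesis connD : forall x y, x \in D -> y \in D ->
  exists s, [/\ path edge x s, last x s = y & {subset s <= D}].
Hypothesis q1D : q1 \in D.
Hypothesis q2D : q2 \in D.
Hypothesis q3D : q3 \in D.
Hypothesis p1D : {in D, forall x, edge p1 x = (x == q1)}.
Hypothesis p2D : {in D, forall x, edge p2 x = (x == q2)}.
Hypothesis p3D : {in D, forall x, edge p3 x = (x == q3)}.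
Hypothesis p12 : ~~ edge p1 p2.
Hypothesis p13 : ~~ edge p1 p3.
Hypothesis p23 : ~~ edge p2 p3.
Hypothesis np3 : p3 \notin D.
Hypothesis np12 : p1 != p2.
Hypothesis np13 : p1 != p3.
Hypothesis np23 : p2 != p3.
Hypothesis claw_free : forall c x y z, c \in H -> x \in H -> y \in H -> z \in H ->
  edge c x -> edge c y -> edge c z -> x != y -> x != z -> y != z ->
  [|| edge x y, edge x z | edge y z].

(* The legs s1, s2, s3 point towards p1, p2, p3; the leg towards p1 is reduced to
   p1 or can be prolonged by s. *)
Lemma triangle_with_legs : exists t1 t2 t3 s1 s2 s3 : G,
  [/\ [/\ t1 \in D, t2 \in D, t3 \in D & edge t1 t2 && edge t1 t3 && edge t2 t3],
      [/\ s1 \in p1 :: D, s2 \in p2 :: D & s3 \in p3 :: D],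
      [/\ edge s1 t1, edge s2 t2 & edge s3 t3],
      [/\ ~~ edge s1 t2, ~~ edge s1 t3, ~~ edge s2 t1, ~~ edge s2 t3 &
         [/\ ~~ edge s3 t1, ~~ edge s3 t2, ~~ edge s1 s2, ~~ edge s1 s3 &
             ~~ edge s2 s3]] &
      s1 = p1 \/ exists s : G, [/\ s \in p1 :: D, edge s1 s, ~~ edge s t1, ~~ edge s t2 &
                    [/\ ~~ edge s t3, ~~ edge s s2 & ~~ edge s s3]]].
Proof.
have p1q1 : edge p1 q1 by rewrite p1D.
have p2q2 : edge p2 q2 by rewrite p2D.
have p3q3 : edge p3 q3 by rewrite p3D.
have [s12 [ps12 ls12 sD12]] := connD q1D q2D.
have pp : path edge p1 (rcons (q1 :: s12) p2).
  by rewrite /= p1q1 rcons_path ps12 ls12 edge_sym.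
case/shortenP: pp (last_rcons p1 (q1 :: s12) p2) => s' ps' us' ss' ls'.
have [s [is_ us ls ss]] := induced_path_exists ps' us'.
have sub_s a : a \in s -> a \in D \/ a = p2.
  move=> /ss/ss'; rewrite mem_rcons !inE => /or3P[/eqP|/eqP->|/sD12]; by auto.
rewrite ls' in ls.
have p1s : p1 \notin s.
  by apply/negP=> /ss; move: us' => /andP[/negP].
pose onpi w := has (edge w) (p1 :: s).
have piH a : a \in p1 :: s -> a \in H.
  by rewrite !inE => /predU1P[->|/sub_s[->|->]]; rewrite ?eqxx ?orbT.
have intD a : a \in p1 :: s -> a != p1 -> a != p2 -> a \in D.
  by rewrite inE => /predU1P[->|/sub_s[//|->]]; rewrite eqxx.
have q1pi : onpi q1 by rewrite /onpi /= edge_sym p1q1.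
have splitpi l a r : p1 :: s = l ++ a :: r -> a != p1 -> a != p2 ->
    exists l' b c r', l = rcons l' b /\ r = c :: r'.
  move=> dpi ap1 ap2; case/lastP: l dpi => [[e _]|l' b dpi].
    by rewrite e eqxx in ap1.
  case: r dpi => [dpi|c r' _]; last by exists l', b, c, r'.
  move: ap2; rewrite -ls -[last p1 s]/(last p1 (p1 :: s)) dpi last_cat /=.
  by rewrite eqxx.
(* A neighbour [a] of [p3] on the induced path [p1 :: s] would be an inner vertex and the centre of
   a claw formed with [p3] and its two neighbours on the path. *)
have [Pp3|nPp3] := boolP (onpi p3).
  exfalso; case/hasP: Pp3 => a api p3a.
  have ap1 : a != p1 by apply: contraNneq p13 => <-; rewrite edge_sym.
  have ap2 : a != p2 by apply: contraNneq p23 => <-; rewrite edge_sym.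
  have aD := intD a api ap1 ap2.
  have [l [r dpi]] : exists l r, p1 :: s = l ++ a :: r.
    by case/path.splitPr: api => l r; exists l, r.
  have [l' [b [c [r' [dl dr]]]]] := splitpi _ _ _ dpi ap1 ap2.
  move: dpi; rewrite dl dr cat_rcons => dpi.
  have := is_; rewrite dpi => /induced_path_suffix /= /and3P[/and3P[ba bc _] /andP[ac _] _].
  have bpi : b \in p1 :: s by rewrite dpi mem_cat mem_head orbT.
  have cpi : c \in p1 :: s by rewrite dpi mem_cat !inE eqxx !orbT.
  have p3b x : x \in p1 :: s -> x != a -> ~~ edge p3 x.
    rewrite inE => /predU1P[->|/sub_s[xD|->]] xa; rewrite 1?edge_sym //.
    by rewrite edge_sym p3D //; apply: contra xa => /eqP->; move: p3a; rewrite p3D // eq_sym.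
  have ba' : b != a by apply: edge_neq.
  have ca' : c != a by rewrite eq_sym; apply: edge_neq.
  have p3x x : x \in p1 :: s -> p3 != x.
    rewrite inE => /predU1P[->|/sub_s[xD|->]]; rewrite 1?eq_sym //.
    by apply: contraNneq np3 => <-.
  have bc' : b != c.
    apply: contraTneq us => ebc; rewrite dpi ebc cat_uniq /= !inE eqxx orbT.
    by rewrite !andbF.
  have ab : edge a b by rewrite edge_sym.
  have p3H : p3 \in H by rewrite !inE eqxx !orbT.
  have := claw_free (piH a api) (piH b bpi) (piH c cpi) p3H ab ac _ bc' _ _.
  rewrite edge_sym p3a => /(_ isT); rewrite eq_sym p3x // => /(_ isT).
  rewrite eq_sym p3x // => /(_ isT); rewrite (negbTE bc) /= ![edge _ p3]edge_sym.
  by rewrite (negbTE (p3b b bpi ba')) (negbTE (p3b c cpi ca')).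
have [s31 [ps31 ls31 sD31]] := connD q3D q1D.
have pp3 : path edge p3 (q3 :: s31) by rewrite /= p3q3.
(* On the walk from [p3] towards [q1], [w] has a neighbour on the induced path while its predecessor
   [w'] has none. *)
have [|w' [w [w'p ws ew nw' ow]]] := first_on_path pp3 _ nPp3; first by rewrite /= ls31.
have wD : w \in D by move: ws; rewrite inE => /predU1P[->|/sD31].
have w'D : w' \in p3 :: D.
  by move: w'p; rewrite !inE => /or3P[->|/eqP->|/sD31->]; rewrite ?q3D ?orbT.
have off x : x \in p1 :: s -> ~~ edge w' x by move/hasPn: nw'; apply.
have wpi : w \notin p1 :: s by apply: contraL ew => /off.
have q1s : q1 \in p1 :: s.
  case: s is_ {us p1s intD splitpi piH off wpi onpi q1pi nPp3 nw' ow ss} ls sub_s => [_ e|y r].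
    by move: np12; rewrite -e /= eqxx.
  move=> /andP[/andP[p1y _] _] _ sub_s; case: (sub_s y); rewrite ?mem_head //.
    by move=> yD; move: p1y; rewrite p1D // => /eqP->; rewrite !inE eqxx orbT.
  by move=> yp2; move: p12; rewrite -yp2 p1y.
have wp1 : ~~ edge w p1.
  by rewrite edge_sym p1D //; apply: contraNneq wpi => ->.
have onpi_pi x : x \in p1 :: s -> onpi x.
  move=> xpi; have [l [r dpi]] : exists l r, p1 :: s = l ++ x :: r.
    by case/path.splitPr: xpi => l r; exists l, r.
  apply/hasP; case: r dpi => [|c r] dpi; last first.
    have ind := is_; rewrite dpi in ind.
    have /andP[/andP[xc _] _] := induced_path_suffix ind.
    by exists c; rewrite // dpi mem_cat !inE eqxx !orbT.
  case/lastP: l dpi => [[ex es]|l b dpi].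
    by move: np12; rewrite -ls es /= eqxx.
  have ind := is_; rewrite dpi cat_rcons in ind.
  have /andP[/andP[bx _] _] := induced_path_suffix ind.
  by exists b; rewrite 1?edge_sym // dpi mem_cat mem_rcons mem_head.
have wp2 : ~~ edge w p2.
  have [q2s|nq2s] := boolP (q2 \in p1 :: s).
    by rewrite edge_sym p2D //; apply: contraNneq wpi => ->.
  have := onpi_pi p2; rewrite -{1}ls mem_last => /(_ isT)/hasP[x].
  rewrite inE => /predU1P[->|xs]; first by rewrite edge_sym (negbTE p12).
  case: (sub_s x xs) => [xD|->]; last by rewrite edge_irrefl.
  by rewrite p2D // => /eqP xq2; rewrite inE -xq2 xs orbT in nq2s.
(* Since [a] is the first neighbour of [w] on the path, [w] misses the vertex [b] before it.
   Claw-freeness at [a] then makes the next vertex [c] a neighbour of [w], which gives the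
   triangle. *)
have [l [a [r [dpi wa nl]]]] := first_split ow.
have api : a \in p1 :: s by rewrite dpi mem_cat mem_head orbT.
have ap1 : a != p1 by apply: contraTneq wa => ->.
have ap2 : a != p2 by apply: contraTneq wa => ->.
have [l' [b [c [r' [dl dr]]]]] := splitpi _ _ _ dpi ap1 ap2.
subst l r; have ind := is_; rewrite dpi cat_rcons in ind.
have /= /and3P[/and3P[ba bc br'] /andP[ac ar'] _] := induced_path_suffix ind.
have bpi : b \in p1 :: s by rewrite dpi mem_cat mem_rcons mem_head.
have cpi : c \in p1 :: s by rewrite dpi mem_cat !inE eqxx !orbT.
have wb : ~~ edge w b by have /allP/(_ b) := nl; rewrite mem_rcons mem_head => /(_ isT).
have DH x : x \in D -> x \in H by rewrite !inE => ->; rewrite !orbT.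
have wneq x : x \in p1 :: s -> x != w by move=> xpi; apply: contraNneq wpi => <-.
have ab : edge a b by rewrite edge_sym.
have aw : edge a w by rewrite edge_sym.
have bc' : b != c.
  apply: contraTneq us => ebc; rewrite dpi ebc cat_uniq /= !mem_rcons !inE eqxx !orbT.
  by rewrite !andbF.
have wc : edge w c.
  have := claw_free (piH a api) (piH b bpi) (piH c cpi) (DH w wD) ab ac aw bc'.
  move=> /(_ (wneq b bpi) (wneq c cpi)).
  by rewrite (negbTE bc) edge_sym (negbTE wb) /= edge_sym.
have cp1 : c != p1 by apply: contraTneq wc => ->.
have cp2 : c != p2 by apply: contraTneq wc => ->.
have dpi2 : p1 :: s = (rcons l' b ++ [:: a]) ++ c :: r' by rewrite dpi -catA.
have [_ [_ [d [r'' [_ dr']]]]] := splitpi _ _ _ dpi2 cp1 cp2; subst r'.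
have w'H : w' \in H by move: w'D; rewrite !inE => /orP[]->; rewrite ?orbT.
have w'neq x : x \in p1 :: s -> w' != x.
  by move=> /onpi_pi ox; apply: contraNneq nw' => ->.
have ww' : edge w w' by rewrite edge_sym.
have dpi' : d \in p1 :: s by rewrite dpi mem_cat !inE eqxx !orbT.
have /= /andP[ad _] := ar'; have /= /andP[bd _] := br'.
have cd : edge c d.
  by have := induced_path_suffix ind => /= /and4P[_ _ /andP[]].
have da : a != d.
  apply: contraTneq us => ead; rewrite dpi ead cat_uniq /= !inE eqxx !orbT.
  by rewrite !andbF.
(* Otherwise [w] is the centre of a claw with leaves [w'], [a] and [d]. The legs of the triangle are
   therefore [b], [d] and [w']. *)
have wd : ~~ edge w d.
  apply/negP=> wd.
  have := claw_free (DH w wD) w'H (piH a api) (piH d dpi') ww' wa wd.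
  rewrite !w'neq // => /(_ isT isT da).
  by rewrite (negbTE (off a api)) (negbTE (off d dpi')) (negbTE ad).
have pref x l0 m0 : p1 :: s = l0 ++ m0 -> m0 != [::] -> x \in l0 -> x \in p1 :: D.
  move=> e0 m00 xl; have xpi : x \in p1 :: s by rewrite e0 mem_cat xl.
  have [->|xp1] := eqVneq x p1; first exact: mem_head.
  rewrite inE intD ?orbT //; apply: contraTneq us => xp2.
  rewrite e0 cat_uniq; apply/negP=> /and3P[_ /hasP[]]; exists x => //.
  rewrite xp2 -ls -[last p1 s]/(last p1 (p1 :: s)) e0 last_cat.
  by case: (m0) m00 => // y m1 _; rewrite [last _ _]/=; apply: mem_last.
have ds : d \in s.
  move: dpi; case: (l') => [|e l0] [_ ->]; rewrite ?mem_cat !inE eqxx ?orbT //.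
have p1pi : p1 = head p1 (rcons l' b).
  by move: dpi; case: (l') => [|e l0] [].
have off' x : x \in p1 :: s -> ~~ edge x w' by move=> /off; rewrite edge_sym.
exists a, c, w, b, d, w'; split; last 1 first.
(* The leg [b] is [p1] itself or is prolonged by its predecessor [e] on the path. *)
- case/lastP: l' {dpi2} dpi nl ind pref p1pi => [|l0 e] dpi nl ind pref /= p1pi.
    by left.
  right; exists e; rewrite !cat_rcons in dpi ind.
  have epi : e \in p1 :: s by rewrite dpi mem_cat mem_head orbT.
  have /= /and3P[/and5P[eb ea ec ed _] _ _] := induced_path_suffix ind.
  split=> //; last split.
  + apply: (pref e (rcons l0 e) [:: b, a, c, d & r'']) => //.
      by rewrite dpi cat_rcons.
    by rewrite mem_rcons mem_head.
  + by rewrite edge_sym.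
  + have /allP/(_ e) := nl; rewrite mem_rcons inE mem_rcons mem_head orbT => /(_ isT) /=.
    by rewrite edge_sym.
  + by [].
  + exact: off'.
- split=> //; last by rewrite ac aw edge_sym wc.
    by apply: intD.
  by apply: intD.
- split=> //.
    apply: (pref b (rcons l' b) [:: a, c, d & r'']) => //.
    by rewrite mem_rcons mem_head.
  by case: (sub_s d ds) => [dD|->]; rewrite !inE ?eqxx ?dD ?orbT.
- by split; rewrite // edge_sym.
- split=> //; last split; rewrite ?off ?off' // 1?edge_sym //.
Qed.

End InducedPaths.

(** * Forbidden subgraphs of a theta *)

Lemma not_near_edge (G : sgraph) (x y : G) : ~~ near x y -> ~~ edge x y.
Proof. exact/contra/edge_near. Qed.

Lemma not_near_heavy (G : sgraph) (x y : G) :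
  ~~ near x y -> x != y -> ~~ (heavy x && heavy y).
Proof. by move=> nxy xy; apply: contra nxy => /andP[hx hy]; apply: heavy_near. Qed.

(** The path leaves the neighbourhood of [u] somewhere; stopping at the first such place makes [u],
    [b], [b'] an induced path. *)
Lemma edge_run (G : sgraph) (u x : G) l : path edge u (rcons l x) -> l != [::] ->
  ~~ edge u x -> exists b b', [/\ b \in l, b' \in rcons l x, edge u b,
    edge b b' & ~~ edge u b'].
Proof.
case: l => //= a l /andP[ua pl] _ nux.
elim: l a ua pl => [|c l IHl] a ua /=.
  by rewrite andbT => ax; exists a, x; rewrite !inE !eqxx orbT.
case/andP=> ac pl; have [uc|nuc] := boolP (edge u c).
  have [b [b' [bl b'l ub bb' nub']]] := IHl c uc pl; exists b, b'.
  by split=> //; rewrite inE ?bl ?b'l orbT.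
by exists a, c; rewrite !inE !eqxx orbT.
Qed.

Section Sides.

Variable G : sgraph.
Variables (u v : G) (zs l2 A m2 l3 B m3 : seq G).
Hypothesis th : theta u v zs l2 A m2 l3 B m3.
Let nsym := @near_sym G.
Let uq := theta_uniq th.

Lemma theta_terminals2 : uniq [:: v; head v m2; head v m3].
Proof. by have := theta_terminals1 (theta_rev th); rewrite !last_rev. Qed.

Lemma theta_uniq_D1 : uniq (u :: l2 ++ l3).
Proof. by have := uq; rewrite cat_uniq => /andP[]. Qed.

Lemma theta_uniq_D2 : uniq (v :: m2 ++ m3).
Proof. by have := uq; rewrite cat_uniq => /and3P[_ _]; rewrite cat_uniq => /andP[]. Qed.

Lemma theta_l2_D1 x : x \in l2 -> [/\ x \in u :: l2 ++ l3, x != u & x \notin l3].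
Proof.
have := theta_uniq_D1; rewrite cons_uniq cat_uniq => /and4P[ul _ /hasPn nl _] xl.
split; first by rewrite inE mem_cat xl orbT.
  by apply: contraNneq ul => <-; rewrite mem_cat xl.
by apply/negP=> /nl; rewrite /= xl.
Qed.

Lemma theta_m3_m2 x : x \in m3 -> x \notin m2.
Proof.
have := theta_uniq_D2; rewrite cons_uniq cat_uniq => /and4P[_ _ /hasPn nl _].
exact: nl.
Qed.

Lemma theta_last_l2 : last u l2 \in l2.
Proof. by case: l2 (th_l2 th) => //= a l _; apply: mem_last. Qed.

Lemma theta_head_m2 : head v m2 \in m2.
Proof. by case: m2 (th_m2 th) => //= a l _; apply: mem_head. Qed.

Lemma theta_D1_v x : x \in u :: l2 ++ l3 -> near x v -> x = u.
Proof.
move=> xD xv; have := theta_terminals2; rewrite /= !inE negb_or.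
case: (theta_D1_D2 th xD (mem_head v (m2 ++ m3)) xv) => -[-> //] {1 3}->.
  by rewrite eqxx.
by rewrite eqxx andbF.
Qed.

Lemma theta_D1_m3 x y : x \in l2 -> y \in m3 -> ~~ near x y.
Proof.
move=> xl ym; have [xD xu xl3] := theta_l2_D1 xl; apply/negP=> xy.
have yD : y \in v :: m2 ++ m3 by rewrite inE mem_cat ym !orbT.
case: (theta_D1_D2 th xD yD xy) => -[ex ey].
- by rewrite ex eqxx in xu.
- by have := theta_m3_m2 ym; rewrite ey theta_head_m2.
- by have := xl3; rewrite ex; case: l3 (th_l3 th) => //= a l _; rewrite mem_last.
Qed.

Lemma theta_headA_D2 y : y \in v :: m2 ++ m3 -> near (head u A) y -> y = head v m2.
Proof.
move=> yD; have := @theta_D1_lastA _ _ _ _ _ _ _ _ _ _ (theta_rev th) y.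
rewrite !last_rev; have -> : head v A = head u A.
  by case: A (theta_A_neq0 th).
by apply; move: yD; rewrite !inE !mem_cat !mem_rev.
Qed.

End Sides.

Section Side.

Variable G : sgraph.
Variables (u v : G) (zs l2 A m2 l3 B m3 : seq G).
Hypothesis th : theta u v zs l2 A m2 l3 B m3.

Lemma side_v x : x \in rcons l2 (head u A) -> ~~ near x v.
Proof.
rewrite mem_rcons inE => /predU1P[->|xl]; apply/negP.
  move/(theta_headA_D2 th (mem_head _ _)) => ev.
  by have := theta_terminals2 th; rewrite /= -ev mem_head.
have [xD xu _] := theta_l2_D1 th xl.
by move/(theta_D1_v th xD) => ex; rewrite ex eqxx in xu.
Qed.

Lemma side_Z x z : x \in rcons l2 (head u A) -> z \in zs -> ~~ near z x.
Proof.
rewrite mem_rcons inE => /predU1P[->|xl] zZ; first exact: (theta_headA_Z th zZ).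
have [xD xu _] := theta_l2_D1 th xl; apply/negP.
by move/(theta_D1_Z th xD zZ) => ex; rewrite ex eqxx in xu.
Qed.

(** Copies that run along one arc from [u] and along the other from [v] take the nonadjacency of
    their two ends from here. *)
Lemma side_side x y : x \in rcons l2 (head u A) -> y \in last u B :: m3 -> ~~ near x y.
Proof.
rewrite mem_rcons !inE => /predU1P[->|xl] /predU1P[->|ym].
- by rewrite near_sym; apply: theta_lastA_headB (theta_swap th).
- apply/negP=> xy.
  have yD : y \in v :: m2 ++ m3 by rewrite inE mem_cat ym !orbT.
  have ey := theta_headA_D2 th yD xy.
  by have := theta_m3_m2 th ym; rewrite ey (theta_head_m2 th).
- have [xD xu xl3] := theta_l2_D1 th xl; rewrite near_sym; apply/negP.
  have xD' : x \in u :: l3 ++ l2 by move: xD; rewrite !inE !mem_cat [(x \in l3) || _]orbC.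
  move/(theta_D1_lastA (theta_swap th) xD') => ex.
  by move: xl3; rewrite ex (theta_last_l2 (theta_swap th)).
- exact: (theta_D1_m3 th xl ym).
Qed.

Lemma theta_Z_light z : z \in zs -> ~~ heavy z.
Proof.
move=> zZ; apply/negP=> /(cfg_heavy (th_cfg th)) zC.
have := cfg_uniq (th_cfg th).
rewrite [X in uniq X](_ : _ = (u :: v :: (l2 ++ A ++ m2) ++ (l3 ++ B ++ m3)) ++ zs).
  by rewrite cat_uniq => /and3P[_ /hasPn/(_ _ zZ)]; rewrite /= zC.
by rewrite /= -!catA.
Qed.

Lemma theta_neq_uv : u != v.
Proof. by have := cfg_uniq (th_cfg th); rewrite /= inE negb_or => /andP[/andP[]]. Qed.

Lemma theta_ear s : path edge u (rcons s v) -> s != [::] -> {subset s <= zs} ->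
  size zs <= size s.
Proof.
move=> ps s0 sZ; apply: (cfg_ear (th_cfg th) _ _ theta_neq_uv s0 ps).
- exact: mem_head.
- by rewrite !inE eqxx orbT.
move=> z /sZ zZ; apply/negP=> zC.
have := cfg_uniq (th_cfg th).
rewrite [X in uniq X](_ : _ = (u :: v :: (l2 ++ A ++ m2) ++ (l3 ++ B ++ m3)) ++ zs).
  by rewrite cat_uniq => /and3P[_ /hasPn/(_ _ zZ)]; rewrite /= zC.
by rewrite /= -!catA.
Qed.

Lemma theta_heads : [/\ ~~ near v (head u (l2 ++ A ++ m2)),
  ~~ near u (last u (l2 ++ A ++ m2)) & edge u (head u l2)].
Proof.
have hl : head u l2 \in l2 by case: l2 (th_l2 th) => //= a l _; apply: mem_head.
have eh : head u (l2 ++ A ++ m2) = head u l2 by case: l2 (th_l2 th).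
have el : last u (l2 ++ A ++ m2) = last v m2.
  by rewrite !last_cat; case: m2 (th_m2 th).
split.
- by rewrite near_sym eh side_v // mem_rcons inE hl orbT.
- apply/negP; rewrite el near_sym => lu.
  have lm : last v m2 \in m2 by case: m2 (th_m2 th) => //= a l _; apply: mem_last.
  have lD : last v m2 \in v :: rev m2 ++ rev m3 by rewrite inE mem_cat mem_rev lm orbT.
  have := theta_D1_v (theta_rev th) lD lu => lv.
  have lm' : last v m2 \in rev m2 by rewrite mem_rev.
  by have [_] := theta_l2_D1 (theta_rev th) lm'; rewrite lv eqxx.
- have := cfgA (th_cfg th); case: l2 (th_l2 th) => //= a l _ /andP[] //.
Qed.

End Side.

Section NotBothHeavy.

Variable G : sgraph.
Hypothesis clawG : claw_near G.
Variables (u v : G) (zs l2 A m2 l3 B m3 : seq G).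
Hypothesis th : theta u v zs l2 A m2 l3 B m3.

(** An ear with at least two vertices is shortest only if [u] and [v] have no common neighbour off
    the cycle, and then the ear serves as [Z]. Otherwise all such common neighbours together serve
    as [Z]: each is an ear of its own, and the claw at [u] with the first vertex [a] of an arc makes
    them pairwise near. *)
Lemma theta_not_both_heavy : ~~ (heavy u && heavy v).
Proof.
apply/negP=> /andP[hu hv]; have cf := th_cfg th.
have [vA uA _] := theta_heads th; have [vB uB _] := theta_heads (theta_swap th).
set SA := l2 ++ A ++ m2 in cf vA uA; set SB := l3 ++ B ++ m3 in cf vB uB.
have U := cfg_uniq cf.
have zC z : z \in zs -> z \notin u :: v :: SA ++ SB.
  move: U; rewrite [X in uniq X](_ : _ = (u :: v :: SA ++ SB) ++ zs).
    by rewrite cat_uniq => /and3P[_ /hasPn H _] /H.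
  by rewrite /= -!catA.
pose K := [set z | [&& edge u z, edge v z & z \notin u :: v :: SA ++ SB]].
have earK z : z \in K -> size zs <= 1.
  rewrite inE => /and3P[uz vz nz].
  apply: (cfg_ear cf (x := u) (y := v) (s := [:: z])) => //.
  - exact: mem_head.
  - by rewrite !inE eqxx orbT.
  - exact: theta_neq_uv th.
  - by rewrite /= uz edge_sym vz.
  - by move=> x; rewrite inE => /eqP->.
have [le1|gt1] := leqP (size zs) 1; last first.
  have K0 : #|K| = 0.
    by apply/eqP; rewrite cards_eq0 -subset0; apply/subsetP=> z /earK; rewrite leqNgt gt1.
  apply: (both_heavy_count clawG cf hu hv vA vB uA uB (Z := zs)).
  - exact: theta_uniqZ th.
  - exact: zC.
  - exact: cfgZ0 cf.
  - exact: edge_path (cfgZ cf).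
  - by rewrite -/K K0.
have [z dz] : exists z, zs = [:: z].
  by case: zs le1 (cfgZ0 cf) => [|z [|z' l]] // _ _; exists z.
have zK : z \in K.
  rewrite inE zC ?dz ?mem_head // andbT.
  by have := cfgZ cf; rewrite dz /= andbT [edge z v]edge_sym.
have cfK y : y \in K -> config u v [:: y] SA SB.
  rewrite inE => /and3P[uy vy yC]; case: cf => U' pA pB pZ _ hC mx er; split=> //.
  - rewrite [X in uniq X](_ : _ = (u :: v :: SA ++ SB) ++ [:: y]).
      rewrite cat_uniq /= orbF yC !andbT.
      move: U; rewrite [X in uniq X](_ : _ = (u :: v :: SA ++ SB) ++ zs).
        by rewrite cat_uniq => /andP[].
      by rewrite /= -!catA.
    by rewrite /= -!catA.
  - by rewrite /= uy edge_sym vy.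
  - by move=> x' y' [|z' s'].
have uK y : y \in K -> near u y by rewrite inE => /and3P[uy _ _]; apply: edge_near.
have vK y : y \in K -> near y v.
  by rewrite inE near_sym => /and3P[_ vy _]; apply: edge_near.
have nK y : y \in K -> y \notin u :: v :: SA ++ SB by rewrite inE => /and3P[].
have [a [SA' dA]] : exists a SA', SA = a :: SA'.
  by rewrite /SA; case: l2 (th_l2 th) => //= a l _; exists a, (l ++ A ++ m2).
have aC : a \in u :: v :: SA ++ SB by rewrite dA !inE eqxx !orbT.
have ua : edge u a by have := cfgA cf; rewrite dA /= => /andP[].
have clK y y' : y \in K -> y' \in K -> y != y' -> near y y'.
  move=> yK y'K yy'.
  have ney w : w \in K -> w != a by move=> /nK; apply: contraNneq => ->.
  have nya w : w \in K -> ~~ near w a.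
    by move=> /cfK cfw; rewrite dA in cfw; apply: config_ear_arc cfw.
  have uy : edge u y by move: yK; rewrite inE => /and3P[].
  have uy' : edge u y' by move: y'K; rewrite inE => /and3P[].
  case: (clawG uy uy' ua yy' (ney y yK) (ney y' y'K)) => //.
    by move=> h; have := nya y yK; rewrite h.
  by move=> h; have := nya y' y'K; rewrite h.
apply: (both_heavy_count clawG cf hu hv vA vB uA uB (Z := enum K)).
- exact: enum_uniq.
- by move=> y; rewrite mem_enum; apply: nK.
- by apply: contraTneq zK => K0; rewrite -mem_enum K0.
- have := enum_uniq K; have KE y : y \in enum K -> y \in K by rewrite mem_enum.
  have : z \in enum K by rewrite mem_enum.
  case: (enum K) KE => // k t KE _ ut.
  rewrite rcons_path [path _ _ _]/= uK ?KE ?mem_head //=.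
  rewrite vK ?andbT; last by apply: KE; apply: mem_last.
  by apply: pairwise_near_path => // x y xt yt; apply: clK; apply: KE.
- by rewrite -cardE.
Qed.

End NotBothHeavy.

Section LongEar.

Variable G : sgraph.
Hypothesis clawG : claw_near G.

(** In the claw at [u] with leaves [z], [v] and the head [a] of an arc only [z] and [v] can be near.
    They are not adjacent, as the ear is shortest, and [z] is light, so [v] is heavy. *)
Lemma theta_long_ear_heavy (u v z : G) zs l2 A m2 l3 B m3 :
  theta u v (z :: zs) l2 A m2 l3 B m3 -> zs != [::] -> edge u v -> heavy v.
Proof.
move=> th z0 uv; have [+ _ ua] := theta_heads th.
have [a [l dl]] : exists a l, l2 = a :: l.
  by have := th_l2 th; case dl : l2 => [//|a l] _; exists a, l.
subst l2; rewrite /= in ua * => va.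
have uz : edge u z by have := cfgZ (th_cfg th) => /= /andP[].
have az : ~~ near z a by apply: (side_Z th); rewrite ?mem_head.
have zv : ~~ edge z v.
  apply/negP=> zv; have := theta_ear th (s := [:: z]).
  rewrite /= uz zv => /(_ isT isT); case: zs z0 {th} => // w zs _ /=.
  suff H : {subset [:: z] <= [:: z, w & zs]} by move=> /(_ H).
  by move=> x; rewrite inE => /eqP->; rewrite mem_head.
have zl : ~~ heavy z by apply: (theta_Z_light th); rewrite mem_head.
have zneq x : x \in [:: u, v & ((a :: l) ++ A ++ m2) ++ l3 ++ B ++ m3] -> z != x.
  move=> xC; have := cfg_uniq (th_cfg th).
  rewrite [X in uniq X](_ : _ = [:: u, v & ((a :: l) ++ A ++ m2) ++ l3 ++ B ++ m3] ++ z :: zs).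
    by rewrite cat_uniq => /and3P[_ /= /norP[+ _] _]; apply: contraNneq => ->.
  by rewrite /= -!catA.
have av : v != a.
  have := cfg_uniq (th_cfg th); rewrite /= !inE !negb_or.
  by case/and3P=> _ /andP[].
case: (clawG uz uv ua _ _ av); rewrite ?zneq ?inE ?eqxx ?orbT //.
- move=> zv'; apply: contraT => vl.
  by rewrite (near_light zv') in zv.
- by move=> h; rewrite h in az.
- by move=> h; rewrite h in va.
Qed.

(** Read from both sides, an edge from [u] to [v] would make both ends heavy. *)
Lemma theta_long_ear (u v : G) zs l2 A m2 l3 B m3 :
  theta u v zs l2 A m2 l3 B m3 -> 1 < size zs -> ~~ edge u v.
Proof.
move=> th lz; apply/negP=> uv; have := theta_not_both_heavy clawG th.
have -> : heavy v.
  case: zs lz th => [//|z [//|w zs]] _ th.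
  exact: theta_long_ear_heavy th isT uv.
have thr := theta_rev th; rewrite edge_sym in uv.
have -> // : heavy u.
have : 1 < size (rev zs) by rewrite size_rev.
case: (rev zs) thr => [//|z [//|w zs']] thr _.
exact: theta_long_ear_heavy thr isT uv.
Qed.

End LongEar.

(** * One of the two clusters is calm *)

Section Dichotomy.

Variable G : sgraph.

(* Around a calm cluster claw_near excludes honest induced claws. *)
Definition calm (D : seq G) : bool :=
  all (fun x => all (fun y => near x y ==> edge x y) D) D &&
  all (fun x => all (fun y => heavy x && heavy y ==> (x == y)) D) D.

Lemma calmP D : reflect
  ({in D &, forall x y, near x y -> edge x y} /\
   {in D &, forall x y, heavy x -> heavy y -> x = y}) (calm D).
Proof.
apply: (iffP andP) => -[nD hD]; split.
- by move=> x y xD yD; have /allP/(_ y yD)/implyP := allP nD x xD.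
- move=> x y xD yD hx hy; have /allP/(_ y yD)/implyP := allP hD x xD.
  by rewrite hx hy => /(_ isT)/eqP.
- by apply/allP=> x xD; apply/allP=> y yD; apply/implyP; apply: nD.
- by apply/allP=> x xD; apply/allP=> y yD; apply/implyP=> /andP[hx hy]; apply/eqP/hD.
Qed.

Lemma light_calm D : ~~ has (@heavy G) D -> calm D.
Proof.
move/hasPn=> lD; apply/calmP; split=> x y xD yD.
  by move=> xy; apply: near_light xy (lD x xD) (lD y yD).
by move=> hx; have := lD x xD; rewrite hx.
Qed.

Lemma calm_perm D D' : perm_eq D D' -> calm D -> calm D'.
Proof.
move=> DD' /calmP[nD hD]; apply/calmP.
by split=> x y; rewrite -!(perm_mem DD'); [apply: nD | apply: hD].
Qed.

(** Near pairs between the clusters form a matching. If both clusters contain heavy vertices, these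
    are near across, so each cluster has exactly one, [h1] and [h2]. A cluster that is not calm then
    has a near nonedge, one end of which must be its heavy vertex. *)
Lemma theta_dichotomy (u v : G) zs l2 A m2 l3 B m3 :
  theta u v zs l2 A m2 l3 B m3 -> calm (u :: l2 ++ l3) || calm (v :: m2 ++ m3).
Proof.
move=> th; set D1 := u :: _; set D2 := v :: _.
have [h1D|/light_calm-> //] := boolP (has (@heavy G) D1).
have [h2D|/light_calm->] := boolP (has (@heavy G) D2); last by rewrite orbT.
have [h1 h1D1 hv1] := hasP h1D; have [h2 h2D2 hv2] := hasP h2D.
have neq12 x y : x \in D1 -> y \in D2 -> x != y.
  move=> xD; apply: contraTneq => <-; have := theta_uniq th.
  rewrite -/D1 -/D2 cat_uniq => /and3P[_ /hasPn nD _].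
  by apply/negP=> xD2; have := nD x; rewrite mem_cat xD2 /= xD => /(_ isT).
have cross x y : x \in D1 -> y \in D2 -> near x y ->
  [\/ x = u /\ y = v, x = last u l2 /\ y = head v m2 | x = last u l3 /\ y = head v m3].
  by move=> xD yD; apply: (theta_D1_D2 th).
have ta := theta_terminals1 th; have tb := theta_terminals2 th.
have inj1 x x' y : x \in D1 -> x' \in D1 -> y \in D2 -> near x y -> near x' y -> x = x'.
  move=> xD x'D yD xy x'y; move: tb; rewrite /= !inE negb_or andbT.
  move=> /andP[/andP[/eqP b12 /eqP b13] /eqP b23].
  case: (cross x y xD yD xy) => -[-> ey]; case: (cross x' y x'D yD x'y) => -[-> ey'] //;
    congruence.
have inj2 x y y' : x \in D1 -> y \in D2 -> y' \in D2 -> near x y -> near x y' -> y = y'.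
  move=> xD yD y'D xy xy'; move: ta; rewrite /= !inE negb_or andbT.
  move=> /andP[/andP[/eqP a12 /eqP a13] /eqP a23].
  case: (cross x y xD yD xy) => -[ex ->]; case: (cross x y' xD y'D xy') => -[ex' ->] //;
    congruence.
have hnear x y : x \in D1 -> y \in D2 -> heavy x -> heavy y -> near x y.
  by move=> xD yD hx hy; apply: heavy_near (neq12 x y xD yD).
have u1 x : x \in D1 -> heavy x -> x = h1.
  by move=> xD hx; apply: (inj1 _ _ h2) => //; apply: hnear.
have u2 y : y \in D2 -> heavy y -> y = h2.
  by move=> yD hy; apply: (inj2 h1) => //; apply: hnear.
have pick D h : {in D, forall x, heavy x -> x = h} -> ~~ calm D ->
    exists2 y, y \in D & (near h y && ~~ edge h y) && (h \in D).
  move=> uh nc; have : ~~ all (fun x => all (fun y => near x y ==> edge x y) D) D.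
    apply: contra nc => nD; rewrite /calm nD /=; apply/allP=> x xD; apply/allP=> y yD.
    by apply/implyP=> /andP[/(uh x xD)-> /(uh y yD)->].
  case/allPn=> x xD /allPn[y yD]; rewrite negb_imply => /andP[xy nxy].
  have [hx|lx] := boolP (heavy x).
    by exists y => //; rewrite -(uh x xD hx) xy nxy.
  have [hy|ly] := boolP (heavy y).
    by exists x => //; rewrite -(uh y yD hy) near_sym xy edge_sym nxy.
  by rewrite (near_light xy) in nxy.
apply: contraT; rewrite negb_or => /andP[nc1 nc2].
have [y1 y1D /andP[/andP[n1 e1] _]] := pick D1 h1 u1 nc1.
have [y2 y2D /andP[/andP[n2 e2] _]] := pick D2 h2 u2 nc2.
have h12 := hnear h1 h2 h1D1 h2D2 hv1 hv2.
have s1 : #|G| <= deg h1 + deg y1 by case/andP: n1; rewrite (negbTE e1).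
have s2 : #|G| <= deg h2 + deg y2 by case/andP: n2; rewrite (negbTE e2).
(* The four degrees add up to at least [2 * #|G|], so one of the pairs [h1], [y2] and [y1], [h2] is
   near as well. This gives [h1] or [h2] two partners in the matching. *)
have : (#|G| <= deg h1 + deg y2) || (#|G| <= deg y1 + deg h2).
  move: s1 s2; move: (deg h1) (deg h2) (deg y1) (deg y2) #|G|.
  by clear; move=> a b c d n; lia.
case/orP=> le_n.
  have h1y2 : near h1 y2 by rewrite /near neq12 // le_n orbT.
  by have := inj2 h1 h2 y2 h1D1 h2D2 y2D h12 h1y2 => e; rewrite /near -e eqxx in n2.
have y1h2 : near y1 h2 by rewrite /near neq12 // le_n orbT.
by have := inj1 h1 y1 h2 h1D1 y1D h2D2 h12 y1h2 => e; rewrite /near -e eqxx in n1.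
Qed.

End Dichotomy.

Section CalmSide.

Variable G : sgraph.
Variables (u v : G) (zs l2 A m2 l3 B m3 : seq G).
Hypothesis th : theta u v zs l2 A m2 l3 B m3.
Let D := u :: l2 ++ l3.

Lemma theta_connD x y : x \in D -> y \in D ->
  exists s, [/\ path edge x s, last x s = y & {subset s <= D}].
Proof.
have H w : w \in D -> exists s, walk edge u w s /\ {subset s <= D}.
  rewrite inE => /predU1P[->|].
    by exists [:: u]; split; rewrite ?walk1 // => x'; rewrite inE => /eqP->; rewrite mem_head.
  have arc l S : path edge u (l ++ S) -> {subset l <= D} -> w \in l ->
      exists s, walk edge u w s /\ {subset s <= D}.
    move=> pl lD wl; have [p1 [p2 dl]] : exists p1 p2, l = rcons p1 w ++ p2.
      by case/path.splitP: wl => p1 p2; exists p1, p2.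
    exists (u :: rcons p1 w); split; last first.
      move=> x'; rewrite inE => /predU1P[->|xp]; first exact: mem_head.
      by apply: lD; rewrite dl mem_cat xp.
    apply/walkP; exists (rcons p1 w); rewrite last_rcons; split=> //.
    by move: pl; rewrite dl -catA cat_path => /andP[].
  rewrite mem_cat => /orP[]; apply: arc.
  - by have := cfgA (th_cfg th); rewrite -cats1 -catA; apply.
  - by move=> x' xl; rewrite inE mem_cat xl orbT.
  - by have := cfgB (th_cfg th); rewrite -cats1 -catA; apply.
  - by move=> x' xl; rewrite inE mem_cat xl !orbT.
move=> /H[s1 [w1 sD1]] /H[s2 [w2 sD2]].
have w1' := walk_rev (@edge_sym G) w1.
case/walkP: w2 => t2 [e2 p2 <-].
have : walk edge x (last u t2) (rev s1 ++ t2) by apply: walk_path.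
case/walkP=> t [et pt lt]; exists t; split=> // a at_.
have : a \in rev s1 ++ t2 by rewrite et inE at_ orbT.
rewrite mem_cat mem_rev => /orP[/sD1//|at2]; apply: sD2.
by rewrite e2 inE at2 orbT.
Qed.

End CalmSide.

Ltac copy_solve :=
  rewrite /copy /=;
  repeat (apply/andP; split); try done;
  match goal with |- is_true (?e == adj ?E ?i ?j) =>
    let b := eval vm_compute in (adj E i j) in change (is_true (e == b))
  end;
  rewrite ?eqb_id ?eqbF_neg;
  first [ assumption | rewrite edge_sym; assumption
        | apply: not_near_edge; assumption
        | apply: not_near_edge; rewrite near_sym; assumption ].

Section Legs.

Variable G : sgraph.
Hypothesis clawG : claw_near G.
Variables (u v z : G) (zs l2 A m2 l3 B m3 : seq G).
Hypothesis thm : theta_min u v (z :: zs) l2 A m2 l3 B m3.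
Let th := thm.1.
Let D := u :: l2 ++ l3.
Hypothesis calmD : calm D.

Let p2 := head u A.
Let p3 := head u B.

(** Between triangle and legs nonadjacency is strengthened to not being near, so that such pairs are
    never both heavy. The prolonging vertex [s] keeps plain nonadjacency. *)
Definition legs (t1 t2 t3 s1 s2 s3 : G) : Prop :=
  [/\ [/\ t1 \in D, t2 \in D, t3 \in D & edge t1 t2 && edge t1 t3 && edge t2 t3],
      [/\ s1 \in z :: D, s2 \in p2 :: D & s3 \in p3 :: D],
      [/\ edge s1 t1, edge s2 t2 & edge s3 t3],
      [/\ ~~ near s1 t2, ~~ near s1 t3, ~~ near s2 t1, ~~ near s2 t3 &
         [/\ ~~ near s3 t1, ~~ near s3 t2, ~~ near s1 s2, ~~ near s1 s3 &
             ~~ near s2 s3]] &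
      s1 = z \/ exists s : G, [/\ s \in z :: D, edge s1 s, ~~ edge s t1, ~~ edge s t2 &
                    [/\ ~~ edge s t3, ~~ edge s s2 & ~~ edge s s3]]].

(** Each of [z], [p2], [p3] has a single near vertex in the cluster, which is a neighbour, and
    calmness turns near pairs inside the cluster into edges. On these vertices [near] and [edge]
    agree, so [claw_near] excludes claws. *)
Lemma theta_legs : exists t1 t2 t3 s1 s2 s3, legs t1 t2 t3 s1 s2 s3.
Proof.
have [nD hD] := calmP _ calmD.
have ths := theta_swap th.
have uz : edge u z by have := cfgZ (th_cfg th) => /= /andP[].
have zZ : z \in z :: zs := mem_head _ _.
have edge_head l' A' m' SA : path edge u (rcons SA v) -> SA = l' ++ A' ++ m' ->
    A' != [::] -> edge (last u l') (head u A').
  move=> pA dA; case: A' dA => // a A' dA _; move: pA.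
  by rewrite dA rcons_cat cat_path => /andP[_] /= /andP[].
have e2 : edge p2 (last u l2).
  by rewrite edge_sym (edge_head _ _ _ _ (cfgA (th_cfg th)) (erefl _)) ?(theta_A_neq0 th).
have e3 : edge p3 (last u l3).
  by rewrite edge_sym (edge_head _ _ _ _ (cfgB (th_cfg th)) (erefl _)) ?(theta_A_neq0 ths).
have n12 : ~~ near z p2 := theta_headA_Z th zZ.
have n13 : ~~ near z p3 := theta_headA_Z ths zZ.
have n23 : ~~ near p2 p3 := theta_min_headAB thm.
have l2D : last u l2 \in D by rewrite inE mem_cat (theta_last_l2 th) orbT.
have l3D : last u l3 \in D by rewrite inE mem_cat (theta_last_l2 ths) !orbT.
have uD : u \in D := mem_head _ _.
have swapD x : (x \in D) = (x \in u :: l3 ++ l2).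
  by rewrite !inE !mem_cat [(x \in l3) || _]orbC.
have u1 x : x \in D -> near z x -> x = u by move=> xD; apply: (theta_D1_Z th xD zZ).
have u2 x : x \in D -> near p2 x -> x = last u l2.
  by move=> xD; apply: (theta_min_headA thm xD).
have u3 x : x \in D -> near p3 x -> x = last u l3.
  by rewrite swapD => xD; apply: (theta_min_headA (theta_min_swap thm) xD).
have nearE p q : edge p q -> (forall x, x \in D -> near p x -> x = q) ->
    {in D, forall x, edge p x = (x == q)}.
  move=> pq up x xD; apply/idP/eqP => [/edge_near|->//]; exact: up.
have uqall := theta_uniq th.
have hA : p2 \in A by rewrite /p2; case: A (theta_A_neq0 th) => // a l _; apply: mem_head.
have hB : p3 \in B.
  by rewrite /p3; case: B (theta_A_neq0 ths) => // a l _; apply: mem_head.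
have np3 : p3 \notin D.
  by apply: (uniq_cat_notin uqall); rewrite !mem_cat hB !orbT.
have [d12 d13 d23] : [/\ z != p2, z != p3 & p2 != p3].
  have U : uniq ((z :: zs) ++ A ++ B) by move: uqall; rewrite !cat_uniq => /and5P[_ _ _ _].
  have := U; rewrite cat_uniq => /and3P[_ /hasPn nz]; rewrite cat_uniq => /and3P[_ /hasPn nB _].
  split.
  - by apply/eqP=> e; have := nz p2; rewrite mem_cat hA -e /= mem_head => /(_ isT).
  - by apply/eqP=> e; have := nz p3; rewrite mem_cat hB orbT -e /= mem_head => /(_ isT).
  - by apply/eqP=> e; have := nB p3 hB; rewrite -e /= hA.
have [u1E u2E u3E] : [/\ {in D, forall x, edge z x = (x == u)},
    {in D, forall x, edge p2 x = (x == last u l2)} &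
    {in D, forall x, edge p3 x = (x == last u l3)}].
  by split; apply: nearE => //; rewrite edge_sym.
pose H := [:: z, p2, p3 & D].
have nearD p q x : edge p q -> (forall x, x \in D -> near p x -> x = q) ->
    x \in D -> near p x -> edge p x.
  by move=> pq up xD /(up x xD)->.
have zu : edge z u by rewrite edge_sym.
have nearH x y : x \in H -> y \in H -> near x y -> edge x y.
  have irr a : near a a = false by rewrite /near eqxx.
  rewrite !in_cons => /or4P[/eqP->|/eqP->|/eqP->|xD] /or4P[/eqP->|/eqP->|/eqP->|yD].
  - by rewrite irr.
  - by rewrite (negbTE n12).
  - by rewrite (negbTE n13).
  - exact: (nearD z u).
  - by rewrite near_sym (negbTE n12).
  - by rewrite irr.
  - by rewrite (negbTE n23).
  - exact: (nearD p2 (last u l2)).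
  - by rewrite near_sym (negbTE n13).
  - by rewrite near_sym (negbTE n23).
  - by rewrite irr.
  - exact: (nearD p3 (last u l3)).
  - by rewrite near_sym edge_sym; apply: (nearD z u).
  - by rewrite near_sym edge_sym; apply: (nearD p2 (last u l2)).
  - by rewrite near_sym edge_sym; apply: (nearD p3 (last u l3)).
  - exact: nD.
have cfH c x y w : c \in H -> x \in H -> y \in H -> w \in H ->
  edge c x -> edge c y -> edge c w -> x != y -> x != w -> y != w ->
  [|| edge x y, edge x w | edge y w].
  move=> _ xH yH wH cx cy cw xy xw yw.
  by case: (clawG cx cy cw xy xw yw) => /nearH->; rewrite ?orbT.
have [t1 [t2 [t3 [s1 [s2 [s3 [tD sD es ns ex]]]]]]] :=
  triangle_with_legs (theta_connD th) uD l2D l3D u1E u2E u3E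
    (not_near_edge n12) (not_near_edge n13) (not_near_edge n23)
    np3 d12 d13 d23 cfH.
exists t1, t2, t3, s1, s2, s3; split=> //.
have [t1D t2D t3D _] := tD; have [s1D s2D s3D] := sD.
have DH x : x \in D -> x \in H by rewrite !inE => ->; rewrite !orbT.
have s1H : s1 \in H by move: s1D; rewrite in_cons => /predU1P[->|/DH//]; rewrite mem_head.
have s2H : s2 \in H.
  by move: s2D; rewrite in_cons => /predU1P[->|/DH//]; rewrite !inE eqxx orbT.
have s3H : s3 \in H.
  by move: s3D; rewrite in_cons => /predU1P[->|/DH//]; rewrite !inE eqxx !orbT.
have nnear x y : x \in H -> y \in H -> ~~ edge x y -> ~~ near x y.
  by move=> xH yH; apply/contra/nearH.
case: ns => n1 n2 n4 n5 [n6 n7 n8 n9 n10].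
by split; last split; apply: nnear => //; apply: DH.
Qed.

(** A leg reduced to [z] starts at [u] and is prolonged by the next ear vertex, or by [v] if there
    is none; in the latter case [v] must not be adjacent to [u]. The clause on a heavy [s1] is
    needed for [Z_2]. *)
Lemma theta_long_leg : (zs == [::]) ==> ~~ edge u v ->
  exists t1 t2 t3 s1 s2 s3 s, legs t1 t2 t3 s1 s2 s3 /\
    [/\ edge s1 s, ~~ edge s t1, ~~ edge s t2, ~~ edge s t3 &
        ~~ edge s s2 /\ (heavy s1 -> ~~ heavy s)].
Proof.
move=> r1; have [t1 [t2 [t3 [s1 [s2 [s3 lg]]]]]] := theta_legs.
have zl : ~~ heavy z by apply: (theta_Z_light th); rewrite mem_head.
have [nD hD] := calmP _ calmD.
exists t1, t2, t3, s1, s2, s3.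
case: (lg) => [[t1D t2D t3D /andP[/andP[e12 e13] e23]]] [s1D s2D s3D] [es1 es2 es3].
move=> [n1 n2 n4 n5 [n6 n7 n8 n9 n10]] [es|[s [sD ss1 st1 st2 [st3 ss2 ss3]]]].
- subst s1; have et1 : t1 = u.
    by apply: (theta_D1_Z th t1D (mem_head _ _)); apply: edge_near.
  subst t1; have t2u : t2 != u by rewrite eq_sym edge_neq.
  have t3u : t3 != u by rewrite eq_sym edge_neq.
  have s2u : s2 != u.
    by apply: contraNneq n5 => ->; apply: edge_near.
  have s2side : s2 \in p2 :: D := s2D.
  have near_side w : w \in zs -> [/\ ~~ near w t2, ~~ near w t3 & ~~ near w s2].
    move=> wZ; have wZ' : w \in z :: zs by rewrite inE wZ orbT.
    have H x : x \in D -> x != u -> ~~ near w x.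
      by move=> xD xu; apply: contra xu => /(theta_D1_Z th xD wZ')/eqP.
    split; try exact: H.
    move: s2D; rewrite in_cons => /predU1P[->|xD]; last exact: H.
    by apply: (theta_headA_Z th wZ').
  case dz : zs r1 => [|w zs'] r1.
    have zv : edge z v.
      by have := cfgZ (th_cfg th); rewrite dz /= andbT => /andP[].
    have H x : x \in D -> x != u -> ~~ edge v x.
      move=> xD xu; apply: contra xu; rewrite edge_sym => /edge_near xv.
      by rewrite (theta_D1_v th xD xv).
    exists v; split=> //; split=> //; try exact: H.
    + by rewrite edge_sym.
    + split; last by rewrite (negbTE zl).
      move: s2D; rewrite in_cons => /predU1P[->|xD]; last exact: H.
      rewrite edge_sym; apply: not_near_edge; apply: (side_v th).
      by rewrite mem_rcons mem_head.
  have wZ : w \in zs by rewrite dz mem_head.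
  have [w2 w3 w4] := near_side w wZ.
  exists w; split=> //; split; try exact: not_near_edge.
  + by have := cfgZ (th_cfg th); rewrite dz /= => /and3P[].
  + rewrite edge_sym; apply/negP=> uw.
    suff : size (z :: zs) <= size zs by rewrite /= ltnn.
    apply: (theta_ear th); rewrite ?dz //.
      by have := cfgZ (th_cfg th); rewrite dz /= uw => /and3P[].
    by move=> x xz; rewrite inE xz orbT.
  + by split; [exact: not_near_edge | rewrite (negbTE zl)].
exists s; split=> //; split=> //; split=> // hs1.
move: sD; rewrite in_cons => /predU1P[->//|sD].
move: s1D; rewrite in_cons => /predU1P[e|s1D]; first by rewrite -e hs1 in zl.
by apply/negP=> /(hD s1 s s1D sD hs1) e; rewrite e edge_irrefl in ss1.
Qed.


Lemma calm_heavy x y : x \in D -> y \in D -> edge x y -> ~~ (heavy x && heavy y).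
Proof.
have [_ hD] := calmP _ calmD => xD yD xy; apply/negP=> /andP[hx hy].
by move: xy; rewrite (hD x y xD yD hx hy) edge_irrefl.
Qed.

(** At most one [t] and at most one [s] are heavy. Among the remaining light vertices some [t] and
    [s] have different indices and form a light pair at distance two. *)
Lemma legs_net t1 t2 t3 s1 s2 s3 : legs t1 t2 t3 s1 s2 s3 -> ~ fan_heavy G 6 net_edges.
Proof.
move=> [[t1D t2D t3D /andP[/andP[e12 e13] e23]]] [s1D s2D s3D] [es1 es2 es3].
move=> [n1 n2 n4 n5 [n6 n7 n8 n9 n10]] _ fan.
have cp : copy 6 net_edges [:: t1; t2; t3; s1; s2; s3] by copy_solve.
have := copy_uniq cp isT isT; rewrite /= !inE !negb_or => us; split_ands.
have c12 := calm_heavy t1D t2D e12; have c13 := calm_heavy t1D t3D e13.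
have c23 := calm_heavy t2D t3D e23.
have [x1 x2 x3] : [/\ ~~ (heavy s1 && heavy s2), ~~ (heavy s1 && heavy s3) &
    ~~ (heavy s2 && heavy s3)] by split; apply: not_near_heavy.
have := fan _ u cp; move: c12 c13 c23 x1 x2 x3 => /=.
by do 6![case: (heavy _) => //=].
Qed.

Lemma long_leg_wounded t1 t2 t3 s1 s2 s3 s : legs t1 t2 t3 s1 s2 s3 ->
  [/\ edge s1 s, ~~ edge s t1, ~~ edge s t2, ~~ edge s t3 &
        ~~ edge s s2 /\ (heavy s1 -> ~~ heavy s)] ->
  ~ fan_heavy G 6 wounded_edges.
Proof.
move=> [[t1D t2D t3D /andP[/andP[e12 e13] e23]]] [s1D s2D s3D] [es1 es2 es3].
move=> [n1 n2 n4 n5 [n6 n7 n8 n9 n10]] _ [k1 k2 k3 k4 [k5 k6]] fan.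
have cp : copy 6 wounded_edges [:: t1; t2; t3; s1; s2; s] by copy_solve.
have := copy_uniq cp isT isT; rewrite /= !inE !negb_or => us; split_ands.
have c23 := calm_heavy t2D t3D e23.
have [x1 x2 x3] : [/\ ~~ (heavy s1 && heavy s2), ~~ (heavy t2 && heavy s1) &
    ~~ (heavy t3 && heavy s1)].
  by split; apply: not_near_heavy => //; rewrite near_sym.
have := fan _ u cp; move: c23 x1 x2 x3 => /=.
by do 6![case: (heavy _) => //=].
Qed.

(** Again [s1] must be heavy, and then [t1], [s] is a light pair. *)
Lemma long_leg_Z2 t1 t2 t3 s1 s2 s3 s : legs t1 t2 t3 s1 s2 s3 ->
  [/\ edge s1 s, ~~ edge s t1, ~~ edge s t2, ~~ edge s t3 &
        ~~ edge s s2 /\ (heavy s1 -> ~~ heavy s)] ->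
  ~ fan_heavy G 5 (Z_edges 2).
Proof.
move=> [[t1D t2D t3D /andP[/andP[e12 e13] e23]]] [s1D s2D s3D] [es1 es2 es3].
move=> [n1 n2 n4 n5 _] _ [k1 k2 k3 k4 [k5 k6]] fan.
have cp : copy 5 (Z_edges 2) [:: t2; t3; t1; s1; s] by copy_solve.
have c23 := calm_heavy t2D t3D e23.
have c1 : ~~ (heavy s1 && heavy t1).
  move: s1D; rewrite in_cons => /predU1P[->|s1D]; last exact: calm_heavy.
  by rewrite negb_and (theta_Z_light th) // mem_head.
have := fan _ u cp; move: c23 c1 k6 => /=.
by do 5![case: (heavy _) => //=] => _ _ /(_ isT).
Qed.

End Legs.

Lemma heavy_excl (G : sgraph) (x y : G) : ~~ near x y -> heavy x -> heavy y -> x = y.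
Proof. by move=> nxy hx hy; apply: contraNeq nxy; apply: heavy_near. Qed.

(** * Copies of [N], [W], [Z_2] and [P_6] with a light pair *)

Section ForbiddenCopies.

Variable G : sgraph.
Hypothesis clawG : claw_near G.

Lemma theta_run (u v : G) zs l2 A m2 l3 B m3 :
  theta_min u v zs l2 A m2 l3 B m3 ->
  exists b b', [/\ b \in l2, b' \in rcons l2 (head u A), edge u b, edge b b' &
                   ~~ edge u b'].
Proof.
move=> thm; have th := thm.1; apply: edge_run (th_l2 th) _.
  have := cfgA (th_cfg th); have := theta_A_neq0 th.
  case: (A) => // a A' _; rewrite rcons_cat /= -cat_rcons cat_path.
  by case/andP.
rewrite edge_sym; apply/negP=> /edge_near/(theta_min_headA thm (mem_head _ _)) ul.
by have := theta_terminals1 th; rewrite /= inE -ul eqxx.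
Qed.

(* The paths u, b, b' and v, c, c' run along different arcs of the cycle. *)
Lemma theta_runs (u v : G) zs l2 A m2 l3 B m3 :
  theta_min u v zs l2 A m2 l3 B m3 ->
  exists b b' c c',
  [/\ [/\ edge u b, edge b b', ~~ edge u b', edge v c & edge c c'],
      [/\ ~~ edge v c', ~~ near b v, ~~ near b' v, ~~ near c u & ~~ near c' u],
      [/\ ~~ near b c, ~~ near b c', ~~ near b' c & ~~ near b' c'] &
      {in zs, forall z, [/\ ~~ near z b, ~~ near z b', ~~ near z c & ~~ near z c']}].
Proof.
move=> thm; have th := thm.1.
have [b [b' [bl b'l ub bb' ub']]] := theta_run thm.
have thr := theta_min_swap (theta_min_rev thm).
have [c [c' [cl c'l vc cc' vc']]] := theta_run thr.
have bl' : b \in rcons l2 (head u A) by rewrite mem_rcons inE bl orbT.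
have cl' : c \in rcons (rev m3) (head v (rev B)) by rewrite mem_rcons inE cl orbT.
have toB x : x \in rcons (rev m3) (head v (rev B)) -> x \in last u B :: m3.
  rewrite mem_rcons !inE mem_rev head_rev => /predU1P[->|->]; last by rewrite orbT.
  by have := theta_A_neq0 (theta_swap th); case: (B) => //= *; rewrite eqxx.
exists b, b', c, c'; split=> //.
- by split=> //; first [exact: (side_v th) | exact: (side_v thr.1)].
- by split; apply: (side_side th); rewrite ?toB.
move=> z zZ; have zZ' : z \in rev zs by rewrite mem_rev.
by split; first [exact: (side_Z th) | exact: (side_Z thr.1)].
Qed.

Lemma theta_ear_cons (u v : G) zs l2 A m2 l3 B m3 :
  theta u v zs l2 A m2 l3 B m3 -> exists z zs', zs = z :: zs'.
Proof. by move=> /th_cfg/cfgZ0; case: zs => // z zs' _; exists z, zs'. Qed.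

Lemma theta_not_net (u v : G) zs l2 A m2 l3 B m3 :
  theta_min u v zs l2 A m2 l3 B m3 -> ~ fan_heavy G 6 net_edges.
Proof.
have H (u' v' : G) zs' k2 A' n2 k3 B' n3 : theta_min u' v' zs' k2 A' n2 k3 B' n3 ->
    calm (u' :: k2 ++ k3) -> ~ fan_heavy G 6 net_edges.
  move=> thm cD; have [z [zs1 dz]] := theta_ear_cons thm.1; subst zs'.
  have [t1 [t2 [t3 [s1 [s2 [s3 lg]]]]]] := theta_legs clawG thm cD.
  exact: (legs_net cD lg).
move=> thm; case/orP: (theta_dichotomy thm.1) => [/(H _ _ _ _ _ _ _ _ _ thm)//|c2].
apply: (H _ _ _ _ _ _ _ _ _ (theta_min_rev thm)).
by apply: calm_perm c2; perm_count.
Qed.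

Lemma theta_legs_wounded_Z2 (u v : G) zs l2 A m2 l3 B m3 :
  theta_min u v zs l2 A m2 l3 B m3 -> ~~ ((size zs == 1) && edge u v) ->
  ~ fan_heavy G 6 wounded_edges /\ ~ fan_heavy G 5 (Z_edges 2).
Proof.
have H (u' v' : G) zs' k2 A' n2 k3 B' n3 : theta_min u' v' zs' k2 A' n2 k3 B' n3 ->
    calm (u' :: k2 ++ k3) -> ~~ ((size zs' == 1) && edge u' v') ->
    ~ fan_heavy G 6 wounded_edges /\ ~ fan_heavy G 5 (Z_edges 2).
  move=> thm cD; have [z [zs1 dz]] := theta_ear_cons thm.1; subst zs'.
  rewrite eqSS size_eq0 negb_and -implybE => r1.
  have [t1 [t2 [t3 [s1 [s2 [s3 [s [lg lg']]]]]]]] := theta_long_leg clawG thm cD r1.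
  by split; [exact: (long_leg_wounded cD lg lg') | exact: (long_leg_Z2 thm cD lg lg')].
move=> thm r1; case/orP: (theta_dichotomy thm.1) => [cD|c2].
  exact: H thm cD r1.
apply: (H _ _ _ _ _ _ _ _ _ (theta_min_rev thm)).
  by apply: calm_perm c2; perm_count.
by rewrite size_rev edge_sym.
Qed.

(** Here [u], [v], [z] is a triangle with a light vertex [z], whose pairs with [b] and [c] would
    make both of these heavy; this excludes [W] and [Z_2]. The copy of [P_6] passes through the edge
    from [u] to [v]: a heavy [u] leaves [v], [c'] light, a light [u] requires [b'] and [c] to be
    heavy. *)
Lemma theta_short_ear (u v : G) zs l2 A m2 l3 B m3 :
  theta_min u v zs l2 A m2 l3 B m3 -> size zs == 1 -> edge u v ->
  [/\ ~ fan_heavy G 6 wounded_edges, ~ fan_heavy G 5 (Z_edges 2) &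
      ~ fan_heavy G 6 (path_edges 6)].
Proof.
move=> thm s1 uv; have th := thm.1.
have [b [b' [c [c' [[ub bb' ub' vc cc'] [vc' bv b'v cu c'u]]]]]] := theta_runs thm.
move=> [bc bc' b'c b'c'] zb.
have [z dz] : exists z, zs = [:: z] by case: (zs) s1 => [|z [|]] //; exists z.
have zZ : z \in zs by rewrite dz mem_head.
have [nzb nzb' nzc nzc'] := zb z zZ.
have lz := negbTE (theta_Z_light th zZ).
have /= := cfgZ (th_cfg th); rewrite dz /= andbT => /andP[uz zv].
have nuv := theta_not_both_heavy clawG th.
split=> fan.
- have cp : copy 6 wounded_edges [:: u; v; z; b; c; b'] by copy_solve.
  have := copy_uniq cp isT isT; rewrite /= !inE !negb_or => us; split_ands.
  have x1 : ~~ (heavy b && heavy c) by apply: not_near_heavy.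
  have := fan _ u cp; move: x1 => /=; rewrite lz.
  by do 5![case: (heavy _) => //=].
- have cp : copy 5 (Z_edges 2) [:: z; v; u; b; b'] by copy_solve.
  have cp' : copy 5 (Z_edges 2) [:: z; u; v; c; c'] by copy_solve.
  have := fan _ u cp; have := fan _ u cp'; rewrite /= lz /=.
  case: (boolP (heavy c)) => //= hc _; case: (boolP (heavy b)) => //= hb _.
  have ebc : b = c by apply: heavy_excl bc _ _.
  by move: bv; rewrite ebc near_sym edge_near.
- have cp : copy 6 (path_edges 6) [:: b'; b; u; v; c; c'] by copy_solve.
  have := copy_uniq cp isT isT; rewrite /= !inE !negb_or => us; split_ands.
  have x1 : ~~ (heavy b' && heavy c) by apply: not_near_heavy.
  have x2 : ~~ (heavy b && heavy v) by apply: not_near_heavy.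
  have x3 : ~~ (heavy u && heavy c).
    by apply: not_near_heavy => //; rewrite near_sym.
  have x4 : ~~ (heavy u && heavy c').
    by apply: not_near_heavy => //; rewrite near_sym.
  have x5 : ~~ (heavy b && heavy c') by apply: not_near_heavy.
  have := fan _ u cp; move: nuv x1 x2 x3 x4 x5 => /=.
  by do 6![case: (heavy _) => //=].
Qed.

(** Once [u] and [v] are nonadjacent, the path [b'], [b], [u] continues into the ear. A single ear
    vertex forces [b] and [c] to be heavy, two force [b] and [v], and with three or more [z1], [z3]
    is itself a light pair. *)
Lemma theta_not_path (u v : G) zs l2 A m2 l3 B m3 :
  theta_min u v zs l2 A m2 l3 B m3 -> ~ fan_heavy G 6 (path_edges 6).
Proof.
move=> thm; have th := thm.1.
have [/andP[s1 uv]|suv] := boolP ((size zs == 1) && edge u v).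
  by case: (theta_short_ear thm s1 uv).
have [b [b' [c [c' [[ub bb' ub' vc cc'] [vc' bv b'v cu c'u]]]]]] := theta_runs thm.
move=> [bc bc' b'c b'c'] zb fan.
have lightZ := theta_Z_light th.
have nuv : ~~ edge u v.
  have [l1|] := leqP (size zs) 1; last exact: (theta_long_ear clawG th).
  move: suv; rewrite eqn_leq l1 lt0n size_eq0 (cfgZ0 (th_cfg th)) //.
have eZ := cfgZ (th_cfg th).
have ear := theta_ear th.
case: zs thm th suv zb lightZ eZ ear => [//|z1 [|z2 [|z3 zs]]] thm th _ zb lZ eZ ear.
- by have := cfgZ0 (th_cfg th).
- have [zb1 zb'1 zc1 _] := zb z1 (mem_head _ _).
  have lz1 := negbTE (lZ z1 (mem_head _ _)).
  have /= := eZ; rewrite andbT => /andP[uz zv].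
  have cp : copy 6 (path_edges 6) [:: b'; b; u; z1; v; c] by copy_solve.
  have := copy_uniq cp isT isT; rewrite /= !inE !negb_or => us; split_ands.
  have x1 : ~~ (heavy b && heavy c) by apply: not_near_heavy.
  have := fan _ u cp; move: x1 => /=; rewrite lz1.
  by do 5![case: (heavy _) => //=].
- have [zb1 zb'1 _ _] := zb z1 (mem_head _ _).
  have z2Z : z2 \in [:: z1; z2] by rewrite !inE eqxx orbT.
  have [zb2 zb'2 _ _] := zb z2 z2Z.
  have lz1 := negbTE (lZ z1 (mem_head _ _)); have lz2 := negbTE (lZ z2 z2Z).
  have /= := eZ; rewrite andbT => /and3P[uz1 z12 z2v].
  have nuz2 : ~~ edge u z2.
    apply/negP=> uz2; have := ear [:: z2]; rewrite /= uz2 z2v => /(_ isT isT) H.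
    suff /H : {subset [:: z2] <= [:: z1; z2]} by [].
    by move=> x; rewrite inE => /eqP->.
  have nz1v : ~~ edge z1 v.
    apply/negP=> z1v; have := ear [:: z1]; rewrite /= uz1 z1v => /(_ isT isT) H.
    suff /H : {subset [:: z1] <= [:: z1; z2]} by [].
    by move=> x; rewrite inE => /eqP->; rewrite mem_head.
  have cp : copy 6 (path_edges 6) [:: b'; b; u; z1; z2; v] by copy_solve.
  have := copy_uniq cp isT isT; rewrite /= !inE !negb_or => us; split_ands.
  have x1 : ~~ (heavy b && heavy v) by apply: not_near_heavy.
  have := fan _ u cp; move: x1 => /=; rewrite lz1 lz2.
  by do 4![case: (heavy _) => //=].
set S := [:: z1, z2, z3 & zs] in zb lZ eZ ear.
have z1Z : z1 \in S by rewrite mem_head.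
have z2Z : z2 \in S by rewrite !inE eqxx orbT.
have z3Z : z3 \in S by rewrite !inE eqxx !orbT.
have [zb1 zb'1 _ _] := zb z1 z1Z; have [zb2 zb'2 _ _] := zb z2 z2Z.
have [zb3 zb'3 _ _] := zb z3 z3Z.
have lz1 := negbTE (lZ z1 z1Z); have lz3 := negbTE (lZ z3 z3Z).
have /= /and4P[uz1 z12 z23 p3] := eZ.
have short s : path edge u (rcons s v) -> s != [::] -> {subset s <= S} ->
    size s < size S -> False.
  by move=> ps s0 sS; rewrite ltnNge ear.
have nuz2 : ~~ edge u z2.
  apply/negP=> uz2; apply: (short [:: z2, z3 & zs]) => //; first by rewrite /= uz2 z23.
  by move=> x xs; rewrite inE xs orbT.
have nuz3 : ~~ edge u z3.
  apply/negP=> uz3; apply: (short (z3 :: zs)) => //; first by rewrite /= uz3.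
  by move=> x xs; rewrite !in_cons -in_cons xs !orbT.
have nz13 : ~~ edge z1 z3.
  apply/negP=> z13; apply: (short [:: z1, z3 & zs]) => //; first by rewrite /= uz1 z13.
  by move=> x; rewrite !in_cons => /or3P[]->; rewrite ?orbT.
have cp : copy 6 (path_edges 6) [:: b'; b; u; z1; z2; z3] by copy_solve.
by have := fan _ u cp; rewrite /= lz1 lz3 /= !andbF.
Qed.

Lemma theta_not_wounded (u v : G) zs l2 A m2 l3 B m3 :
  theta_min u v zs l2 A m2 l3 B m3 -> ~ fan_heavy G 6 wounded_edges.
Proof.
move=> thm; have [/andP[s1 uv]|suv] := boolP ((size zs == 1) && edge u v).
  by case: (theta_short_ear thm s1 uv).
by case: (theta_legs_wounded_Z2 thm suv).
Qed.

Lemma theta_not_Z2 (u v : G) zs l2 A m2 l3 B m3 :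
  theta_min u v zs l2 A m2 l3 B m3 -> ~ fan_heavy G 5 (Z_edges 2).
Proof.
move=> thm; have [/andP[s1 uv]|suv] := boolP ((size zs == 1) && edge u v).
  by case: (theta_short_ear thm s1 uv).
by case: (theta_legs_wounded_Z2 thm suv).
Qed.

End ForbiddenCopies.

Lemma fan_heavy_hamiltonian (G : sgraph) :
  kconnected 2 G -> o_heavy claw G ->
  [\/ fan_heavy G 6 (path_edges 6), fan_heavy G 5 (Z_edges 2),
      fan_heavy G 6 net_edges | fan_heavy G 6 wounded_edges] ->
  hamiltonian G.
Proof.
move=> conn2 /claw_o_heavy_near cl fan.
apply: NNPP => nh.
apply: (nonhamiltonian_theta conn2 cl nh) => u v zs l2 A m2 l3 B m3 thm.
case: fan => fan.
- exact: (theta_not_path cl thm fan).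
- exact: (theta_not_Z2 cl thm fan).
- exact: (theta_not_net cl thm fan).
- exact: (theta_not_wounded cl thm fan).
Qed.

Lemma f_heavy_hamiltonian (S G : sgraph) :
  iso S (P_ 4) \/ iso S (P_ 5) \/ iso S (P_ 6) \/ iso S (Z_ 1) \/ iso S (Z_ 2) \/
  iso S bull \/ iso S net \/ iso S wounded ->
  kconnected 2 G -> o_heavy claw G -> f_heavy S G -> hamiltonian G.
Proof.
move=> isoS conn2 hc fS; apply: fan_heavy_hamiltonian => //.
have F k E : iso S (graph_of_edges k E) -> loopless k E -> separated k E ->
    fan_heavy G k E by move=> isoE ll sep; apply: f_heavy_fan isoE ll sep fS.
case: isoS => [/F H|[/F H|[/F H|[/F H|[/F H|[/F H|[/F H|/F H]]]]]]].
- by constructor 1; apply/fan_P5_P6/fan_P4_P5/H.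
- by constructor 1; apply/fan_P5_P6/H.
- by constructor 1; apply: H.
- by constructor 3; apply/fan_bull_net/fan_Z1_bull/H.
- by constructor 2; apply: H.
- by constructor 3; apply/fan_bull_net/H.
- by constructor 3; apply: H.
- by constructor 4; apply: H.
Qed.

(** * The graphs P_{T,T,T} and P_{3,3,3} *)

Section Search.

Variables (eG eH : rel nat) (tgt : seq nat).

Definition compatible (p q : nat * nat) : bool :=
  (p.2 != q.2) && (eG p.1 q.1 == eH p.2 q.2).

(* The recursive call is guarded by a conditional because && is evaluated
   eagerly by vm_compute. *)
Fixpoint embeds (s : seq nat) (acc : seq (nat * nat)) : bool :=
  if s is x :: s' then
    has (fun y => if all (fun p => compatible p (x, y)) acc then embeds s' ((x, y) :: acc)
      else false) tgt
  else true.

(** The searches run on natural numbers, where [vm_compute] is effective; a labelling carries their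
    results back to the graph. *)
Definition labelling (G : sgraph) (e : rel nat) (g : G -> nat) : Prop :=
  injective g /\ {mono g : x y / edge x y >-> e x y}.

Variables (G H : sgraph) (g : G -> nat) (h : H -> nat).
Hypotheses (lG : labelling eG g) (lH : labelling eH h).

Lemma embeds_complete (f : G -> H) (s : seq G) :
  injective f -> {mono f : x y / edge x y} -> uniq s -> (forall y, h y \in tgt) ->
  embeds [seq g x | x <- s] [::].
Proof.
move=> f_inj fE us ht.
rewrite -[[::]]/[seq (g x, h (f x)) | x <- [::] : seq G].
have : {in ([::] : seq G) & s, forall x y, x != y} by [].
elim: s [::] us => //= x s IHs acc /andP[xs us] disj.
apply/hasP; exists (h (f x)) => //; case: ifPn => [_|/negP[]]; last first.
  rewrite all_map; apply/allP => y yacc; rewrite /= /compatible /=.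
  rewrite (inj_eq lH.1) (inj_eq f_inj) lG.2 lH.2 fE eqxx andbT.
  by apply: disj; rewrite ?mem_head.
apply: (IHs (x :: acc)) => // y z; rewrite inE => /predU1P[->|yacc] zs.
  by apply: contraNneq xs => ->.
by apply: disj => //; rewrite inE zs orbT.
Qed.

Lemma embeds_sound (y0 : H) (s : seq G) (t : seq H) :
  symmetric eG -> symmetric eH -> uniq s -> (forall x, x \in s) -> tgt = [seq h y | y <- t] ->
  embeds [seq g x | x <- s] [::] ->
  exists2 f : G -> H, injective f & {mono f : x y / edge x y}.
Proof.
move=> symG symH us all_s tgtE emb.
suff [f _ fc] : exists2 f : G -> H,
    {in s, forall x, all (fun p => compatible p (g x, h (f x))) [::]} &
    {in s &, forall x y, x != y -> compatible (g x, h (f x)) (g y, h (f y))}.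
  have cf x y : x != y -> compatible (g x, h (f x)) (g y, h (f y)) by apply: fc.
  exists f => [x y exy|x y].
    by apply/eqP/negPn/negP=> /cf; rewrite /compatible /= exy eqxx.
  have [<-|/cf] := eqVneq x y; first by rewrite !edge_irrefl.
  by rewrite /compatible /= lG.2 lH.2 => /andP[_ /eqP].
elim: s [::] us emb {all_s} => [|x s IHs] acc /=; first by exists (fun _ => y0).
case/andP=> xs us /hasP[y']; rewrite tgtE => /mapP[y _ ->{y'}]; case: ifP => // ca.
case/(IHs _ us) => f fa fc; exists (fun z => if z == x then y else f z).
  move=> z; rewrite inE; case: eqP => [-> _|_] //= zs.
  by have /andP[] := fa z zs.
have sym p q : compatible p q = compatible q p.
  by rewrite /compatible eq_sym symG symH.
move=> z w; rewrite !inE; case: (eqVneq z x) => [->|zx] /=; case: (eqVneq w x) => [->|wx] //=.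
- by move=> _ ws _; have /andP[] := fa w ws.
- by move=> zs _ _; have /andP[+ _] := fa z zs; rewrite sym.
- exact: fc.
Qed.

End Search.

Lemma iso_of_embedding (G H : sgraph) (f : G -> H) :
  injective f -> {mono f : x y / edge x y} -> #|H| <= #|G| -> iso G H.
Proof. by move=> f_inj fE cGH; exists f => //; apply: inj_card_bij. Qed.

(* That r is closed under adjacency is tested, so nothing has to be proved about
   the iteration that computes it. *)
Definition split_off (e : rel nat) (s : seq nat) : bool :=
  let r := iter (size s) (fun r => [seq y <- s | (y \in r) || has (e y) r]) [:: head 0 s] in
  [&& all (fun x => all (fun y => (x \in r) && e x y ==> (y \in r)) s) s,
      head 0 s \in r & ~~ all (mem r) s].

Lemma connected_not_split_off (G : sgraph) e (g : G -> nat) (s : seq G) :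
  labelling e g -> connected G -> (forall x, x \in s) ->
  ~~ split_off e [seq g x | x <- s].
Proof.
move=> [_ gE] [G0 conn] all_s; rewrite /split_off.
case: s all_s => [|x0 s] all_s; first by case/card_gt0P: G0 => x _; have := all_s x.
move: (iter _ _ _) => r; rewrite [head _ _]/=.
apply/and3P=> -[clos r0 /allPn[_ /mapP[y ys ->] /negP[]]].
have step a b : edge a b -> g a \in r -> g b \in r.
  rewrite -gE => ab ra; have /allP/(_ _ (map_f g (all_s a)))/allP := clos.
  by move/(_ _ (map_f g (all_s b)))/implyP; rewrite ra ab; apply.
case/connectP: (conn x0 y) => p + -> /=; elim: p x0 r0 {ys clos all_s} => //= b p IHs x0 r0.
by case/andP=> /step/(_ r0)/IHs H /H.
Qed.

Fixpoint sublists (s : seq nat) : seq (seq nat) :=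
  if s is x :: s' then sublists s' ++ [seq x :: t | t <- sublists s'] else [:: [::]].

Lemma mem_sublists s t : subseq s t -> s \in sublists t.
Proof.
elim: t s => [|y t IHt] s /=; first by move/eqP->.
rewrite mem_cat; case: s => [_|x s]; first by rewrite IHt ?sub0seq.
case: eqP => [->|_] st; last by rewrite IHt.
by rewrite orbC map_f // IHt.
Qed.

Lemma labelling_graph n E : loopless n E -> labelling (adj E) (val : graph_of_edges n E -> nat).
Proof.
move=> ll; split=> [|x y /=]; first exact: val_inj.
rewrite /edges_rel -/(adj E x y); have [<-|//] := eqVneq x y.
by have /allP/(_ (val x)) := ll; rewrite mem_iota => /(_ (ltn_ord x))/negbTE.
Qed.

Lemma labelling_induced (G : sgraph) e g (A : {set G}) :
  labelling e g -> labelling e (fun x : induced A => g (val x)).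
Proof. by case=> g_inj gE; split=> [x y /g_inj/val_inj|x y]; rewrite /= ?gE. Qed.

Definition listing n E (A : {set graph_of_edges n E}) : seq (induced A) :=
  pmap insub (enum 'I_n).

Lemma listing_uniq n E (A : {set graph_of_edges n E}) : uniq (listing A).
Proof. by rewrite pmap_sub_uniq // enum_uniq. Qed.

Lemma mem_listing n E (A : {set graph_of_edges n E}) x : x \in listing A.
Proof. by rewrite mem_pmap_sub mem_enum. Qed.

Lemma listing_sub n E (A : {set graph_of_edges n E}) :
  [seq val (val x) | x <- listing A] \in sublists (iota 0 n).
Proof.
rewrite mem_sublists // -val_enum_ord (map_comp val val) map_subseq //.
rewrite pmap_filter; [exact: filter_subseq | exact: insubK].
Qed.

Lemma path_connected (G : sgraph) (A : {set G}) (x0 : G) p :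
  path edge x0 p -> x0 :: p =i A -> connected (induced A).
Proof.
move=> pp pA; have A0 : x0 \in A by rewrite -pA mem_head.
pose inA x (xA : x \in A) : induced A := exist (fun x => x \in A) x xA.
have inA_val (y : induced A) x (xA : x \in A) : val y = x -> y = inA x xA.
  by move=> ey; apply: val_inj.
have from (y : induced A) q x (xA : x \in A) : path edge x q -> {subset q <= A} ->
    val y \in x :: q -> connect edge (inA x xA) y.
  elim: q x xA => [|z q IHq] x xA /=.
    by move=> _ _; rewrite inE => /eqP/inA_val <-.
  case/andP=> xz pq qA; rewrite inE => /predU1P[/inA_val <- //|yq].
  have zA : z \in A by apply: qA; apply: mem_head.
  apply: connect_trans (IHq z zA pq _ yq); first by apply: connect1.
  by move=> w wq; apply: qA; rewrite inE wq orbT.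
have from0 y : connect edge (inA x0 A0) y.
  by apply: from pp _ _ => [x xp|]; rewrite -?pA ?inE ?xp ?orbT // -in_cons pA (valP y).
split=> [|x y]; first by apply/card_gt0P; exists (inA x0 A0).
by apply: connect_trans (from0 y); rewrite (sym_connect_sym (@edge_sym (induced A))).
Qed.

(* P_{T,T,T} with the chords and P_{3,3,3} without: the triangles 012 and 345 are
   joined by the paths i, i+6, i+3, and in P_{T,T,T} also by the edges i, i+3. *)
Definition prism_edges (chords : bool) : seq (nat * nat) :=
  [:: (0, 1); (1, 2); (0, 2); (3, 4); (4, 5); (3, 5);
      (0, 6); (3, 6); (1, 7); (4, 7); (2, 8); (5, 8)] ++
  (if chords then [:: (0, 3); (1, 4); (2, 5)] else [::]).

Definition prism b := graph_of_edges 9 (prism_edges b).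

Lemma labelling_prism b : labelling (adj (prism_edges b)) (val : prism b -> nat).
Proof. by apply: labelling_graph; case: b. Qed.

Fixpoint extends_to_cycle (e : rel nat) n k x0 x vis : bool :=
  if k is k'.+1 then
    has (fun y => if e x y && (y \notin vis) then extends_to_cycle e n k' x0 y (y :: vis)
      else false) (iota 0 n)
  else e x x0.

Lemma extends_to_cycleP (e : rel nat) n x0 x p vis :
  path e x (rcons p x0) -> uniq p -> {in p, forall y, y \notin vis} ->
  {in p, forall y, y < n} -> extends_to_cycle e n (size p) x0 x vis.
Proof.
elim: p x vis => [|y p IHp] x vis /=; first by case/andP.
case/andP=> xy pp /andP[yp up] dis bnd; apply/hasP; exists y.
  by rewrite mem_iota; apply: bnd; apply: mem_head.
rewrite xy dis ?mem_head //; apply: IHp => // z zp; last by apply: bnd; rewrite inE zp orbT.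
by rewrite inE negb_or dis ?inE ?zp ?orbT // andbT; apply: contraNneq yp => <-.
Qed.

Lemma prism_no_cycle b : ~~ extends_to_cycle (adj (prism_edges b)) 9 8 0 0 [:: 0].
Proof. by case: b; vm_compute. Qed.

Lemma prism_not_hamiltonian b : ~ hamiltonian (prism b).
Proof.
case=> c [_ /andP[cc uc] allc]; pose x0 : prism b := ord0 : 'I_9.
have [i s rc] := rot_to (allc x0).
have cs : cycle edge (x0 :: s) by rewrite -rc rot_cycle.
have us : uniq (x0 :: s) by rewrite -rc rot_uniq.
have sz : size s = 8.
  apply: succn_inj; rewrite -[(size s).+1]/(size (x0 :: s)).
  rewrite -(card_uniqP us) -[RHS](card_ord 9); apply: eq_card => x.
  by rewrite -rc mem_rot allc.
have : extends_to_cycle (adj (prism_edges b)) 9 (size (map val s)) (val x0) (val x0) [:: val x0].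
  have [_ ge] := labelling_prism b.
  apply: extends_to_cycleP.
  - by rewrite -map_rcons path_map; apply: sub_path cs => x y; rewrite -ge.
  - by rewrite map_inj_uniq; [case/andP: us | exact: val_inj].
  - move=> _ /mapP[x xs ->]; rewrite inE; have /andP[] := us.
    by move=> + _; apply: contra => /eqP/val_inj <-.
  - by move=> _ /mapP[x _ ->]; apply: ltn_ord.
by rewrite size_map sz; apply/negP/prism_no_cycle.
Qed.

(* The i-th path spans the prism without its vertex i, the last one (i = 9) the
   whole prism. *)
Definition prism_paths : seq (seq nat) :=
  [:: [:: 6; 3; 4; 7; 1; 2; 8; 5]; [:: 7; 4; 3; 6; 0; 2; 8; 5]; [:: 8; 5; 3; 6; 0; 1; 7; 4];
      [:: 6; 0; 1; 7; 4; 5; 8; 2]; [:: 7; 1; 0; 6; 3; 5; 8; 2]; [:: 8; 2; 0; 6; 3; 4; 7; 1];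
      [:: 0; 2; 8; 5; 3; 4; 7; 1]; [:: 1; 2; 8; 5; 4; 3; 6; 0]; [:: 2; 1; 7; 4; 5; 3; 6; 0];
      [:: 6; 3; 4; 7; 1; 0; 2; 8; 5]].

Lemma prism_paths_span b : all (fun i =>
    [&& path (adj (prism_edges b)) (head 0 (nth [::] prism_paths i))
          (behead (nth [::] prism_paths i)),
        all (fun j => j < 9) (nth [::] prism_paths i) &
        all (fun j => (j \in nth [::] prism_paths i) == (j != i)) (iota 0 9)])
  (iota 0 10).
Proof. by case: b. Qed.

Lemma prism_2connected b : kconnected 2 (prism b).
Proof.
split=> [|X cX]; first by rewrite card_ord.
(* The value 9 of [k] stands for an empty [X], in accordance with the indexing of [prism_paths]. *)
have [k X_k] : exists k : 'I_10, forall x : prism b, (x \in X) = (val x == val k).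
  case: (posnP #|X|) => [/eqP|X0].
    rewrite cards_eq0 => /eqP->; exists ord_max => x.
    by rewrite in_set0; apply/esym/negbTE; rewrite neq_ltn /= ltn_ord.
  have /cards1P[a ->] : #|X| == 1 by rewrite eqn_leq X0 -ltnS cX.
  by exists (widen_ord (leqnSn 9) a) => x; rewrite in_set1.
have k10 : val k \in iota 0 10 by rewrite mem_iota ltn_ord.
have /allP/(_ _ k10) := prism_paths_span b.
move: (nth _ _ _) => p /and3P[pp bnd /allP pE].
have [_ ge] := labelling_prism b.
have : map val (map inord p : seq (prism b)) = p.
  rewrite -map_comp -[RHS]map_id; apply/eq_in_map => j /(allP bnd) jn /=.
  by rewrite inordK.
move: (map inord p) => q qE; subst p.
have memq x : (x \in q) = (x \notin X).
  rewrite X_k -(mem_map val_inj); apply/eqP/pE; by rewrite mem_iota ltn_ord.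
case: q pp memq {bnd pE} => [|x0 q] pp memq.
  have : exists x : prism b, x \notin X.
    apply/existsP; apply: contraTT cX; rewrite negb_exists => /forallP aX.
    by rewrite -leqNgt (eq_card (B := predT)) ?card_ord // => x; have := aX x; rewrite negbK.
  by case=> x; rewrite -memq.
apply: (@path_connected (prism b) (~: X) x0 q) => [|x]; last by rewrite memq in_setC.
move: pp; rewrite /= path_map; apply: sub_path => x y; by rewrite /= ge.
Qed.

Definition claw_edges := [:: (0, 1); (0, 2); (0, 3)].

Lemma prism_claw_free b :
  ~~ embeds (adj claw_edges) (adj (prism_edges b)) (iota 0 9) (iota 0 4) [::].
Proof. by case: b; vm_compute. Qed.

(** The condition holds vacuously, as the search finds no induced claw. *)
Lemma prism_o_heavy b : o_heavy claw (prism b).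
Proof.
move=> A /iso_sym[f bf fE]; case/negP: (prism_claw_free b).
rewrite -[iota 0 4]val_enum_ord.
have lc : labelling (adj claw_edges) (val : claw -> nat) by apply: labelling_graph.
apply: (embeds_complete lc (labelling_prism b) (f := val \o f)).
- by apply: inj_comp val_inj _; apply: bij_inj.
- by move=> x y; rewrite -fE.
- exact: enum_uniq.
- by move=> y; rewrite mem_iota ltn_ord.
Qed.

Definition f_heavy_family : seq (nat * seq (nat * nat)) :=
  [:: (4, path_edges 4); (5, path_edges 5); (6, path_edges 6); (4, Z_edges 1); (5, Z_edges 2);
      (5, bull_edges); (6, net_edges); (6, wounded_edges)].

(** With equal numbers of vertices an induced embedding is an isomorphism. *)
Definition isomorphic_to (e : rel nat) (s : seq nat) (p : nat * seq (nat * nat)) : bool :=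
  if size s == p.1 then embeds (adj p.2) e s (iota 0 p.1) [::] else false.

Definition common_subgraph_ok (s : seq nat) : bool :=
  let e := adj (prism_edges true) in
  if split_off e s then true
  else if all (fun x => all (fun y => (x == y) || e x y) s) s then true
  else if has (isomorphic_to e s) ((3, path_edges 3) :: f_heavy_family) then true
  else ~~ embeds e (adj (prism_edges false)) (iota 0 9) s [::].

Lemma prism_common_subgraph : all common_subgraph_ok (sublists (iota 0 9)).
Proof. by vm_compute. Qed.

(** If every copy of [S] were complete, none would contain a pair at distance two and $f$-heaviness
    would hold vacuously. *)
Lemma not_f_heavy_copy (S G : sgraph) : ~ f_heavy S G ->
  exists A : {set G}, iso (induced A) S /\ exists u v : induced A, u != v /\ ~~ edge u v.
Proof.
move=> nf; apply: NNPP => none; apply: nf => A isoA u v [[p [pp lp sp]] uv_min].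
case: none; exists A; split=> //; exists u, v; split; apply/negP.
  by move=> /eqP e; have := uv_min [::] isT e.
by move=> e; suff: 2 <= 1 by []; apply: (uv_min [:: v]) => //; apply/andP.
Qed.

Lemma common_subgraph (S : sgraph) : connected S -> ~ iso S (P_ 3) ->
  (forall b, exists A : {set prism b}, iso (induced A) S /\
     exists u v : induced A, u != v /\ ~~ edge u v) ->
  exists2 p, p \in f_heavy_family & iso S (graph_of_edges p.1 p.2).
Proof.
move=> connS SnP3 cpy.
have [A [isoA [u [v [uv nuv]]]]] := cpy true.
have [B [isoB _]] := cpy false.
have lA := labelling_induced A (labelling_prism true).
set g := fun x : induced A => _ in lA.
have lB := labelling_induced B (labelling_prism false).
have connA : connected (induced A).
  case: isoA => f [f' fK f'K] fE; case: connS => _ conn.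
  split=> [|x y]; first by apply/card_gt0P; exists u.
  case/connectP: (conn (f x) (f y)) => p pp lp; apply/connectP; exists (map f' p).
    rewrite -[x]fK path_map; apply: sub_path pp => a b ab.
    by have /esym := fE (f' a) (f' b); rewrite !f'K ab.
  by rewrite -[x]fK last_map -lp fK.
have /allP/(_ _ (listing_sub A)) := prism_common_subgraph.
rewrite /common_subgraph_ok -/g (negbTE (connected_not_split_off lA connA (@mem_listing _ _ A))).
case: ifPn => [/allP/(_ _ (map_f g (mem_listing u)))/allP/(_ _ (map_f g (mem_listing v)))|_].
  by rewrite (inj_eq lA.1) lA.2 (negbTE uv) (negbTE nuv).
have [/iso_sym isoA' uniqA] := (isoA, listing_uniq A).
(* If [S] is not recognised, its two copies compose to an embedding of [A] into the graph without
   chords, which the search has ruled out. *)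
case: ifPn => [/hasP[[k E] kE]|_]; last first.
  have [f bf fE] := iso_trans isoA (iso_sym isoB).
  case/negP; apply: (embeds_complete lA lB (f := f)) => //; first exact: bij_inj.
  by move=> y; rewrite mem_iota ltn_ord.
rewrite /isomorphic_to /=; case: eqP => // sk emb.
suff isoE : iso S (graph_of_edges k E).
  move: kE; rewrite inE => /predU1P[[ek eE]|kE]; last by exists (k, E).
  by case: SnP3; move: isoE; rewrite ek eE.
apply: iso_trans isoA' _; apply: iso_sym.
have ll : loopless k E.
  have : all (fun p => loopless p.1 p.2) ((3, path_edges 3) :: f_heavy_family) by [].
  by move/allP/(_ _ kE).
have lE := labelling_graph ll.
rewrite -val_enum_ord in emb.
have sym F : symmetric (adj F) by apply: adj_sym.
have [f f_inj fE] := embeds_sound lE lA u (sym _) (sym _) (enum_uniq _) (@mem_enum _ _) erefl emb.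
apply: (iso_of_embedding f_inj fE).
rewrite card_ord -sk size_map -(card_uniqP uniqA); apply/eq_leq/eq_card => x.
by rewrite mem_listing.
Qed.

Lemma f_heavy_familyP (S : sgraph) p : p \in f_heavy_family -> iso S (graph_of_edges p.1 p.2) ->
  iso S (P_ 4) \/ iso S (P_ 5) \/ iso S (P_ 6) \/ iso S (Z_ 1) \/ iso S (Z_ 2) \/
  iso S bull \/ iso S net \/ iso S wounded.
Proof. by rewrite !inE; do 7![case/predU1P => [->|]; first tauto]; move/eqP->; tauto. Qed.

Theorem theorem14 (S : sgraph) (connS : connected S) (SnP3 : ~ iso S (P_ 3)) :
  (forall G : sgraph,
     kconnected 2 G -> o_heavy claw G -> f_heavy S G -> hamiltonian G)
  <->
  (iso S (P_ 4) \/ iso S (P_ 5) \/ iso S (P_ 6) \/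
   iso S (Z_ 1) \/ iso S (Z_ 2) \/
   iso S bull \/ iso S net \/ iso S wounded).
Proof.
split=> [ham|isoS G]; last exact: f_heavy_hamiltonian isoS.
have [p pF isoS] : exists2 p, p \in f_heavy_family & iso S (graph_of_edges p.1 p.2).
  (* A prism that were [S]-$f$-heavy would be Hamiltonian by [ham]; the failure of $f$-heaviness is
     the source of the copies of [S]. *)
  apply: common_subgraph => // b; apply: not_f_heavy_copy => fS.
  apply: (@prism_not_hamiltonian b); apply: ham fS.
    exact: prism_2connected.
  exact: prism_o_heavy.
exact: f_heavy_familyP pF isoS.
Qed.
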